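(* Let $d\ge1$ be an integer, $\beta\in(0,1]$, $\alpha>0$ with $\alpha\beta\le1$, and $\gamma=\frac{\beta(1+\alpha)}{2\beta+d}$. Fix the class constants $L,D_0>0$, $\delta_0\in(0,1)$, $0<\underline c\le\bar c$, any constant $D_1>0$, and constants $0<a_1\le a_2$. For a suitable choice of the positive constants $l_i$ in the grid (bounded above and below by positive constants independent of $T$ and $M$), there is a constant $\tilde C>0$ independent of $T$ and $M$ such that the following holds for all $T\ge2$ and $1\le M\le D_1\log T$. Let $b\in[a_1T^{\frac{1-\gamma}{1-\gamma^M}},\,a_2T^{\frac{1-\gamma}{1-\gamma^M}}]$, let the split factors satisfy $$g_0=\lfloor b^{\frac1{2\beta+d}}\rfloor,\qquad g_i=\lfloor g_{i-1}^{\gamma}\rfloor\ (1\le i\le M-2),\qquad g_{M-1}=1,$$ set $w_i=(\prod_{l=0}^{i-1}g_l)^{-1}$, and let the grid $0=t_0<t_1<\dots<t_{M-1}<t_M=T$ satisfy $$t_i-t_{i-1}=\lfloor l_i\,w_i^{-(2\beta+d)}\log(Tw_i^d)\rfloor,\qquad 1\le i\le M-1.$$ Then the policy $\hat\pi$ given by the algorithm \texttt{BaSEDB} (described in the context) with this grid and these split factors satisfies, on every instance in $\mathcal F(\alpha,\beta)$, $$R_T(\hat\pi)\ \le\ \tilde C(\log T)^2\, T^{\frac{1-\gamma}{1-\gamma^{M}}}.$$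
   Context: **Bandit instance.** A two-arm nonparametric bandit with horizon $T$ is given by i.i.d. random vectors $(X_t,Y_t^{(1)},Y_t^{(-1)})$, $t=1,\dots,T$, where $X_t\in\mathcal X=[0,1]^d$ has law $P_X$ with Lebesgue density bounded between $\underline c$ and $\bar c$ ($0<\underline c\le\bar c$), $Y_t^{(k)}\in[0,1]$, and $\mathbb E[Y_t^{(k)}\mid X_t]=f^{(k)}(X_t)$ for $k\in\{1,-1\}$. Write $f^\star=\max_k f^{(k)}$. **Class $\mathcal F(\alpha,\beta)$.** The set of bandit instances such that: (Smoothness) $|f^{(k)}(x)-f^{(k)}(x')|\le L\|x-x'\|_2^\beta$ for all $x,x'\in\mathcal X$, $k\in\{1,-1\}$; (Margin) $\mathbb P_X(0<|f^{(1)}(X)-f^{(-1)}(X)|\le\delta)\le D_0\delta^\alpha$ for all $\delta\in[0,\delta_0]$. **Regret.** If $\pi_t(X_t)$ is the arm pulled at time $t$, $R_T(\pi)=\mathbb E\big[\sum_{t=1}^T(f^\star(X_t)-f^{(\pi_t(X_t))}(X_t))\big]$. **Algorithm \texttt{BaSEDB}** (batched successive elimination with dynamic binning). Input: $M$, grid $\{t_i\}_{i=0}^M$, split factors $\{g_i\}_{i=0}^{M-1}$. For $i\ge1$ let $\mathcal B_i$ be the regular partition of $\mathcal X$ into cubes (bins) $\{x:(v_j-1)w_i\le x_j<v_jw_i,\ 1\le j\le d\}$, $v\in\{1,\dots,1/w_i\}^d$, of width $w_i$. For a bin $C$ let $|C|$ be its width, and let $\mathrm{child}(C,g)$ be the regular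 partition of $C$ into $g^d$ cubes of width $|C|/g$. The algorithm maintains a partition $\mathcal L$ of $\mathcal X$ into active bins and, for each $C\in\mathcal L$, an active arm set $\mathcal I_C\subseteq\{1,-1\}$; initially $\mathcal L=\mathcal B_1$ and $\mathcal I_C=\{1,-1\}$ for all $C$. - For batch $i=1,\dots,M-1$: for $t=t_{i-1}+1,\dots,t_i$, let $C\in\mathcal L$ be the bin containing $X_t$ and pull an arm of $\mathcal I_C$ in round-robin fashion within the bin. Rewards of the batch are revealed at time $t_i$. Then each $C\in\mathcal L$ with $|\mathcal I_C|=1$ is kept unchanged. For each $C\in\mathcal L$ with $|\mathcal I_C|=2$, let $m_{C,i}=\sum_{t=t_{i-1}+1}^{t_i}\mathbf 1\{X_t\in C\}$, let $\bar Y^{(k)}_{C,i}$ be the average of the rewards obtained from arm $k$ at times $t$ in batch $i$ with $X_t\in C$, and remove from $\mathcal I_C$ every arm $k$ with $\max_{k'\in\mathcal I_C}\bar Y^{(k')}_{C,i}-\bar Y^{(k)}_{C,i}>U(m_{C,i},T,C)$, where $U(\tau,T,C)=4\sqrt{\log(2T|C|^d)/\tau}$. If still $|\mathcal I_C|>1$, replace $C$ in $\mathcal L$ by the bins of $\mathrm{child}(C,g_i)$, each inheriting the arm set $\mathcal I_C$; otherwise keep $C$ in $\mathcal L$. - For $t=t_{M-1}+1,\dots,T$: pull any arm of $\mathcal I_C$, where $C\in\mathcal L$ is the bin containing $X_t$. *)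

(* Defs.v *)
From HB Require Import structures.
From mathcomp Require Import all_boot all_order all_algebra.
From mathcomp Require Import all_classical all_reals all_analysis.

Set Implicit Arguments.
Unset Strict Implicit.
Unset Printing Implicit Defensive.

Import Order.TTheory GRing.Theory Num.Theory.
Import numFieldNormedType.Exports.

Local Open Scope classical_set_scope.
Local Open Scope ring_scope.

(* MathComp-Analysis world.  Points of R^d are [d.-tuple R]
   with the product Borel sigma-algebra.  Arms are booleans: [true] is arm 1,
   [false] is arm -1.  Rounds are numbered from 0, so round [s] is time
   t = s + 1 and batch i (1 <= i <= M) is the set of rounds s with
   t_{i-1} <= s < t_i. *)

(* Lebesgue measure on R^n, as an iterated product. *)
Section LebesgueTuple.
Context {R : realType}.

Definition cons_pair n (p : measurableTypeR R * n.-tuple R) : n.+1.-tuple R :=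
  [tuple of p.1 :: p.2].

Lemma measurable_cons_pair n : measurable_fun setT (@cons_pair n).
Proof. exact: measurable_cons measurable_fst measurable_snd. Qed.

Section Step.
Context n (m : {sigma_finite_measure set (n.-tuple R) -> \bar R}).

Definition lebesgue_cons : set (n.+1.-tuple R) -> \bar R :=
  pushforward (lebesgue_measure \x m)%E (@cons_pair n).

Let lebesgue_cons0 : lebesgue_cons set0 = 0%E.
Proof. by rewrite /lebesgue_cons /pushforward preimage_set0 measure0. Qed.

Let lebesgue_cons_ge0 A : (0 <= lebesgue_cons A)%E.
Proof. by rewrite /lebesgue_cons /pushforward measure_ge0. Qed.

Let lebesgue_cons_sigma_additive : semi_sigma_additive lebesgue_cons.
Proof.
have mpre A : measurable A -> measurable (@cons_pair n @^-1` A).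
  by move=> mA; rewrite -[X in measurable X]setTI; exact: measurable_cons_pair.
move=> F mF tF mUF; rewrite /lebesgue_cons /pushforward preimage_bigcup.
apply: measure_semi_sigma_additive.
- by move=> k; exact: mpre.
- apply/trivIsetP => i j _ _ ij; rewrite -preimage_setI.
  by move/trivIsetP : tF => /(_ _ _ _ _ ij) ->//; rewrite preimage_set0.
- by rewrite -preimage_bigcup; exact: mpre.
Qed.

HB.instance Definition _ := isMeasure.Build _ _ _ lebesgue_cons
  lebesgue_cons0 lebesgue_cons_ge0 lebesgue_cons_sigma_additive.

Let lebesgue_cons_sigma_finite : sigma_finite setT lebesgue_cons.
Proof.
pose split (z : n.+1.-tuple R) : measurableTypeR R * n.-tuple R :=
  (thead z, [tuple of behead z]).
have msplit : measurable_fun setT split.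
  apply/measurable_fun_pairP; split; first exact: measurable_tnth.
  exact: measurable_behead.
have consK p : split (cons_pair p) = p.
  by case: p => x t; rewrite /split theadE; congr (x, _); exact: val_inj.
have /sigma_finiteP[F [TF ndF Foo]] := sigma_finiteT (@lebesgue_measure R).
have /sigma_finiteP[G [TG ndG Goo]] := sigma_finiteT m.
exists (fun k => split @^-1` (F k `*` G k)).
  apply/esym; rewrite -subTset => z _.
  have [i _ Fi] : (\bigcup_i F i) (split z).1 by rewrite -TF.
  have [j _ Gj] : (\bigcup_j G j) (split z).2 by rewrite -TG.
  exists (maxn i j) => //; split.
    by move: Fi; exact/subsetPset/ndF/leq_maxl.
  by move: Gj; exact/subsetPset/ndG/leq_maxr.
move=> k; have [mF Fk] := Foo k; have [mG Gk] := Goo k.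
have mFG : measurable (F k `*` G k) by exact: measurableX.
split; first by rewrite -[X in measurable X]setTI; exact: msplit.
rewrite /lebesgue_cons /pushforward.
have -> : @cons_pair n @^-1` (split @^-1` (F k `*` G k)) = F k `*` G k.
  by apply/funext => p; rewrite /preimage /mkset consK.
by rewrite product_measure1E// lte_mul_pinfty// ge0_fin_numE.
Qed.

HB.instance Definition _ := Measure_isSigmaFinite.Build _ _ _
  lebesgue_cons lebesgue_cons_sigma_finite.

End Step.

Fixpoint lebesgue_tuple n : {sigma_finite_measure set (n.-tuple R) -> \bar R} :=
  match n with
  | 0 => \d_([tuple] : 0.-tuple R)
  | n'.+1 => lebesgue_cons (lebesgue_tuple n')
  end.

End LebesgueTuple.

Section Independence.
Context {R : realType} dO (Omega : measurableType dO) (P : probability Omega R).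
Context dS (S : measurableType dS).

Definition mutually_independent (I : finType) (Z : I -> Omega -> S) : Prop :=
  forall (J : {set I}) (A : I -> set S), (forall i, measurable (A i)) ->
    P (\bigcap_(i in [set` J]) (Z i @^-1` A i)) =
    (\prod_(i in J) P (Z i @^-1` A i))%E.

End Independence.

(* An observation (x, (y1, y2)): covariate, reward of arm 1, reward of arm -1. *)
Notation obs R d := (d.-tuple R * (R * R))%type.

Section Bandit.
Context {R : realType} {d : nat}.

Local Notation point := (d.-tuple R).

Definition ctx (z : obs R d) : point := z.1.
Definition reward (k : bool) (z : obs R d) : R := if k then z.2.1 else z.2.2.

Definition cube : set point := [set x | forall j, 0 <= tnth x j <= 1].

Definition admissible (z : obs R d) : Prop :=
  cube (ctx z) /\ forall k, 0 <= reward k z <= 1.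

Definition dist2 (x x' : point) : R :=
  Num.sqrt (\sum_(j < d) (tnth x j - tnth x' j) ^+ 2).

Definition has_bounded_density (cl cu : R) (Q : probability (obs R d) R) : Prop :=
  exists p : point -> R,
    [/\ measurable_fun setT p,
        forall x, cube x -> cl <= p x <= cu &
        forall A : set point, measurable A ->
          Q (ctx @^-1` A) = (\int[lebesgue_tuple d]_(x in A `&` cube) (p x)%:E)%E].

(* [f k] is a version of E[Y^(k) | X = .]; its values off the cube are
   irrelevant. *)
Definition is_regression (Q : probability (obs R d) R) (f : bool -> point -> R) :
    Prop :=
  forall k, measurable_fun cube (f k) /\
    forall B : set point, measurable B -> B `<=` cube ->
      (\int[Q]_(z in ctx @^-1` B) (reward k z)%:E =
       \int[Q]_(z in ctx @^-1` B) (f k (ctx z))%:E)%E.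

(* A bandit instance is given by the common law [Q] of the vectors
   (X_t, Y_t^(1), Y_t^(-1)) together with the regression functions [f]. *)
Definition bandit_instance (cl cu : R) (Q : probability (obs R d) R)
    (f : bool -> point -> R) : Prop :=
  [/\ {ae Q, forall z, admissible z},
      has_bounded_density cl cu Q &
      is_regression Q f].

Definition smooth (L beta : R) (f : bool -> point -> R) : Prop :=
  forall k x x', cube x -> cube x' ->
    `|f k x - f k x'| <= L * dist2 x x' `^ beta.

Definition margin (D0 delta0 alpha : R) (Q : probability (obs R d) R)
    (f : bool -> point -> R) : Prop :=
  forall delta, 0 <= delta <= delta0 ->
    (Q [set z | cube (ctx z) /\
                (0 < `|f true (ctx z) - f false (ctx z)| <= delta)%R]
     <= (D0 * delta `^ alpha)%:E)%E.

Definition bandit_class (L D0 delta0 cl cu alpha beta : R)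
    (Q : probability (obs R d) R) (f : bool -> point -> R) : Prop :=
  [/\ bandit_instance cl cu Q f,
      smooth L beta f &
      margin D0 delta0 alpha Q f].

(* The vectors (X_t, Y_t^(1), Y_t^(-1)) of the rounds 0, ..., T-1, i.i.d. with
   law [Q]; the values of [Z] at later rounds are irrelevant. *)
Definition iid_sample dO (Omega : measurableType dO) (P : probability Omega R)
    (T : nat) (Q : probability (obs R d) R) (Z : nat -> {RV P >-> obs R d}) : Prop :=
  [/\ forall s w, (s < T)%N -> admissible (Z s w),
      forall s A, (s < T)%N -> measurable A -> distribution P (Z s) A = Q A &
      mutually_independent P (fun s : 'I_T => Z s : Omega -> obs R d)].

End Bandit.

Section Policy.
Context {R : realType} {d : nat}.
Variables (M : nat) (t : nat -> nat).

(* The rewards of the rounds [j < revealed s] are those of the batches that are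
   complete when round [s] starts. *)
Definition revealed (s : nat) : nat := \max_(i < M | (t i <= s)%N) t i.

(* A batched policy: the arm pulled at round [s] is a function of the covariates
   of the rounds 0, ..., s and of the rewards observed in past batches. *)
Definition policy : Type :=
  forall s, (s.+1.-tuple (d.-tuple R) * (revealed s).-tuple R)%type -> bool.

Definition measurable_policy (pi : policy) : Prop :=
  forall s, measurable_fun setT (pi s).

(* arms pulled by [pi] on the data [z] at the rounds 0, ..., n-1 *)
Fixpoint arms (pi : policy) (z : nat -> obs R d) (n : nat) : seq bool :=
  match n with
  | 0 => [::]
  | s.+1 => rcons (arms pi z s)
      (pi s ([tuple ctx (z j) | j < s.+1],
             [tuple reward (nth true (arms pi z s) j) (z j) | j < revealed s]))
  end.

Definition pulled (pi : policy) (z : nat -> obs R d) (s : nat) : bool :=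
  nth true (arms pi z s.+1) s.

Definition regret dO (Omega : measurableType dO) (P : probability Omega R)
    (T : nat) (f : bool -> d.-tuple R -> R) (Z : nat -> {RV P >-> obs R d})
    (pi : policy) : \bar R :=
  'E_P[fun w => (\sum_(s < T)
     (Num.max (f true (ctx (Z s w))) (f false (ctx (Z s w)))
      - f (pulled pi (fun s' => Z s' w) s) (ctx (Z s w))))%R]%E.

End Policy.

Section BaSEDB.
Context {R : realType} {d : nat}.

(* The bin [(n, v)] is the cube of width 1/n with lower corner v/n; all widths
   are of this form since a bin is split into g^d bins of width 1/(n g).  Bins
   are half-open: a point with a coordinate equal to 1 lies in no bin, and the
   arm pulled there is unconstrained (such points have P_X-measure 0). *)
Definition bin : Type := (nat * d.-tuple nat)%type.

Definition width (C : bin) : R := C.1%:R^-1.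

Definition in_bin (C : bin) (x : d.-tuple R) : bool :=
  [forall j, (tnth C.2 j)%:R * width C <= tnth x j <
             (tnth C.2 j).+1%:R * width C].

Definition child (C : bin) (g : nat) : seq bin :=
  [seq (C.1 * g, [tuple tnth C.2 j * g + u j | j < d])%N
  | u : {ffun 'I_d -> 'I_g}].

Definition root : bin := (1%N, [tuple 0%N | _ < d]).

Variables (T : nat) (t g : nat -> nat).

Definition threshold (tau : nat) (C : bin) : R :=
  4 * Num.sqrt (ln (2 * T%:R * width C ^+ d) / tau%:R).

Section Data.
Variables (z : nat -> obs R d) (a : nat -> bool).

Definition batch (i : nat) : seq nat := iota (t i.-1) (t i - t i.-1).

Definition visits (i : nat) (C : bin) : seq nat :=
  [seq s <- batch i | in_bin C (ctx (z s))].

Definition mean_reward (i : nat) (C : bin) (k : bool) : R :=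
  (\sum_(s <- visits i C | a s == k) reward k (z s))
  / (count (fun s => a s == k) (visits i C))%:R.

Definition surviving (i : nat) (C : bin) : {set bool} :=
  [set k | Num.max (mean_reward i C true) (mean_reward i C false)
           - mean_reward i C k <= threshold (size (visits i C)) C].

(* Each active bin is paired with its set of active arms. *)
Definition update (i : nat) (CI : bin * {set bool}) : seq (bin * {set bool}) :=
  if #|CI.2| == 2%N then
    let I' := surviving i CI.1 in
    if (1 < #|I'|)%N then [seq (C', I') | C' <- child CI.1 (g i)]
    else [:: (CI.1, I')]
  else [:: CI].

(* the active partition at the end of batch [i] *)
Fixpoint active (i : nat) : seq (bin * {set bool}) :=
  match i with
  | 0 => [seq (C, [set: bool]%SET) | C <- child root (g 0)]
  | i'.+1 => flatten [seq update i'.+1 CI | CI <- active i']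
  end.

Definition pulls_active_arms (i : nat) : Prop :=
  forall C I, (C, I) \in active i.-1 ->
    forall s, s \in visits i C -> a s \in I.

(* A bin in which a single arm is active is handled by [pulls_active_arms]; two
   consecutive visits of batch [i] to a bin with two active arms pull
   different arms. *)
Definition round_robin (i : nat) : Prop :=
  forall C I, (C, I) \in active i.-1 -> #|I| = 2 ->
    sorted (fun s s' => a s != a s') (visits i C).

End Data.

(* [pi] is an execution of the algorithm: which arm starts the round robin in a
   bin, and which active arm is pulled in the last batch, are left free. *)
Definition is_BaSEDB (M : nat) (pi : @policy R d M t) : Prop :=
  forall z : nat -> obs R d, (forall s, (s < T)%N -> admissible (z s)) ->
    let a := pulled pi z in
    (forall i, (1 <= i <= M)%N -> pulls_active_arms z a i) /\
    (forall i, (1 <= i < M)%N -> round_robin z a i).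

End BaSEDB.

(* Main.v *)
(* A bin of width w is split when a batch of order w^-(2 beta + d) log(T w^d)
   rounds cannot tell its two arms apart, in which case the gap of the two arms is
   O(w^beta) on the bin.  Hence a round of batch i in an undecided bin costs at
   most O(w_{i-1}^beta) and, by the margin condition, occurs with a suboptimal arm
   with probability O(w_{i-1}^(alpha beta)).  The grid makes
   w_i^-(2 beta + d) w_{i-1}^(beta (1 + alpha)) at most b, so that each of the first
   M - 1 batches costs O(b log T); the last one costs T w_{M-1}^(beta (1 + alpha)),
   which is of the order of b because the rounding of the split factors loses only
   a bounded factor in total.

   A bin is bad when its number of visits or one of its average rewards is
   atypical.  A bad bin of width w_i has probability O(1 / (T w_i^d)); charging all
   later regret in it to the first bad bin around a point, where the gap is still
   O(w_{i-1}^beta), costs O(w_i^-d w_{i-1}^(beta (1 + alpha))) = O(b) per batch.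

   For the constant l of the grid, l = 1 / (16 cu L^2 d^beta) makes the threshold
   exceed the bias of a bin, so that on a good bin only suboptimal arms are
   eliminated. *)

Require Import Defs.
From HB Require Import structures.
From mathcomp Require Import all_boot all_order all_algebra.
From mathcomp Require Import all_classical all_reals all_analysis.
From mathcomp Require Import measurable_realfun.
From mathcomp Require Import ring lra zify.

Set Implicit Arguments.
Unset Strict Implicit.
Unset Printing Implicit Defensive.

Import Order.TTheory GRing.Theory Num.Theory.
Import numFieldNormedType.Exports.

Local Open Scope classical_set_scope.
Local Open Scope ring_scope.

(** * Expectation of products of independent observations *)

(** The rounds at which an arm is pulled depend on past data and on the choices left free by
    [is_BaSEDB]. The regret of a round is therefore dominated pointwise by explicit functions of the
    observations. The indicator of a bad bin is replaced by the upper bound [excess], a sum of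
    products with one factor per round of the batch. Its expectation follows from independence
    alone, and it still factorizes when multiplied by the indicator that a later covariate falls in
    the bin with a small gap. Summing over the bins of a grid then gives the mass of the margin set,
    with no union bound over bins.

    Constants: on a good bin each average reward is within 3/8 of the threshold [U] of its cell mean
    and the bias is at most [U] / 8, so each arm is known to within [U] / 2 and a comparison of the
    arms to within [U]. The exponential moments need a parameter of at most 1/3, hence the
    requirement of 81 visits per unit of [Lam]. *)

Section ProductExpectation.
Local Open Scope ereal_scope.
Context {R : realType} {dO dS : measure_display}.
Context {Omega : measurableType dO} {S : measurableType dS}.
Import HBNNSimple.

(** The standard machine: the factorization assumed for indicators extends to simple functions by
    linearity and to [h] by monotone convergence. [W] stands for the product of the other
    factors. *)
Lemma ge0_integral_mul_comp (P : {measure set Omega -> \bar R})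
    (Q : {measure set S -> \bar R}) (Z : Omega -> S) (W : Omega -> R) (c : R)
    (h : S -> R) :
  measurable_fun setT Z -> measurable_fun setT W -> (forall w, (0 <= W w)%R) ->
  (0 <= c)%R ->
  (forall A, measurable A -> \int[P]_w (W w * \1_A (Z w))%:E = c%:E * Q A) ->
  measurable_fun setT h -> (forall z, (0 <= h z)%R) ->
  \int[P]_w (W w * h (Z w))%:E = c%:E * \int[Q]_z (h z)%:E.
Proof.
move=> mZ mW W0 c0 WA mh h0.
have meh : measurable_fun setT (EFin \o h) by exact/measurable_EFinP.
have h0' x : setT x -> 0 <= (EFin \o h) x by rewrite lee_fin.
pose g := nnsfun_approx measurableT meh.
have gh z : EFin \o g ^~ z @ \oo --> (h z)%:E.
  by have := cvg_nnsfun_approx measurableT meh h0' (x := z) I.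
have ndg z : {homo (fun n => (g n z)%:E) : m n / (m <= n)%N >-> m <= n}.
  by move=> m n mn; rewrite lee_fin; exact/lefP/nd_nnsfun_approx.
have -> : \int[Q]_z (h z)%:E = limn (fun n => \int[Q]_z (g n z)%:E).
  rewrite -monotone_convergence//.
  - by apply: eq_integral => z _; apply/esym/cvg_lim => //; exact: gh.
  - by move=> n; exact/measurable_EFinP.
  - by move=> n z _; rewrite lee_fin.
have -> : \int[P]_w (W w * h (Z w))%:E
    = limn (fun n => \int[P]_w (W w * g n (Z w))%:E).
  rewrite -monotone_convergence//.
  - apply: eq_integral => w _; apply/esym/cvg_lim => //.
    under eq_fun do rewrite EFinM.
    by rewrite EFinM; apply: cvgeZl => //; exact: gh.
  - move=> n; apply/measurable_EFinP; apply: measurable_funM => //.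
    exact: measurableT_comp.
  - by move=> n z _; rewrite lee_fin mulr_ge0.
  - by move=> w _ m n mn; rewrite !EFinM lee_wpmul2l ?lee_fin//; exact: ndg.
rewrite -limeMl//; last first.
  apply: ereal_nondecreasing_is_cvgn => m n mn.
  apply: ge0_le_integral => //.
  - by move=> z _; rewrite lee_fin.
  - exact/measurable_EFinP.
  - exact/measurable_EFinP.
  - by move=> z _; exact: ndg.
congr (limn _); apply/funext => n.
have mg y : measurable (g n @^-1` [set y]) by exact: measurable_sfunP.
have gE z : (g n z)%:E = \sum_(y \in range (g n)) (y * \1_(g n @^-1` [set y]) z)%:E.
  by rewrite fimfunE -fsumEFin.
have y0 y z : 0 <= (y * \1_(g n @^-1` [set y]) z)%:E by exact: nnfun_muleindic_ge0.
have mi y : measurable_fun setT (fun z => (y * \1_(g n @^-1` [set y]) z)%:E : \bar R).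
  by apply/measurable_EFinP; apply: measurable_funM.
have mW' : measurable_fun setT (EFin \o W) by exact/measurable_EFinP.
transitivity (\int[P]_w \sum_(y \in range (g n))
    ((W w)%:E * (y * \1_(g n @^-1` [set y]) (Z w))%:E)).
  by apply: eq_integral => w _; rewrite EFinM gE ge0_mule_fsumr.
rewrite ge0_integral_fsum//; last 2 first.
- move=> y; apply: emeasurable_funM => //.
  exact: (measurableT_comp (mi y)).
- by move=> y w _; rewrite mule_ge0// lee_fin.
under [in RHS]eq_integral => z _ do rewrite gE.
rewrite ge0_integral_fsum// ge0_mule_fsumr; last first.
  by move=> y; exact: integral_ge0.
apply: eq_fsbigr => y; rewrite inE => -[z _ gzy].
have {gzy}y_ge0 : (0 <= y)%R by rewrite -gzy.
under eq_integral => w _.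
  rewrite -EFinM mulrCA EFinM; over.
rewrite ge0_integralZl_EFin//; last 2 first.
- by move=> w _; rewrite lee_fin mulr_ge0.
- apply/measurable_EFinP/measurable_funM => //; exact: measurableT_comp.
rewrite WA//.
under [in RHS]eq_integral => w _ do rewrite EFinM.
rewrite ge0_integralZl_EFin//; last exact/measurable_EFinP.
by rewrite integral_indic// setIT muleCA.
Qed.

(** Independence speaks of indicators; the factors are converted one at a time. The list [s] holds
    the indices that already carry [h], the others carry indicators of arbitrary sets [A], and this
    generality lets the induction step test the new factor against every measurable set. *)
Lemma integral_prod_independent (P : probability Omega R)
    (Q : probability S R) (I : finType) (Z : I -> Omega -> S)
    (h : I -> S -> R) (c : I -> R) :
  (forall i, measurable_fun setT (Z i)) ->
  mutually_independent P Z ->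
  (forall i A, measurable A -> P (Z i @^-1` A) = Q A) ->
  (forall i, measurable_fun setT (h i)) -> (forall i z, (0 <= h i z)%R) ->
  (forall i, \int[Q]_z (h i z)%:E = (c i)%:E) ->
  \int[P]_w (\prod_i h i (Z i w))%:E = (\prod_i c i)%:E.
Proof.
move=> mZ indep lawZ mh h0 hc.
have c0 i : (0 <= c i)%R.
  by rewrite -lee_fin -hc integral_ge0// => z _; rewrite lee_fin.
pose H (s : seq I) (A : I -> set S) i : S -> R := if i \in s then h i else \1_(A i).
pose C (s : seq I) A i : R := if i \in s then c i else fine (Q (A i)).
have H0 s A i z : (0 <= H s A i z)%R by rewrite /H; case: ifP.
have C0 s A i : (0 <= C s A i)%R by rewrite /C; case: ifP => // _; exact: fine_ge0.
have mH s A i : (forall i, measurable (A i)) -> measurable_fun setT (H s A i).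
  by move=> mA; rewrite /H; case: ifP.
suff key (s : seq I) A : uniq s -> (forall i, measurable (A i)) ->
    \int[P]_w (\prod_i H s A i (Z i w))%:E = (\prod_i C s A i)%:E.
  have := key (enum I) (fun=> setT) (enum_uniq _) (fun=> measurableT).
  under eq_integral => w _ do under eq_bigr => i _ do rewrite /H mem_enum inE.
  by move=> ->; congr EFin; apply: eq_bigr => i _; rewrite /C mem_enum inE.
elim: s A => [|j s IH] A /=.
  move=> _ mA; transitivity (\int[P]_w (\1_(\bigcap_i (Z i @^-1` A i)) w)%:E).
    apply: eq_integral => w _; congr EFin.
    rewrite indicE; case: (boolP (w \in _)) => [|].
      rewrite inE => wA; apply: big1 => i _; rewrite /H/= indicE mem_set//.
      exact: wA.
    rewrite notin_setE => wA.
    have [i Ai] : exists i, ~ A i (Z i w).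
      by apply/existsNP => AA; apply: wA => i _; exact: AA.
    by rewrite (bigD1 i)//= /H/= indicE memNset// mul0r.
  have mZA i : measurable (Z i @^-1` A i).
    by rewrite -[X in measurable X]setTI; exact: mZ.
  rewrite integral_indic ?setIT//; last exact: fin_bigcap_measurable.
  have := indep [set: I]%SET A mA.
  rewrite (_ : [set` _] = setT); last by apply/seteqP; split => // i; rewrite /= inE.
  move=> PE; apply: (etrans PE); rewrite -prodEFin; apply: eq_big => [i|i _]; first by rewrite inE.
  by rewrite /C/= lawZ// fineK// fin_num_measure.
move=> /andP[js us] mA.
pose W w := (\prod_(i | i != j) H s A i (Z i w))%R.
have HW w : (\prod_i H (j :: s) A i (Z i w) = W w * h j (Z j w))%R.
  rewrite (bigD1 j)//= {1}/H inE eqxx/= mulrC; congr (_ * _)%R.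
  by apply: eq_bigr => i /negbTE ij; rewrite /H inE ij.
under eq_integral => w _ do rewrite HW.
rewrite (@ge0_integral_mul_comp P Q (Z j) W (\prod_(i | i != j) C s A i)%R)//.
- rewrite hc [in RHS](bigD1 j)//= -EFinM mulrC.
  congr EFin; congr (_ * _)%R; first by rewrite /C mem_head.
  by apply: eq_bigr => i /negbTE ij; rewrite /C inE ij.
- rewrite /W; under eq_fun do rewrite big_mkcond; apply: measurable_prod => i _.
  by case: (i != j) => //; apply: measurableT_comp => //; exact: mH.
- by move=> w; apply: prodr_ge0 => i _; exact: H0.
- by apply: prodr_ge0 => i _; exact: C0.
- move=> B mB; pose A' i := if i == j then B else A i.
  have mA' i : measurable (A' i) by rewrite /A'; case: ifP.
  have Cj : C s A' j = fine (Q B) by rewrite /C (negbTE js) /A' eqxx.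
  have Hj : H s A' j = \1_B by rewrite /H (negbTE js) /A' eqxx.
  have := IH A' us mA'.
  rewrite (bigD1 j)//= Cj mulrC EFinM fineK ?fin_num_measure//.
  rewrite (_ : (\prod_(i | i != j) C s A' i = \prod_(i | i != j) C s A i)%R); last first.
    by apply: eq_bigr => i /negbTE ij; rewrite /C /A' ij.
  move=> <-; apply: eq_integral => w _; rewrite (bigD1 j)//= Hj.
  rewrite mulrC; congr EFin; congr (_ * _)%R.
  by apply: eq_bigr => i /negbTE ij; rewrite /H /A' ij.
Qed.

End ProductExpectation.

(** * Lebesgue measure of bins *)

Section Box.
Context {R : realType}.

Definition box n (A : 'I_n -> set R) : set (n.-tuple R) :=
  [set x | forall j, A j (tnth x j)].

Lemma measurable_box n (A : 'I_n -> set R) :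
  (forall j, measurable (A j)) -> measurable (box A).
Proof.
move=> mA; rewrite (_ : box A = \bigcap_j ((fun x => tnth x j) @^-1` A j)).
  apply: fin_bigcap_measurable => // j _.
  by rewrite -[X in measurable X]setTI; exact: (measurable_tnth j).
by apply/seteqP; split=> [x xA j _|x xA j]; [exact: xA|exact: (xA j)].
Qed.

Lemma lebesgue_tuple_box n (A : 'I_n -> set R) :
  (forall j, measurable (A j)) ->
  lebesgue_tuple n (box A) = (\prod_(j < n) lebesgue_measure (A j))%E.
Proof.
elim: n A => [|n IH] A mA.
  rewrite big_ord0 /= diracE mem_set//.
  by case.
rewrite big_ord_recl -IH//.
rewrite /= /lebesgue_cons /pushforward.
rewrite (_ : _ @^-1` _ = A ord0 `*` box (fun j => A (lift ord0 j))).
  by apply: product_measure1E; [exact: (mA ord0)|exact: measurable_box].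
apply/seteqP; split=> [[x u]/= xuA|[x u] /= [xA uA] j].
  split; first exact: (xuA ord0).
  by move=> j; have := xuA (lift ord0 j); rewrite tnthS.
by case: (unliftP ord0 j) => [k ->|->]; [rewrite tnthS; exact: uA|exact: xA].
Qed.

Lemma measurable_cube n : measurable (@cube R n).
Proof.
rewrite (_ : cube = box (fun=> `[0, 1]%classic)); first exact: measurable_box.
by apply/seteqP; split=> x xc j; have := xc j; rewrite /= in_itv.
Qed.

Lemma in_binE n (C : @bin n) :
  [set x : n.-tuple R | in_bin C x] =
  box (fun j => `[(tnth C.2 j)%:R * width C, (tnth C.2 j).+1%:R * width C[%classic).
Proof.
apply/seteqP; split=> x /=; first by move/forallP => xC j; rewrite /= in_itv/=.
by move=> xC; apply/forallP => j; have := xC j; rewrite /= in_itv.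
Qed.

Lemma measurable_in_bin n (C : @bin n) : measurable [set x : n.-tuple R | in_bin C x].
Proof. by rewrite in_binE; exact: measurable_box. Qed.

Lemma width_ge0 n (C : @bin n) : 0 <= width C :> R.
Proof. by rewrite /width invr_ge0. Qed.

Lemma lebesgue_tuple_in_bin n (C : @bin n) :
  lebesgue_tuple n [set x | in_bin C x] = (width C ^+ n : R)%:E.
Proof.
rewrite in_binE lebesgue_tuple_box//.
transitivity (\prod_(j < n) (width C : R)%:E)%E; last first.
  by rewrite prodEFin prodr_const card_ord.
apply: eq_bigr => j _; rewrite lebesgue_measure_itv/= lte_fin.
have := width_ge0 C; rewrite le_eqVlt => /predU1P[<-|w0].
  by rewrite !mulr0 ltxx.
by rewrite ltr_pM2r// ltr_nat ltnSn -EFinB -mulrBl -natrB// subSnn mul1r.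
Qed.

End Box.

Section Density.
Context {R : realType} {d : nat}.
Variables (cl cu : R) (Q : probability (obs R d) R).
Hypotheses (cl0 : 0 < cl) (dens : has_bounded_density cl cu Q).

Lemma bounded_density (A : set (d.-tuple R)) (v : R) :
  measurable A -> A `<=` cube -> lebesgue_tuple d A = v%:E ->
  ((cl * v)%:E <= Q (ctx @^-1` A) <= (cu * v)%:E)%E.
Proof.
move=> mA Ac Av; have [p [mp pb ->//]] := dens.
rewrite (_ : A `&` cube = A); last exact/setIidPl.
rewrite !EFinM -Av -!integral_cst//; apply/andP; split; apply: ge0_le_integral => //.
- by move=> x _; rewrite lee_fin ltW.
- by apply/measurable_EFinP; exact: measurable_funTS.
- by move=> x /Ac/pb/andP[]; rewrite lee_fin.
- by move=> x /Ac/pb/andP[+ _]; rewrite lee_fin; apply: le_trans; exact: ltW.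
- by apply/measurable_EFinP; exact: measurable_funTS.
- by move=> x /Ac/pb/andP[_]; rewrite lee_fin.
Qed.

End Density.

(** * Exponential moments and concentration *)

Section ExpBounds.
Context {R : realType}.

(** For u <= 0 use 1 - u <= e^-u; for u > 0 use the square of 1 - u/2 <= e^(-u/2). In the second
    case (1 - u/2)^2 (1 + u + u^2) - 1 = u^2 (1 - 3u + u^2) / 4, which is nonnegative for u <=
    1/3. *)
Lemma expR_le_quadratic (u : R) : u <= 3^-1 -> expR u <= 1 + u + u ^+ 2.
Proof.
move=> u3; have [u0|u0] := leP u 0.
  have e0 := expR_gt0 u; have := expR_ge1Dx (- u); rewrite expRN => e1.
  have : (1 - u) * expR u <= 1.
    by rewrite -[leRHS](mulVf (lt0r_neq0 e0)) ler_pM2r.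
  nra.
have e0 := expR_gt0 (u / 2); have := expR_ge1Dx (- (u / 2)); rewrite expRN => e1.
have e2 : (1 - u / 2) * expR (u / 2) <= 1.
  by rewrite -[leRHS](mulVf (lt0r_neq0 e0)) ler_pM2r.
have -> : u = u / 2 + u / 2 by lra.
rewrite expRD.
have e3 : ((1 - u / 2) * expR (u / 2)) ^+ 2 <= 1.
  by rewrite expr_le1// mulr_ge0 ?(ltW e0)//; lra.
have : 1 <= (1 - u / 2) ^+ 2 * (1 + u + u ^+ 2) by nra.
have : 0 < (1 - u / 2) ^+ 2 by rewrite exprn_gt0//; lra.
move=> h1 h2; rewrite -(ler_pM2l h1).
have -> : u / 2 + u / 2 = u by lra.
by apply: le_trans h2; rewrite exprMn expr2 in e3; lra.
Qed.

End ExpBounds.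

Section CellMoments.
Local Open Scope ereal_scope.
Context {R : realType} {dS : measure_display} {S : measurableType dS}.
Variables (Q : probability S R) (E : set S) (Y : S -> R).
Hypotheses (mE : measurable E) (mY : measurable_fun setT Y).
Hypothesis Y01 : forall z, E z -> (0 <= Y z <= 1)%R.

Definition mass (A : set S) : R := fine (Q A).
Definition cell_mean : R := (fine (\int[Q]_(z in E) (Y z)%:E) / mass E)%R.

Lemma massE (A : set S) : measurable A -> (mass A)%:E = Q A.
Proof. by move=> mA; rewrite /mass fineK// fin_num_measure. Qed.

Lemma mass_ge0 A : (0 <= mass A)%R.
Proof. exact: fine_ge0. Qed.

Lemma mass_le1 A : measurable A -> (mass A <= 1)%R.
Proof. by move=> mA; rewrite -lee_fin massE// probability_le1. Qed.

Lemma integral_mass_indic A : measurable A -> \int[Q]_z (\1_A z)%:E = (mass A)%:E.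
Proof. by move=> mA; rewrite integral_indic// setIT massE. Qed.

Lemma integrable_cell : Q.-integrable E (EFin \o Y).
Proof.
apply: measurable_bounded_integrable => //.
- by rewrite ltey_eq fin_num_measure.
- exact: measurable_funTS.
- exists 1%R; split; first by rewrite num_real.
  move=> r r1 z /Y01/andP[y0 y1]; rewrite /= ger0_norm// (le_trans y1)//; exact: ltW.
Qed.

Lemma integral_cell_affine (a b : R) : (0 < mass E)%R ->
  \int[Q]_(z in E) (a + b * Y z)%:E = (mass E * (a + b * cell_mean))%:E.
Proof.
move=> E0.
have iY := integrable_cell.
have fE : Q E < +oo by rewrite ltey_eq fin_num_measure.
under eq_integral => z _ do rewrite EFinD EFinM.
rewrite integralD//; last 2 first.
- exact: finite_measure_integrable_cst.
- by apply: integrableZl.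
rewrite integral_cst// integralZl// -[X in a%:E * X](massE mE).
rewrite -[\int[Q]_(z in E) _]fineK; last exact: integrable_fin_num.
rewrite -!EFinM -EFinD; congr EFin; rewrite /cell_mean.
by field; rewrite gt_eqF.
Qed.

Lemma cell_mean_bounds : (0 < mass E)%R -> (0 <= cell_mean <= 1)%R.
Proof.
move=> E0; apply/andP; split.
  apply: divr_ge0; last exact: mass_ge0.
  by apply/fine_ge0/integral_ge0 => z /Y01/andP[]; rewrite lee_fin.
have : 0 <= \int[Q]_(z in E) (1 + (-1) * Y z)%:E.
  by apply: integral_ge0 => z /Y01/andP[? ?]; rewrite lee_fin; lra.
rewrite integral_cell_affine// lee_fin pmulr_rge0//; lra.
Qed.

(** A subgaussian bound: the second-order term is [theta ^+ 2] times at most m (1 - m) <= 1/4, the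
    largest variance of a [0,1]-valued variable of mean m. *)
Lemma cell_exp_moment (theta : R) : (0 < mass E)%R -> (`|theta| <= 3^-1)%R ->
  \int[Q]_z (\1_E z * expR (theta * (Y z - cell_mean)))%:E <=
  (mass E * expR (theta ^+ 2 / 4))%:E.
Proof.
move=> E0 th; have /andP[m0 m1] := cell_mean_bounds E0.
set m := cell_mean.
pose a := (1 - theta * m + theta ^+ 2 * m ^+ 2)%R.
pose b := (theta + theta ^+ 2 * (1 - 2 * m))%R.
(* affine in [Y z], because [Y z ^+ 2 <= Y z] on the cell *)
have ab z : E z -> (expR (theta * (Y z - m)) <= a + b * Y z)%R.
  move=> /Y01/andP[y0 y1].
  have thx : (theta * (Y z - m) <= 3^-1)%R.
    apply: le_trans th; apply: le_trans (ler_norm _) _; rewrite normrM.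
    by rewrite ler_piMr// ler_norml; rewrite /m; lra.
  apply: (le_trans (expR_le_quadratic thx)).
  rewrite /a /b -subr_ge0.
  have -> : (1 - theta * m + theta ^+ 2 * m ^+ 2 +
    (theta + theta ^+ 2 * (1 - 2 * m)) * Y z -
    (1 + theta * (Y z - m) + (theta * (Y z - m)) ^+ 2) =
    theta ^+ 2 * (Y z * (1 - Y z)))%R by ring.
  by rewrite mulr_ge0 ?sqr_ge0// mulr_ge0//; lra.
have -> : \int[Q]_z (\1_E z * expR (theta * (Y z - m)))%:E =
    \int[Q]_(z in E) (expR (theta * (Y z - m)))%:E.
  rewrite [RHS]integral_mkcond; apply: eq_integral => z _.
  by rewrite patchE indicE; case: ifP => _; rewrite ?mul1r ?mul0r.
have mexp : measurable_fun E (fun z => (expR (theta * (Y z - m)))%:E).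
  apply/measurable_EFinP; apply: measurable_funTS.
  apply: measurableT_comp => //; apply: measurable_funM => //.
  exact: measurable_funB.
have maff : measurable_fun E (fun z => (a + b * Y z)%:E).
  apply/measurable_EFinP; apply: measurable_funTS.
  by apply: measurable_funD => //; exact: measurable_funM.
apply: (@le_trans _ _ (\int[Q]_(z in E) (a + b * Y z)%:E)).
  apply: ge0_le_integral => // z Ez; rewrite lee_fin ?expR_ge0//.
rewrite integral_cell_affine// lee_fin ler_pM2l// -/m.
apply: le_trans (expR_ge1Dx _).
have -> : (a + b * m = 1 + theta ^+ 2 * (m - m ^+ 2))%R by rewrite /a /b; ring.
rewrite lerD2l ler_wpM2l ?sqr_ge0//.
have : (0 <= (m - 2^-1) ^+ 2)%R by exact: sqr_ge0.
by lra.
Qed.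

End CellMoments.

Section IndependentBounds.
Local Open Scope ereal_scope.
Context {R : realType} {dO dS : measure_display}.
Context {Omega : measurableType dO} {S : measurableType dS}.
Variables (P : probability Omega R) (Q : probability S R) (I : finType).
Variable Z : I -> Omega -> S.
Hypothesis mZ : forall i, measurable_fun setT (Z i).
Hypothesis indep : mutually_independent P Z.
Hypothesis lawZ : forall i A, measurable A -> P (Z i @^-1` A) = Q A.

Lemma measurable_prod_sample (B : {set I}) (h : I -> S -> R) :
  (forall i, measurable_fun setT (h i)) ->
  measurable_fun setT (fun w => \prod_(i in B) h i (Z i w))%R.
Proof.
move=> mh; under eq_fun do rewrite big_mkcond; apply: measurable_prod => i _.
by case: (i \in B) => //; exact: measurableT_comp.
Qed.

(** The round [i0] lies outside [B], so [\1_D] is one more independent factor. This is how a bad bin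
    of a past batch is combined with the position of a later covariate. *)
Lemma integral_indic_prod_le (B : {set I}) (i0 : I) (D : set S)
    (h : I -> S -> R) (c : I -> R) :
  i0 \notin B -> measurable D ->
  (forall i, measurable_fun setT (h i)) -> (forall i z, (0 <= h i z)%R) ->
  (forall i, i \in B -> \int[Q]_z (h i z)%:E <= (c i)%:E) ->
  \int[P]_w (\1_D (Z i0 w) * \prod_(i in B) h i (Z i w))%:E <=
  (mass Q D * \prod_(i in B) c i)%:E.
Proof.
move=> i0B mD mh h0 hc.
pose H i : S -> R := if i == i0 then \1_D else if i \in B then h i else cst 1%R.
pose C i : R := if i == i0 then mass Q D
  else if i \in B then fine (\int[Q]_z (h i z)%:E) else 1%R.
have c0 i : 0 <= \int[Q]_z (h i z)%:E.
  by apply: integral_ge0 => z _; rewrite lee_fin.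
have key : \int[P]_w (\prod_i H i (Z i w))%:E = (\prod_i C i)%:E.
  apply: (integral_prod_independent (Q := Q)) => //.
  - by move=> i; rewrite /H; case: (i == i0) => //; case: (i \in B).
  - by move=> i z; rewrite /H; case: (i == i0) => //; case: (i \in B) => /=.
  - move=> i; rewrite /H /C; case: ifP => _; first exact: integral_mass_indic.
    case: ifP => iB; last first.
      by apply: etrans (integral_cst Q measurableT 1) _; rewrite mul1e; exact: probability_setT.
    rewrite fineK// ge0_fin_numE//; apply: le_lt_trans (hc i iB) _; exact: ltry.
have split (a : R) (F G : I -> R) :
    G i0 = a -> (forall i, i != i0 -> G i = if i \in B then F i else 1%R) ->
    (\prod_i G i = a * \prod_(i in B) F i)%R.
  move=> Ga GF; rewrite (bigD1 i0)//= Ga; congr (_ * _)%R.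
  rewrite [LHS]big_mkcond [RHS]big_mkcond; apply: eq_bigr => i _.
  by case: eqP => [->|/eqP/GF ->//]; rewrite (negbTE i0B).
rewrite (_ : \int[P]_w _ = \int[P]_w (\prod_i H i (Z i w))%:E); last first.
  apply: eq_integral => w _; congr EFin; apply/esym.
  apply: (split _ (fun i => h i (Z i w)) (fun i => H i (Z i w))).
    by rewrite /H eqxx.
  by move=> i /negbTE ii0; rewrite /H ii0; case: ifP.
rewrite key lee_fin (split (mass Q D) (fun i => fine (\int[Q]_z (h i z)%:E))).
- rewrite ler_wpM2l ?mass_ge0//; apply: ler_prod => i iB.
  by rewrite fine_ge0//= -lee_fin fineK ?hc// ge0_fin_numE// (le_lt_trans (hc i iB))// ltry.
- by rewrite /C eqxx.
- by move=> i /negbTE ii0; rewrite /C ii0.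
Qed.

End IndependentBounds.

(** * A factorizable upper bound on the indicator of an atypical cell *)

Section Excess.
Context {R : realType} {dS : measure_display} {S : measurableType dS}.
Variables (Q : probability S R) (E : set S) (Y : bool -> S -> R).
Variables (I : finType) (B : {set I}) (cls : {set I} -> bool -> {set I}) (Lam : R).

Local Notation q := (mass Q E).
Local Notation mu k := (cell_mean Q E (Y k)).
Local Notation n := (#|B|%:R : R).

(** This is 3/8 of the elimination threshold for |V| visits. The square is 9/4 [Lam] / |V|, so that
    a class holding at least 4/9 of [V] yields the exponent [Lam]. *)
Definition deviation (V : {set I}) : R := 3 / 2 * Num.sqrt (Lam / #|V|%:R).

(** The indicators restrict to the event that [V] is exactly the set of rounds visiting [E]; only
    the rounds of the class are tilted. The parameter theta = [2 * deviation V] minimizes theta^2 /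
    4 - theta [deviation V]. *)
Definition cell_weight (V : {set I}) (kbe : bool * bool * bool) (s : I) (x : S) : R :=
  let: (k, b, e) := kbe in
  if s \in V then
    \1_E x * expR (if s \in cls V e
                   then (-1) ^+ b * (2 * deviation V) * (Y k x - mu k) else 0)
  else \1_(~` E) x.

Definition deviation_excess (z : I -> S) (V : {set I}) (kbe : bool * bool * bool) : R :=
  expR (- (2 * deviation V ^+ 2 * #|cls V kbe.2|%:R)) *
  \prod_(s in B) cell_weight V kbe s (z s).

(* An upper bound on the indicator that the number of visits to the cell [E], or
   one of the class averages of the rewards observed there, is atypical.  In
   [kbe], [k] is an arm, [b] the sign of the deviation and [e] a class of visits.
   Summing over the set [V] of visits makes every term a product of functions of
   the individual observations, so that its expectation factorizes. *)
Definition excess (z : I -> S) : R :=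
  2 `^ (- (4 * n * q)) * \prod_(s in B) (1 + \1_E (z s)) +
  2 `^ (n * q / 4) * \prod_(s in B) (1 - \1_E (z s) / 2) +
  \sum_(V in powerset B | 81 * Lam <= #|V|%:R)
    \sum_kbe deviation_excess z V kbe.

Definition visitors (z : I -> S) : {set I} := [set s in B | z s \in E].

Hypothesis cls_sub : forall V e, cls V e \subset V.
Hypothesis Lam0 : 0 < Lam.

Lemma cell_weight_ge0 V kbe s x : 0 <= cell_weight V kbe s x.
Proof.
case: kbe => [[k b] e]; rewrite /cell_weight; case: ifP => _ //.
by rewrite mulr_ge0 ?expR_ge0.
Qed.

Lemma half_indic_ge0 (x : S) : 0 <= 1 - \1_E x / 2 :> R.
Proof. by rewrite indicE; case: (_ \in _) => /=; lra. Qed.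

Lemma deviation_excess_ge0 z V kbe : 0 <= deviation_excess z V kbe.
Proof.
rewrite mulr_ge0 ?expR_ge0//; apply: prodr_ge0 => s _; exact: cell_weight_ge0.
Qed.

Lemma prod_visitors (z : I -> S) (a : R) :
  \prod_(s in B) (if z s \in E then a else 1) = a ^+ #|visitors z|.
Proof.
rewrite -big_mkcondr/= -prodr_const; apply: eq_bigl => s.
by rewrite inE.
Qed.

(** At the actual set of visits all indicators are 1, and what remains is the exponential Markov
    quantity of a one-sided deviation of the class average. *)
Lemma deviation_excess_visitors (z : I -> S) k b e (V := visitors z) :
  deviation_excess z V (k, b, e) =
  expR (2 * deviation V * ((-1) ^+ b * (\sum_(s in cls V e) (Y k (z s) - mu k))
                           - #|cls V e|%:R * deviation V)).
Proof.
rewrite /deviation_excess /=.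
rewrite (eq_bigr (fun s => expR (if s \in cls V e
   then (-1) ^+ b * (2 * deviation V) * (Y k (z s) - mu k) else 0))); last first.
  move=> s sB; case: ifPn => sV; rewrite indicE.
    by move: sV; rewrite inE sB /= => ->; rewrite mul1r.
  move: (sV); rewrite inE sB /= => sE.
  rewrite ifN; last by move: sV; apply: contra; exact: (fintype.subsetP (cls_sub V e)).
  by rewrite in_setC sE expR0.
rewrite -expR_sum -expRD; congr expR.
rewrite -big_mkcondr/=.
rewrite (eq_bigl (mem (cls V e))); last first.
  move=> s /=; rewrite andb_idl// => /(fintype.subsetP (cls_sub V e)).
  by rewrite inE => /andP[].
rewrite -mulr_sumr; ring.
Qed.

(** All terms of [excess] are nonnegative, so each of them is below 1. For N visits the first two
    are 2^(N - 4nq) and 2^(nq/4 - N); the two signs [b] give the two sides of the deviation. *)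
Lemma excess_lt1 (z : I -> S) (V := visitors z) : excess z < 1 ->
  [/\ n * q / 4 < #|V|%:R, #|V|%:R < 4 * n * q &
      81 * Lam <= #|V|%:R -> forall k e,
        `|\sum_(s in cls V e) (Y k (z s) - mu k)| < #|cls V e|%:R * deviation V].
Proof.
move=> z1.
have T1 : 0 <= 2 `^ (- (4 * n * q)) * \prod_(s in B) (1 + \1_E (z s)) :> R.
  by rewrite mulr_ge0 ?powR_ge0//; apply: prodr_ge0 => s _; rewrite addr_ge0.
have T2 : 0 <= 2 `^ (n * q / 4) * \prod_(s in B) (1 - \1_E (z s) / 2) :> R.
  by rewrite mulr_ge0 ?powR_ge0//; apply: prodr_ge0 => s _; exact: half_indic_ge0.
have T3 : 0 <= \sum_(V in powerset B | 81 * Lam <= #|V|%:R)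
    \sum_kbe deviation_excess z V kbe.
  by apply: sumr_ge0 => U _; apply: sumr_ge0 => kbe _; exact: deviation_excess_ge0.
have ln2 : 0 < ln (2 : R) by rewrite ln_gt0// ltr1n.
split.
- have : 2 `^ (n * q / 4) * \prod_(s in B) (1 - \1_E (z s) / 2) < 1 :> R.
    by apply: le_lt_trans z1; rewrite /excess; lra.
  rewrite (eq_bigr (fun s => if z s \in E then 2^-1 else 1)); last first.
    by move=> s _; rewrite indicE; case: ifP => _ /=; lra.
  rewrite prod_visitors exprVn -powR_mulrn// -powRN -powRD; last first.
    by apply/implyP => _; rewrite pnatr_eq0.
  rewrite /powR gt_eqF// expR_lt1 pmulr_llt0//; lra.
- have : 2 `^ (- (4 * n * q)) * \prod_(s in B) (1 + \1_E (z s)) < 1 :> R.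
    by apply: le_lt_trans z1; rewrite /excess; lra.
  rewrite (eq_bigr (fun s => if z s \in E then 2 else 1)); last first.
    by move=> s _; rewrite indicE; case: ifP => _ /=; lra.
  rewrite prod_visitors -powR_mulrn// -powRD; last first.
    by apply/implyP => _; rewrite pnatr_eq0.
  rewrite /powR gt_eqF// expR_lt1 pmulr_llt0//; lra.
- move=> V81 k e.
  have dev0 : 0 < deviation V.
    rewrite mulr_gt0// sqrtr_gt0 divr_gt0//.
    by apply: lt_le_trans V81; rewrite mulr_gt0.
  have sgn (b : bool) : (-1) ^+ b * (\sum_(s in cls V e) (Y k (z s) - mu k))
      < #|cls V e|%:R * deviation V.
    have : deviation_excess z V (k, b, e) < 1.
      apply: le_lt_trans z1; rewrite /excess.
      apply: (@le_trans _ _ (\sum_(V in powerset B | 81 * Lam <= #|V|%:R)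
        \sum_kbe deviation_excess z V kbe)); last by lra.
      have VB : V \in powerset B.
        by rewrite inE; apply/fintype.subsetP => s; rewrite inE => /andP[].
      rewrite (bigD1 V)/=; last by rewrite VB.
      rewrite (bigD1 (k, b, e))//= -addrA lerDl addr_ge0//.
        by apply: sumr_ge0 => kbe _; exact: deviation_excess_ge0.
      by apply: sumr_ge0 => U _; apply: sumr_ge0 => kbe _; exact: deviation_excess_ge0.
    rewrite deviation_excess_visitors expR_lt1 pmulr_rlt0 ?subr_lt0//.
    by rewrite mulr_gt0.
  have := sgn false; have := sgn true; rewrite /= expr0 expr1 ltr_norml; lra.
Qed.

End Excess.

Section SubsetSum.
Context {R : realType}.

Lemma ln2_ge_half : 2^-1 <= ln (2 : R).
Proof.
rewrite -ler_expR lnK ?posrE//.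
have e0 := expR_gt0 (4^-1 : R).
have e4 : expR (4^-1 : R) <= 1 + 4^-1 + 4^-1 ^+ 2.
  by apply: expR_le_quadratic; lra.
have -> : (2^-1 = 4^-1 + 4^-1 :> R) by lra.
rewrite expRD; nra.
Qed.

Lemma ln2_le1 : ln (2 : R) <= 1.
Proof. by have := @le_ln1Dx R 1; apply; lra. Qed.

(** The summands are the probabilities of the possible sets of visits, that is, terms in the
    expansion of a product of factors q + (1 - q). Hence summing [excess] over all [V] costs
    nothing. *)
Lemma sum_powerset_bernoulli (I : finType) (B : {set I}) (q : R) : 0 <= q <= 1 ->
  \sum_(V in powerset B) \prod_(s in B) (if s \in V then q else 1 - q) <= 1.
Proof.
move=> q01.
pose F s : R := if s \in B then q else 0.
pose G s : R := if s \in B then 1 - q else 1.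
have FG0 s : 0 <= F s /\ 0 <= G s by rewrite /F /G; case: ifP; lra.
have FG1 : \prod_s (F s + G s) = 1.
  by apply: big1 => s _; rewrite /F /G; case: ifP => _; ring.
rewrite -[leRHS]FG1 bigA_distr [leRHS](bigID (mem (powerset B)))/=.
rewrite -[leLHS]addr0 lerD//; last first.
  apply: sumr_ge0 => V _; apply: prodr_ge0 => s _.
  by case: ifP => _; have [] := FG0 s.
apply: ler_sum => V; rewrite inE => /fintype.subsetP VB.
rewrite [leLHS]big_mkcond/=; apply: ler_prod => s _.
rewrite /F /G; case: ifPn => sB; first by case: ifP; lra.
by rewrite (contraNF (VB s) sB) lexx ler01.
Qed.

End SubsetSum.

Section ExcessMoment.
Local Open Scope ereal_scope.
Context {R : realType} {dO dS : measure_display}.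
Context {Omega : measurableType dO} {S : measurableType dS}.
Variables (P : probability Omega R) (Q : probability S R) (I : finType).
Variable Z : I -> Omega -> S.
Hypothesis mZ : forall i, measurable_fun setT (Z i).
Hypothesis indep : mutually_independent P Z.
Hypothesis lawZ : forall i A, measurable A -> P (Z i @^-1` A) = Q A.
Variables (E : set S) (Y : bool -> S -> R).
Hypotheses (mE : measurable E) (mY : forall k, measurable_fun setT (Y k)).
Hypothesis Y01 : forall k z, E z -> (0 <= Y k z <= 1)%R.
Hypothesis E0 : (0 < mass Q E)%R.
Variables (B : {set I}) (cls : {set I} -> bool -> {set I}) (Lam : R).
Hypothesis cls_sub : forall V e, cls V e \subset V.
Hypothesis cls_large : forall (V : {set I}) e, (9 <= #|V| -> 4 * #|V| <= 9 * #|cls V e|)%N.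
Hypothesis Lam1 : (1 <= Lam)%R.
Variables (i0 : I) (D : set S).
Hypotheses (i0B : i0 \notin B) (mD : measurable D).

Local Notation q := (mass Q E).
Local Notation n := (#|B|%:R : R).

Lemma integral_indic_sum_prod_le (J : Type) (r : seq J) (X : pred J)
    (kappa : J -> R) (h : J -> I -> S -> R) (c : J -> I -> R) :
  (forall j, (0 <= kappa j)%R) ->
  (forall j i, measurable_fun setT (h j i)) ->
  (forall j i z, (0 <= h j i z)%R) ->
  (forall j i, X j -> \int[Q]_z (h j i z)%:E <= (c j i)%:E) ->
  \int[P]_w (\1_D (Z i0 w) *
     \sum_(j <- r | X j) kappa j * \prod_(i in B) h j i (Z i w))%:E <=
  (mass Q D * \sum_(j <- r | X j) kappa j * \prod_(i in B) c j i)%:E.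
Proof.
move=> k0 mh h0 hc.
under eq_integral => w _ do rewrite mulr_sumr -sumEFin -big_filter.
rewrite ge0_integral_sum//; last 2 first.
- move=> j; apply/measurable_EFinP; apply: measurable_funM.
    exact: measurableT_comp.
  by apply: measurable_funM => //; exact: measurable_prod_sample.
- move=> j w _; rewrite lee_fin mulr_ge0// mulr_ge0//.
  by apply: prodr_ge0 => i _; exact: h0.
rewrite big_filter mulr_sumr -sumEFin; apply: lee_sum => j Xj.
under eq_integral => w _ do rewrite mulrCA EFinM.
rewrite ge0_integralZl_EFin//; last 2 first.
- move=> w _; rewrite lee_fin mulr_ge0//.
  by apply: prodr_ge0 => i _; exact: h0.
- apply/measurable_EFinP; apply: measurable_funM.
    exact: measurableT_comp.
  exact: measurable_prod_sample.
rewrite mulrCA [leRHS]EFinM lee_wpmul2l ?lee_fin//.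
by apply: (integral_indic_prod_le (Q := Q)) => // i _; exact: hc.
Qed.

Lemma integral_cell_affine_indic (a : R) :
  \int[Q]_z (1 + a * \1_E z)%:E = (1 + a * q)%:E.
Proof.
under eq_integral => z _ do rewrite EFinD EFinM.
rewrite integralD//; last 2 first.
- exact: finite_measure_integrable_cst.
- apply: integrableZl => //; exact: integrable_indic.
rewrite integralZl//; last exact: integrable_indic.
rewrite integral_mass_indic//; have := integral_cst Q measurableT 1.
rewrite /cst => ->; rewrite mul1e.
by rewrite (_ : _ [set: S] = 1)//; exact: probability_setT.
Qed.

Definition cell_weight_bound (V : {set I}) (kbe : bool * bool * bool) (s : I) : R :=
  if s \in V then
    (q * (if s \in cls V kbe.2 then expR (deviation Lam V ^+ 2) else 1))%R
  else (1 - q)%R.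

Lemma measurable_cell_weight (V : {set I}) kbe s :
  measurable_fun setT (cell_weight Q E Y cls Lam V kbe s).
Proof.
case: kbe => [[k b] e]; rewrite /cell_weight; case: (s \in V); last first.
  by apply: measurable_indic; exact: measurableC.
apply: measurable_funM; first exact: measurable_indic.
case: (s \in cls V e) => //; apply: measurableT_comp => //.
by apply: measurable_funM => //; exact: measurable_funB.
Qed.

Lemma sqr_deviation (V : {set I}) :
  (deviation Lam V ^+ 2 = 9 / 4 * (Lam / #|V|%:R))%R.
Proof.
have L0 : (0 <= Lam)%R by exact: le_trans ler01 Lam1.
by rewrite exprMn sqr_sqrtr ?divr_ge0//; congr (_ * _)%R; field.
Qed.

Lemma integral_cell_weight (V : {set I}) kbe s : (81 * Lam <= #|V|%:R)%R ->
  \int[Q]_z (cell_weight Q E Y cls Lam V kbe s z)%:E <=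
  (cell_weight_bound V kbe s)%:E.
Proof.
move=> V81; case: kbe => [[k b] e]; rewrite /cell_weight /cell_weight_bound.
case: (s \in V); last first.
  rewrite integral_mass_indic; last exact: measurableC.
  by rewrite lee_fin /mass probability_setC// -massE// -EFinB.
case: (s \in cls V e); last first.
  under eq_integral do rewrite expR0 mulr1.
  by rewrite integral_mass_indic// mulr1.
have L1 := Lam1.
have V0 : (0 < #|V|%:R :> R)%R by apply: lt_le_trans V81; lra.
have d0 : (0 <= deviation Lam V)%R by rewrite mulr_ge0// sqrtr_ge0.
have d2 := sqr_deviation V.
apply: le_trans (cell_exp_moment mE (mY k) (@Y01 k) E0 _) _.
  rewrite normrM normrX normrN1 expr1n mul1r ger0_norm ?mulr_ge0//.
  rewrite -(@ler_pXn2r _ 2)// ?nnegrE ?mulr_ge0// exprMn d2.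
  (* With theta = [2 * deviation Lam V], the condition theta <= 1/3 reads 9 [Lam] / |V| <= 1/9;
     hence the 81. *)
  have : (Lam / #|V|%:R <= 81^-1)%R by rewrite ler_pdivrMr//; lra.
  by lra.
rewrite lee_fin ler_pM2l// ler_expR exprMn -exprM mulnC exprM sqrrN expr1n expr1n.
by lra.
Qed.

(** For a class of size c and D = [deviation Lam V], the moments cost e^(c D^2) and the
    normalization supplies e^(-2 c D^2). What is left is at most e^-Lam, since D^2 = 9/4 [Lam] / |V|
    and c >= 4/9 |V|. *)
Lemma prod_cell_weight_bound (V : {set I}) kbe : V \subset B -> (81 * Lam <= #|V|%:R)%R ->
  (expR (- (2 * deviation Lam V ^+ 2 * #|cls V kbe.2|%:R)) *
    \prod_(s in B) cell_weight_bound V kbe s <=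
  expR (- Lam) * \prod_(s in B) (if s \in V then q else 1 - q))%R.
Proof.
move=> VB V81; set e := kbe.2.
have L1 := Lam1.
have V0 : (0 < #|V|%:R :> R)%R by apply: lt_le_trans V81; lra.
have d2 := sqr_deviation V.
have -> : (\prod_(s in B) cell_weight_bound V kbe s =
  expR (deviation Lam V ^+ 2 * #|cls V e|%:R) *
  \prod_(s in B) (if s \in V then q else 1 - q))%R.
  rewrite expRM_natr -prodr_const.
  rewrite [X in (X * _)%R](_ : _ =
    \prod_(s in B) if s \in cls V e then expR (deviation Lam V ^+ 2) else 1)%R.
    rewrite -big_split/=; apply: eq_bigr => s _; rewrite /cell_weight_bound -/e.
    case: ifPn => sV; first by rewrite mulrC.
    by rewrite (contraNF (fintype.subsetP (cls_sub V e) s) sV) mul1r.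
  rewrite -big_mkcondr/=; apply: eq_bigl => s; rewrite andb_idl//.
  by move=> /(fintype.subsetP (cls_sub V e))/(fintype.subsetP VB).
rewrite mulrA -expRD ler_wpM2r//.
  apply: prodr_ge0 => s _; case: ifP => _; first exact: mass_ge0.
  by rewrite subr_ge0 mass_le1.
rewrite ler_expR d2.
have V9 : (9 <= #|V|)%N by rewrite -(ler_nat R); lra.
have := cls_large e V9; rewrite -(ler_nat R) !natrM => Vc.
have : (Lam / #|V|%:R * (4 * #|V|%:R) <= Lam / #|V|%:R * (9 * #|cls V e|%:R))%R.
  by rewrite ler_wpM2l// divr_ge0//; lra.
have -> : (Lam / #|V|%:R * (4 * #|V|%:R) = 4 * Lam)%R by field; rewrite gt_eqF.
lra.
Qed.

Lemma measurable_excess :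
  measurable_fun setT (fun w => excess Q E Y B cls Lam (Z ^~ w)).
Proof.
have mind : measurable_fun setT (\1_E : S -> R) by exact: measurable_indic.
apply: measurable_funD; first apply: measurable_funD.
- apply: measurable_funM => //.
  apply: (measurable_prod_sample mZ B (h := (fun _ z => 1 + \1_E z)%R)) => i.
  exact: measurable_funD.
- apply: measurable_funM => //.
  apply: (measurable_prod_sample mZ B (h := (fun _ z => 1 - \1_E z / 2)%R)) => i.
  by apply: measurable_funB => //; exact: measurable_funM.
- under eq_fun do rewrite big_mkcond; apply: measurable_sum => V.
  case: (_ && _) => //; apply: measurable_sum => kbe; apply: measurable_funM => //.
  apply: (measurable_prod_sample mZ B) => s; exact: measurable_cell_weight.
Qed.

(** The 8 counts the triples arm, sign, class. The other two terms are Chernoff bounds for the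
    number of visits with bases 2 and 1/2, for which 1/2 <= ln 2 <= 1 is precise enough. *)
Lemma integral_indic_excess_le :
  \int[P]_w (\1_D (Z i0 w) * excess Q E Y B cls Lam (Z ^~ w))%:E <=
  (mass Q D * (2 * expR (- (n * q / 4)) + 8 * expR (- Lam)))%:E.
Proof.
have q1 := mass_le1 Q mE.
have nq0 : (0 <= n * q)%R by rewrite mulr_ge0// ltW.
have ln2l := @ln2_ge_half R; have ln2u := @ln2_le1 R.
have mind (a : R) : measurable_fun setT (fun z : S => 1 + a * \1_E z)%R.
  by apply: measurable_funD => //; apply: measurable_funM.
have tail (kappa a x : R) : (0 <= kappa)%R -> (-1 <= a)%R ->
    (kappa * expR (n * (a * q)) <= expR x)%R ->
    \int[P]_w (\1_D (Z i0 w) * (kappa * \prod_(s in B) (1 + a * \1_E (Z s w))))%:E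
    <= (mass Q D * expR x)%:E.
  move=> k0 a1 kx.
  have ind0 z : (0 <= 1 + a * \1_E z)%R by rewrite indicE; case: (_ \in _) => /=; lra.
  have aq : (0 <= 1 + a * q)%R by have := E0; nra.
  have mom (j : unit) (i : I) : true ->
      \int[Q]_z (1 + a * \1_E z)%:E <= (1 + a * q)%:E.
    by move=> _; rewrite integral_cell_affine_indic.
  have := @integral_indic_sum_prod_le unit [:: tt] xpredT (fun=> kappa)
    (fun _ _ z => 1 + a * \1_E z)%R (fun _ _ => (1 + a * q)%R) (fun=> k0)
    (fun _ _ => mind a) (fun _ _ => ind0) mom.
  under eq_integral => w _ do rewrite big_cons big_nil addr0.
  rewrite big_cons big_nil addr0 => H; apply: le_trans H _.
  rewrite lee_fin ler_wpM2l ?mass_ge0//; apply: le_trans kx.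
  rewrite ler_wpM2l// prodr_const expRM_natl lerXn2r ?nnegrE ?expR_ge0//.
  exact: expR_ge1Dx.
pose T1 w := (2 `^ (- (4 * n * q)) * \prod_(s in B) (1 + 1 * \1_E (Z s w)))%R.
pose T2 w := (2 `^ (n * q / 4) * \prod_(s in B) (1 + (- 2^-1) * \1_E (Z s w)))%R.
pose X (p : {set I} * (bool * bool * bool)) :=
  (p.1 \in powerset B) && (81 * Lam <= #|p.1|%:R)%R.
pose kappa (p : {set I} * (bool * bool * bool)) :=
  expR (- (2 * deviation Lam p.1 ^+ 2 * #|cls p.1 p.2.2|%:R)).
pose h (p : {set I} * (bool * bool * bool)) := cell_weight Q E Y cls Lam p.1 p.2.
pose T3 w := (\sum_(p | X p) kappa p * \prod_(s in B) h p s (Z s w))%R.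
have excessE w : excess Q E Y B cls Lam (Z ^~ w) = (T1 w + T2 w + T3 w)%R.
  rewrite /excess /T1 /T2 /T3 pair_big/=; congr (_ * _ + _ * _ + _)%R.
  - by apply: eq_bigr => s _; rewrite mul1r.
  - by apply: eq_bigr => s _; rewrite mulNr mulrC.
  - by apply: eq_big => [p|p _]; rewrite ?andbT.
have T1_ge0 w : (0 <= T1 w)%R.
  by rewrite mulr_ge0 ?powR_ge0// prodr_ge0// => s _; rewrite mul1r addr_ge0.
have T2_ge0 w : (0 <= T2 w)%R.
  rewrite mulr_ge0 ?powR_ge0// prodr_ge0// => s _.
  by rewrite indicE; case: (_ \in _) => /=; lra.
have T3_ge0 w : (0 <= T3 w)%R.
  apply: sumr_ge0 => p _; rewrite mulr_ge0 ?expR_ge0//; apply: prodr_ge0 => s _.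
  exact: cell_weight_ge0.
have mT1 : measurable_fun setT T1.
  apply: measurable_funM => //.
  by apply: (measurable_prod_sample mZ B (h := (fun _ z => 1 + 1 * \1_E z)%R)).
have mT2 : measurable_fun setT T2.
  apply: measurable_funM => //.
  by apply: (measurable_prod_sample mZ B (h := (fun _ z => 1 + - 2^-1 * \1_E z)%R)).
have mT3 : measurable_fun setT T3.
  rewrite /T3; under eq_fun do rewrite big_mkcond.
  apply: measurable_sum => p; case: (X p) => //; apply: measurable_funM => //.
  by apply: (measurable_prod_sample mZ) => s; exact: measurable_cell_weight.
have mDZ : measurable_fun setT (fun w => \1_D (Z i0 w) : R) by exact: measurableT_comp.
under eq_integral => w _ do rewrite excessE !mulrDr 2!EFinD.
rewrite ge0_integralD//; last 4 first.
- by move=> w _; rewrite -EFinD lee_fin addr_ge0// mulr_ge0.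
- by apply: emeasurable_funD; apply/measurable_EFinP; exact: measurable_funM.
- by move=> w _; rewrite lee_fin mulr_ge0.
- by apply/measurable_EFinP; exact: measurable_funM.
rewrite ge0_integralD//; last 4 first.
- by move=> w _; rewrite lee_fin mulr_ge0.
- by apply/measurable_EFinP; exact: measurable_funM.
- by move=> w _; rewrite lee_fin mulr_ge0.
- by apply/measurable_EFinP; exact: measurable_funM.
rewrite mulrDr EFinD leeD//.
  rewrite mulr_natl mulr2n mulrDr EFinD leeD//; apply: tail; rewrite ?powR_ge0//; try lra.
    by rewrite /powR gt_eqF// -expRD ler_expR; nra.
  by rewrite /powR gt_eqF// -expRD ler_expR; nra.
have mom p s : X p -> \int[Q]_z (h p s z)%:E <= (cell_weight_bound p.1 p.2 s)%:E.
  by move=> /andP[_]; exact: integral_cell_weight.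
have := @integral_indic_sum_prod_le _ (index_enum _) X kappa h
  (fun p => cell_weight_bound p.1 p.2) (fun=> expR_ge0 _)
  (fun p => measurable_cell_weight p.1 p.2)
  (fun p => cell_weight_ge0 Q E Y cls Lam p.1 p.2) mom.
move=> /le_trans; apply.
rewrite lee_fin ler_wpM2l ?mass_ge0//.
have -> : (\sum_(p | X p) kappa p * \prod_(s in B) cell_weight_bound p.1 p.2 s =
  \sum_(V in powerset B | 81 * Lam <= #|V|%:R) \sum_kbe
    kappa (V, kbe) * \prod_(s in B) cell_weight_bound V kbe s)%R.
  by rewrite pair_big/=; apply: eq_bigl => p; rewrite andbT.
apply: (@le_trans _ _ (\sum_(V in powerset B) 8 * (expR (- Lam) *
    \prod_(s in B) (if s \in V then q else 1 - q))))%R.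
  rewrite big_mkcondr; apply: ler_sum => V; rewrite inE => VB.
  have w0 : (0 <= expR (- Lam) * \prod_(s in B) (if s \in V then q else 1 - q))%R.
    rewrite mulr_ge0 ?expR_ge0//; apply: prodr_ge0 => s _; case: ifP => _.
      exact: mass_ge0.
    by rewrite subr_ge0.
  case: ifPn => V81; last by rewrite mulr_ge0.
  apply: le_trans (ler_sum _ (fun kbe _ => prod_cell_weight_bound kbe VB V81)) _.
  by rewrite sumr_const !card_prod card_bool mulr_natl.
rewrite -mulr_sumr ler_pM2l// -mulr_sumr ler_piMr ?expR_ge0//.
by apply: sum_powerset_bernoulli; rewrite mass_ge0.
Qed.

End ExcessMoment.

(** * Bins of a regular grid *)

Section Cells.
Context {R : realType} {d : nat}.
Implicit Types (x : d.-tuple R) (C : @bin d).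

Definition half_cube : set (d.-tuple R) := [set x | forall j, 0 <= tnth x j < 1].

Definition grid_bin N (v : {ffun 'I_d -> 'I_N}) : @bin d :=
  (N, [tuple (v j : nat) | j < d]).

Lemma half_cube_cube : half_cube `<=` cube.
Proof. by move=> x hx j; have /andP[-> /ltW] := hx j. Qed.

Lemma in_bin_scaled C x : (0 < C.1)%N ->
  in_bin C x = [forall j, (tnth C.2 j)%:R <= tnth x j * C.1%:R < (tnth C.2 j).+1%:R].
Proof.
move=> C0; apply: eq_forallb => j.
by rewrite /width ler_pdivrMr ?ltr0n// ltr_pdivlMr ?ltr0n.
Qed.

Lemma natr_between_inj (y : R) (a b : nat) :
  a%:R <= y < a.+1%:R -> b%:R <= y < b.+1%:R -> a = b.
Proof.
move=> /andP[ay ya] /andP[b_y yb]; apply/eqP; rewrite eqn_leq.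
by rewrite -(ltnS a) -(ltnS b) -2!(ltr_nat R) (le_lt_trans ay yb) (le_lt_trans b_y ya).
Qed.

Lemma in_bin_inj C C' x : (0 < C.1)%N -> C.1 = C'.1 ->
  in_bin C x -> in_bin C' x -> C = C'.
Proof.
case: C C' => [n c] [n' c'] /= n0 nn'; rewrite -nn' !in_bin_scaled//=.
move=> /forallP xc /forallP xc'; congr (_, _); apply: eq_from_tnth => j.
exact: natr_between_inj (xc j) (xc' j).
Qed.

Lemma grid_bin_exists N x : (0 < N)%N -> half_cube x ->
  exists v : {ffun 'I_d -> 'I_N}, in_bin (grid_bin v) x.
Proof.
move=> N0 hx.
have tN j : (Num.truncn (tnth x j * N%:R) < N)%N.
  have /andP[x0 x1] := hx j.
  rewrite -(ltr_nat R); apply: le_lt_trans (_ : tnth x j * N%:R < _).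
    by rewrite truncn_le// mulr_ge0.
  by rewrite -[ltRHS]mul1r ltr_pM2r// ltr0n.
exists [ffun j => Ordinal (tN j)]; rewrite in_bin_scaled//.
apply/forallP => j /=; rewrite tnth_mktuple ffunE/=.
have /andP[x0 x1] := hx j.
by apply: truncn_itv; rewrite mulr_ge0.
Qed.

Lemma grid_bin_half_cube N (v : {ffun 'I_d -> 'I_N}) x : (0 < N)%N ->
  in_bin (grid_bin v) x -> half_cube x.
Proof.
move=> N0; rewrite in_bin_scaled// => /forallP xv j; have /= := xv j.
rewrite tnth_mktuple => /andP[vx xv1]; apply/andP; split.
  by rewrite -(@pmulr_lge0 _ N%:R) ?ltr0n//; apply: le_trans vx.
have Nr : 0 < N%:R :> R by rewrite ltr0n.
rewrite -(ltr_pM2r Nr) mul1r; apply: lt_le_trans xv1 _.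
by rewrite ler_nat.
Qed.

(** Dividing the fine coordinates by [g] recovers the coarse ones, and the remainders select the
    child. *)
Lemma child_grid_bin_exists N (v : {ffun 'I_d -> 'I_N}) g x : (0 < N)%N -> (0 < g)%N ->
  in_bin (grid_bin v) x ->
  exists v' : {ffun 'I_d -> 'I_(N * g)},
    grid_bin v' \in child (grid_bin v) g /\ in_bin (grid_bin v') x.
Proof.
move=> N0 g0 xv; have hx := grid_bin_half_cube N0 xv.
have Ng0 : (0 < N * g)%N by rewrite muln_gt0 N0.
have [v' xv'] := grid_bin_exists Ng0 hx.
exists v'; split=> //.
have v'v j : (v' j %/ g)%N = v j.
  move: xv xv'; rewrite !in_bin_scaled//= => /forallP/(_ j) + /forallP/(_ j).
  rewrite !tnth_mktuple natrM mulrA => xv /andP[v'x xv'].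
  apply: (@natr_between_inj (tnth x j * N%:R)) => //.
  have gr : 0 < g%:R :> R by rewrite ltr0n.
  rewrite -(ler_pM2r gr) -(ltr_pM2r gr) -!natrM; apply/andP; split.
    by apply: le_trans v'x; rewrite ler_nat leq_trunc_div.
  by apply: lt_le_trans xv' _; rewrite ler_nat ltn_ceil.
have v'g j : (v' j %% g < g)%N by rewrite ltn_mod.
apply/mapP; exists [ffun j => Ordinal (v'g j)]; first exact: mem_enum.
congr (_, _); apply: eq_from_tnth => j; rewrite !tnth_mktuple ffunE/=.
by rewrite -v'v -divn_eq.
Qed.

Lemma width_grid_bin N (v : {ffun 'I_d -> 'I_N}) : width (grid_bin v) = N%:R^-1 :> R.
Proof. by []. Qed.

Lemma dist2_in_bin C x x' : in_bin C x -> in_bin C x' ->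
  dist2 x x' <= Num.sqrt d%:R * width C.
Proof.
move=> /forallP xC /forallP x'C; have w0 := @width_ge0 R d C.
rewrite /dist2 -[X in _ <= _ * X]ger0_norm// -sqrtr_sqr -sqrtrM// ler_wsqrtr//.
have -> : d%:R * width C ^+ 2 = \sum_(j < d) width C ^+ 2 :> R.
  by rewrite sumr_const card_ord mulr_natl.
apply: ler_sum => j _.
have /andP[a1 a2] := xC j; have /andP[b1 b2] := x'C j.
rewrite -[leLHS]real_normK ?num_real// ler_pXn2r ?nnegrE// ler_norml.
by move: a2 b2; rewrite -(natr1 (tnth C.2 j)) mulrDl mul1r => a2 b2; lra.
Qed.

End Cells.

(** * Consequences of the density, regression and smoothness conditions on bins *)

Section Instance.
Context {R : realType} {d : nat}.
Variables (L beta cl cu : R) (Q : probability (obs R d) R).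
Variable f : bool -> d.-tuple R -> R.
Hypotheses (beta0 : 0 < beta) (L0 : 0 < L) (cl0 : 0 < cl).
Hypothesis inst : bandit_instance cl cu Q f.
Hypothesis smooth_f : smooth L beta f.

Lemma measurable_ctx : measurable_fun setT (@ctx R d).
Proof. exact: measurable_fst. Qed.

Lemma measurable_reward k : measurable_fun setT (@reward R d k).
Proof.
have m2 : measurable_fun setT (fun z : obs R d => z.2) by exact: measurable_snd.
case: k; first exact: (measurableT_comp measurable_fst m2).
exact: (measurableT_comp measurable_snd m2).
Qed.

Lemma measurable_ctx_preimage (A : set (d.-tuple R)) :
  measurable A -> measurable (@ctx R d @^-1` A).
Proof. by move=> mA; rewrite -[X in measurable X]setTI; exact: measurable_ctx. Qed.

Lemma measurable_admissible : measurable [set z : obs R d | admissible z].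
Proof.
rewrite (_ : mkset _ = (@ctx R d @^-1` cube) `&`
  ((@reward R d true @^-1` `[0, 1]) `&` (@reward R d false @^-1` `[0, 1]))).
  apply: measurableI; first by apply: measurable_ctx_preimage; exact: measurable_cube.
  have mr k : measurable (@reward R d k @^-1` `[0, 1]).
    rewrite -[X in measurable X]setTI. apply: (measurable_reward k) => //.
  exact: measurableI.
apply/seteqP; split=> [z [zc zr]|z [zc [zt zf]]].
  by split=> //; split; rewrite /= in_itv/=; [exact: (zr true)|exact: (zr false)].
by split=> // -[]; [move: zt|move: zf]; rewrite /= in_itv.
Qed.

(** Admissibility is built in so that the rewards lie in [0,1] everywhere on a cell, as the moment
    bounds require, and not just almost everywhere. *)
Definition cell (C : @bin d) : set (obs R d) :=
  [set z | in_bin C (ctx z) /\ admissible z].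

Lemma measurable_cell C : measurable (cell C).
Proof.
rewrite (_ : cell C = (@ctx R d @^-1` [set x | in_bin C x]) `&` [set z | admissible z])//.
apply: measurableI; last exact: measurable_admissible.
by apply: measurable_ctx_preimage; exact: measurable_in_bin.
Qed.

Lemma integral_cell C (h : obs R d -> \bar R) :
  measurable_fun (ctx @^-1` [set x | in_bin C x]) h ->
  (\int[Q]_(z in cell C) h z = \int[Q]_(z in ctx @^-1` [set x | in_bin C x]) h z)%E.
Proof.
move=> mh; have [adm _ _] := inst.
have mb := measurable_ctx_preimage (@measurable_in_bin R d C).
rewrite integral_mkcond [RHS]integral_mkcond; apply: ae_eq_integral => //.
- by apply/(measurable_restrictT _ _).1 => //; [exact: measurable_cell|];
  apply: measurable_funS mh => // z [].
- exact/(measurable_restrictT _ _).1.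
apply: filterS adm => z zadm _; rewrite !patchE.
congr (if _ then _ else _); apply/idP/idP; rewrite !inE; first by case.
by move=> zC; split.
Qed.

Lemma mass_cellE C : mass Q (cell C) = mass Q (ctx @^-1` [set x | in_bin C x]).
Proof.
rewrite /mass -[X in fine X = _]mul1e -[X in _ = fine X]mul1e.
rewrite -!integral_cst//; first by rewrite integral_cell.
- by apply: measurable_ctx_preimage; exact: measurable_in_bin.
- exact: measurable_cell.
Qed.

Lemma mass_cell_bounds N (v : {ffun 'I_d -> 'I_N}) : (0 < N)%N ->
  cl * N%:R^-1 ^+ d <= mass Q (cell (grid_bin v)) <= cu * N%:R^-1 ^+ d.
Proof.
move=> N0; rewrite mass_cellE -!lee_fin massE; last first.
  by apply: measurable_ctx_preimage; exact: measurable_in_bin.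
have [_ dens _] := inst.
apply: (bounded_density cl0 dens) => //; first exact: measurable_in_bin.
  by move=> x /(grid_bin_half_cube N0); exact: half_cube_cube.
by rewrite lebesgue_tuple_in_bin.
Qed.

Lemma measurable_half_cube : measurable (@half_cube R d).
Proof.
rewrite (_ : half_cube = box (fun=> `[0, 1[%classic)); first exact: measurable_box.
by apply/seteqP; split=> x xc j; have := xc j; rewrite /= in_itv.
Qed.

(** Points with a coordinate equal to 1 lie in no bin, so the algorithm is not controlled there. The
    closed and the half-open cube have the same volume. *)
Lemma negligible_upper_faces : Q (ctx @^-1` (cube `\` half_cube)) = 0%E.
Proof.
have [_ dens _] := inst.
have mF : measurable (cube `\` @half_cube R d).
  apply: measurableD; [exact: measurable_cube|exact: measurable_half_cube].
have vol b : lebesgue_tuple d (box (fun=> [set` Interval (BLeft 0) (BSide b 1)])) = 1%:E :> \bar R.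
  rewrite lebesgue_tuple_box//; apply: big1 => j _.
  by rewrite lebesgue_measure_itv/= lte_fin ltr01 sube0.
have cubeE : cube = box (fun=> `[0, 1]%classic) :> set (d.-tuple R).
  by apply/seteqP; split=> x xc j; have := xc j; rewrite /= in_itv.
have halfE : half_cube = box (fun=> `[0, 1[%classic) :> set (d.-tuple R).
  by apply/seteqP; split=> x xc j; have := xc j; rewrite /= in_itv.
have volc : lebesgue_tuple d cube = 1%:E :> \bar R by rewrite cubeE; exact: vol.
have volh : lebesgue_tuple d half_cube = 1%:E :> \bar R by rewrite halfE; exact: vol.
have F0 : lebesgue_tuple d (cube `\` @half_cube R d) = 0%:E.
  rewrite measureD; last 3 first.
  - exact: measurable_cube.
  - exact: measurable_half_cube.
  - by apply: le_lt_trans (ltry 1); rewrite le_eqVlt; apply/orP; left; apply/eqP.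
  have -> : cube `&` half_cube = @half_cube R d.
    by apply/seteqP; split=> [x []//|x hx]; split=> //; exact: half_cube_cube.
  by transitivity (1%:E - 1%:E : \bar R)%E; [congr (_ - _)%E|rewrite subee].
apply/eqP; rewrite eq_le measure_ge0 andbT.
have /andP[_] := bounded_density cl0 dens mF (@subDsetl _ _ _) F0.
by rewrite mulr0.
Qed.

Definition oscillation (C : @bin d) : R := L * (Num.sqrt d%:R * width C) `^ beta.

(** Testing the regression property on the bin turns the mean reward into the mean of [f k], which
    differs from any value of [f k] on the bin by at most the oscillation. *)
Lemma cell_mean_oscillation C x k : 0 < mass Q (cell C) ->
  [set x : d.-tuple R | in_bin C x] `<=` cube -> in_bin C x ->
  `|f k x - cell_mean Q (cell C) (reward k)| <= oscillation C.
Proof.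
move=> q0 Ccube xC; have [_ _ reg] := inst; have [mf fE] := reg k.
have mC := @measurable_in_bin R d C; have mcell := measurable_cell C.
have osc x' : in_bin C x' -> `|f k x - f k x'| <= oscillation C.
  move=> x'C; apply: le_trans (smooth_f k (Ccube _ xC) (Ccube _ x'C)) _.
  apply: ler_wpM2l; first exact: ltW.
  apply: ge0_ler_powR; [exact: ltW| | |exact: dist2_in_bin].
    by rewrite nnegrE sqrtr_ge0.
  by rewrite nnegrE mulr_ge0 ?sqrtr_ge0 ?width_ge0.
set h : obs R d -> R := fun z => f k (ctx z).
have mh : measurable_fun (cell C) h.
  apply: (@measurable_comp _ _ _ _ _ _ cube) => //; first exact: measurable_cube.
    by move=> _ [z [zC _] <-]; exact: Ccube.
  by apply: measurable_funTS; exact: measurable_ctx.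
have rewE : (\int[Q]_(z in cell C) (reward k z)%:E = \int[Q]_(z in cell C) (h z)%:E)%E.
  rewrite [LHS]integral_cell; last first.
    by apply/measurable_EFinP; apply: measurable_funTS; exact: measurable_reward.
  rewrite fE// integral_cell//; apply/measurable_EFinP.
  apply: (@measurable_comp _ _ _ _ _ _ cube) => //; first exact: measurable_cube.
    by move=> _ [z zC <-]; exact: Ccube.
  by apply: measurable_funTS; exact: measurable_ctx.
have cst_mass a : (\int[Q]_(z in cell C) a%:E = (a * mass Q (cell C))%:E)%E.
  by rewrite integral_cst// EFinM massE.
have hosc z : cell C z -> `|h z - f k x| <= oscillation C.
  by move=> [zC _]; rewrite distrC; exact: osc.
have ih : Q.-integrable (cell C) (EFin \o h).
  apply: measurable_bounded_integrable => //.
    by rewrite ltey_eq fin_num_measure.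
  exists (`|f k x| + oscillation C); split; first by rewrite num_real.
  move=> r r1 z /hosc zo; apply: le_trans (ltW r1).
  by rewrite -[h z](subrK (f k x)) addrC (le_trans (ler_normD _ _))// lerD2l.
set I := fine (\int[Q]_(z in cell C) (h z)%:E).
have IE : (\int[Q]_(z in cell C) (h z)%:E = I%:E)%E.
  by rewrite fineK//; exact: integrable_fin_num.
have -> : cell_mean Q (cell C) (reward k) = I / mass Q (cell C).
  by rewrite /cell_mean rewE.
have icst a : Q.-integrable (cell C) (fun=> a%:E).
  exact: finite_measure_integrable_cst.
have lo : (f k x - oscillation C) * mass Q (cell C) <= I.
  rewrite -lee_fin -cst_mass -IE; apply: le_integral => // z zC.
  have := hosc z (set_mem zC); rewrite lee_fin ler_norml; lra.
have hi : I <= (f k x + oscillation C) * mass Q (cell C).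
  rewrite -lee_fin -cst_mass -IE; apply: le_integral => // z zC.
  have := hosc z (set_mem zC); rewrite lee_fin ler_norml; lra.
have lo' : f k x - oscillation C <= I / mass Q (cell C) by rewrite ler_pdivlMr.
have hi' : I / mass Q (cell C) <= f k x + oscillation C by rewrite ler_pdivrMr.
rewrite ler_norml; lra.
Qed.

Local Notation gap x := `|f true x - f false x|.

Lemma arm_regret_ge0 k x : 0 <= Num.max (f true x) (f false x) - f k x.
Proof. by rewrite subr_ge0 le_max; case: k; rewrite lexx ?orbT. Qed.

Lemma arm_regret_le_gap k x : Num.max (f true x) (f false x) - f k x <= gap x.
Proof.
rewrite lerBlDr ge_max.
have n1 := ler_norm (f true x - f false x).
have n2 := ler_norm (f false x - f true x); rewrite distrC in n2.
by have n0 := normr_ge0 (f true x - f false x); case: k; apply/andP; split; lra.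
Qed.

(** The 1 comes from the mean rewards of the unit bin, which lie in [0,1]; each [f k] is within its
    oscillation of the corresponding mean. *)
Lemma gap_half_cube_le x : half_cube x -> gap x <= 1 + 2 * (L * Num.sqrt d%:R `^ beta).
Proof.
move=> hx; have [v vx] := grid_bin_exists (ltn0Sn 0) hx.
have Ccube : [set y : d.-tuple R | in_bin (grid_bin v) y] `<=` cube.
  by move=> y /(grid_bin_half_cube (ltn0Sn 0)); exact: half_cube_cube.
have q0 : 0 < mass Q (cell (grid_bin v)).
  have /andP[qlo _] := mass_cell_bounds v (ltn0Sn 0).
  by apply: lt_le_trans qlo; rewrite invr1 expr1n mulr1.
have osc k := cell_mean_oscillation k q0 Ccube vx.
have mean k : 0 <= cell_mean Q (cell (grid_bin v)) (reward k) <= 1.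
  apply: cell_mean_bounds => //; first exact: measurable_cell.
    exact: measurable_reward.
  by move=> z [_ [_ zk]].
have := osc true; have := osc false; have := mean true; have := mean false.
rewrite /oscillation width_grid_bin invr1 mulr1 !ler_norml.
move=> /andP[? ?] /andP[? ?] /andP[? ?] /andP[? ?]; apply/andP; split; lra.
Qed.

Lemma gap_cube_le x : cube x -> gap x <= 1 + 4 * (L * Num.sqrt d%:R `^ beta).
Proof.
move=> xc; pose o : d.-tuple R := [tuple 0 | _ < d].
have ho : half_cube o by move=> j; rewrite tnth_mktuple lexx ltr01.
have dist k : `|f k x - f k o| <= L * Num.sqrt d%:R `^ beta.
  apply: le_trans (smooth_f k xc (half_cube_cube ho)) _.
  apply: ler_wpM2l; first exact: ltW.
  apply: ge0_ler_powR; [exact: ltW|by rewrite nnegrE sqrtr_ge0..|].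
  rewrite ler_wsqrtr//.
  have -> : d%:R = \sum_(j < d) 1 :> R by rewrite sumr_const card_ord.
  apply: ler_sum => j _.
  by rewrite tnth_mktuple subr0 expr_le1//; have /andP[] := xc j.
have := dist true; have := dist false; have := gap_half_cube_le ho.
rewrite !ler_norml => /andP[? ?] /andP[? ?] /andP[? ?].
by apply/andP; split; lra.
Qed.

End Instance.

(** * Rewards collected by a round robin *)

Section Parity.

(** For a set of rounds the enumeration is increasing, so a class consists of every other visit in
    chronological order. It depends on [V] alone, as the classes in [excess] must. *)
Definition parity_class (I : finType) (V : {set I}) (e : bool) : {set I} :=
  [set s in V | odd (index s (enum V)) == e].

Lemma parity_class_sub (I : finType) (V : {set I}) e : parity_class V e \subset V.
Proof. by apply/fintype.subsetP => s; rewrite inE => /andP[]. Qed.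

Lemma count_parity_iota e m n : (n <= (count (fun i => odd i == e) (iota m n)).*2.+1)%N.
Proof.
have [k] := ubnP n; elim: k n m => // k IH [|[|n]] m //= nk.
have := IH n m.+2 (leq_trans (leqnSn _) nk).
by move: (count _ _) => c; clear IH; case: (odd m); case: e => /=; lia.
Qed.

Lemma card_setI_count (I : finType) (V : {set I}) (p : pred I) :
  #|[set s in V | p s]| = count p (enum V).
Proof.
by rewrite -sum1_card -sum1_count big_enum_cond; apply: eq_bigl => s; rewrite inE.
Qed.

Lemma leq_card_parity_class (I : finType) (V : {set I}) e :
  (#|V| <= #|parity_class V e|.*2.+1)%N.
Proof.
rewrite card_setI_count cardE.
have -> : count (fun s => odd (index s (enum V)) == e) (enum V) =
    count (fun i => odd i == e) (map (index^~ (enum V)) (enum V)).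
  by rewrite count_map.
have -> : map (index^~ (enum V)) (enum V) = iota 0 (size (enum V)).
  apply: (@eq_from_nth _ 0%N); rewrite size_map ?size_iota// => i iV.
  have [x0] : exists x0 : I, x0 \in enum V.
    by case: (enum V) iV => // x s _; exists x; rewrite mem_head.
  move=> _; rewrite (nth_map x0)// nth_iota// index_uniq//.
  exact: enum_uniq.
exact: count_parity_iota.
Qed.

Lemma alternating_nth (T : Type) (x0 : T) (a : T -> bool) (l : seq T) :
  sorted (fun s s' => a s != a s') l ->
  forall i, (i < size l)%N -> a (nth x0 l i) = a (nth x0 l 0) (+) odd i.
Proof.
move=> sl; elim=> [|i IH] il; first by rewrite addbF.
have /= := elimT (sortedP x0) sl i il; rewrite IH ?(ltnW il)//=.
by case: (a (nth x0 l i.+1)); case: (a (nth x0 l 0)); case: (odd i).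
Qed.

End Parity.

Section Visits.
Context {R : realType} {d : nat}.
Variables (T : nat) (t : nat -> nat) (z : nat -> obs R d) (a : nat -> bool).
Hypothesis z_adm : forall s, (s < T)%N -> admissible (z s).
Variables (i : nat) (C : @bin d).
Hypotheses (t_mono : (t i.-1 <= t i)%N) (t_le : (t i <= T)%N).

Definition batch_set : {set 'I_T} := [set s : 'I_T | (t i.-1 <= s < t i)%N]%SET.

Local Notation zT := (fun s : 'I_T => z s).
Local Notation V := (visitors (cell C) batch_set zT).

(** Links the lists of rounds of the algorithm to the finite sets indexing [excess]. Both lists are
    strictly increasing, so it suffices that they have the same members. *)
Lemma visits_enum : visits t z i C = [seq val s | s <- enum V].
Proof.
have tr : transitive ltn by exact: ltn_trans.
have irr : irreflexive ltn by exact: ltnn.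
apply: (irr_sorted_eq tr irr).
- by apply: sorted_filter => //; exact: iota_ltn_sorted.
- rewrite sorted_map /enum_mem; apply: sorted_filter.
    by move=> x y w; exact: ltn_trans.
  rewrite -sorted_map -enumT val_enum_ord.
  exact: iota_ltn_sorted.
move=> s; rewrite mem_filter mem_iota (subnKC t_mono).
apply/idP/mapP => [/andP[sC /andP[ts st]]|[s' + ->]].
  have sT : (s < T)%N by exact: leq_trans st t_le.
  exists (Ordinal sT) => //; rewrite mem_enum !inE/= ts st/=.
  by apply/mem_set; split; last exact: z_adm.
by rewrite mem_enum !inE => /andP[/andP[-> ->] /set_mem[-> _]].
Qed.

Lemma size_visits : size (visits t z i C) = #|V|.
Proof. by rewrite visits_enum size_map cardE. Qed.

(* Whichever arm starts the round robin, the rounds at which a given arm is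
   pulled form one of the two parity classes of the visits; controlling both
   classes dispenses with any measurability or independence of the policy. *)
Lemma mean_reward_parity : sorted (fun s s' => a s != a s') (visits t z i C) ->
  exists e : bool -> bool, forall k, mean_reward t z a i C k =
    (\sum_(s in parity_class V (e k)) reward k (z s)) / #|parity_class V (e k)|%:R.
Proof.
rewrite /mean_reward visits_enum sorted_map => alt.
(* [a0] is the arm of the first visit, and an arbitrary arm if there is none. *)
have [a0 aE] : exists a0, forall s : 'I_T, s \in V ->
    a s = a0 (+) odd (index s (enum V)).
  have [->|[s0 _]] := set_0Vmem V; first by exists true => s; rewrite inE.
  exists (a (nth s0 (enum V) 0)) => s; rewrite -mem_enum => sV.
  have iV : (index s (enum V) < size (enum V))%N by rewrite index_mem.
  have := @alternating_nth _ s0 (fun s : 'I_T => a s) _ alt _ iV.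
  by rewrite nth_index.
exists (fun k => a0 (+) k) => k.
have clsE s : (s \in V) && (a (val s) == k) = (s \in parity_class V (a0 (+) k)).
  rewrite [RHS]inE; case sV: (s \in V) => //=; rewrite aE//.
  by clear aE; case: a0; case: (k); case: (odd _).
rewrite big_map big_enum_cond/= (eq_bigl _ _ clsE); congr (_ / _%:R).
rewrite count_map -card_setI_count; apply: eq_card => s.
by rewrite -clsE inE.
Qed.

End Visits.

(** * Guarantees on a good bin *)

Section GoodEvent.
Context {R : realType} {d : nat}.
Variables (Q : probability (obs R d) R) (f : bool -> d.-tuple R -> R).
Variables (T : nat) (t : nat -> nat) (z : nat -> obs R d) (a : nat -> bool).
Hypothesis z_adm : forall s, (s < T)%N -> admissible (z s).
Variables (i : nat) (C : @bin d) (osc : R).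
Hypotheses (t_mono : (t i.-1 <= t i)%N) (t_le : (t i <= T)%N).

Local Notation zT := (fun s : 'I_T => z s).
Local Notation V := (visitors (cell C) (batch_set T t i) zT).
Local Notation mu k := (cell_mean Q (cell C) (reward k)).
Local Notation Lam := (ln (2 * T%:R * width C ^+ d) : R).
Local Notation U := (threshold T (size (visits t z i C)) C : R).
Local Notation mean k := (mean_reward t z a i C k).

Definition bin_excess : R :=
  excess Q (cell C) (@reward R d) (batch_set T t i)
    (@parity_class 'I_T) Lam zT.

Hypothesis Lam0 : 0 < Lam.
Hypothesis many_visits : 81 * Lam <= #|batch_set T t i|%:R * mass Q (cell C) / 4.
Hypothesis few_visits : forall m : nat, (0 < m)%N ->
  m%:R < 4 * #|batch_set T t i|%:R * mass Q (cell C) -> 8 * osc <= threshold T m C :> R.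
Hypothesis alternate : sorted (fun s s' => a s != a s') (visits t z i C).
Hypothesis good : bin_excess < 1.

Lemma mean_reward_deviation k : `|mean k - mu k| <= 3 / 8 * U.
Proof.
have [Vlo Vhi dev] := excess_lt1 (@parity_class_sub 'I_T) Lam0 good.
have {}dev := dev (le_trans many_visits (ltW Vlo)).
have [e ->] := mean_reward_parity z_adm t_mono t_le alternate.
set c := parity_class _ _; have := dev k (e k); rewrite -/c => devk.
(* The deviation bound is strict, which rules out an empty class, whose average would be the default
   value 0. *)
have c0 : 0 < #|c|%:R :> R.
  rewrite ltr0n lt0n; apply: contraTN devk => /eqP ->.
  by rewrite mul0r -leNgt.
have -> : 3 / 8 * U = deviation Lam V.
  by rewrite /threshold /deviation (size_visits z_adm C t_mono t_le); lra.
have -> : (\sum_(s in c) reward k (z s)) / #|c|%:R - mu k =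
    (\sum_(s in c) (reward k (z s) - mu k)) / #|c|%:R.
  by rewrite sumrB sumr_const mulrBl -(mulr_natr (mu k)) mulfK ?gt_eqF.
by rewrite normrM normfV (ger0_norm (ltW c0)) ler_pdivrMr// mulrC ltW.
Qed.

Lemma good_threshold : 8 * osc <= U /\
  exists m : nat, [/\ #|batch_set T t i|%:R * mass Q (cell C) / 4 < m%:R & U = threshold T m C :> R].
Proof.
have [Vlo Vhi _] := excess_lt1 (@parity_class_sub 'I_T) Lam0 good.
have V0 : (0 < #|V|)%N.
  rewrite -(ltr_nat R); apply: le_lt_trans Vlo.
  by rewrite divr_ge0// mulr_ge0// mass_ge0.
by split; [|exists #|V|]; rewrite (size_visits z_adm C t_mono t_le)//; exact: few_visits.
Qed.

Variable x : d.-tuple R.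
Hypothesis osc_x : forall k, `|f k x - mu k| <= osc.

(** The two averages differ by at most [U], and each is within 3/8 [U] + 1/8 [U] = [U] / 2 of the
    value of [f] at [x]. *)
Lemma good_both_survive : (1 < #|surviving T t z a i C|)%N ->
  `|f true x - f false x| <= 2 * U.
Proof.
move=> S2; have [osc8 _] := good_threshold.
have mem_surv k : k \in surviving T t z a i C.
  have /eqP -> : surviving T t z a i C == [set: bool]%SET.
    by rewrite eqEcard finset.subsetT cardsT card_bool.
  by rewrite inE.
have := mem_surv true; rewrite inE lerBlDr ge_max => /andP[_ ft].
have := mem_surv false; rewrite inE lerBlDr ge_max => /andP[tf _].
have := mean_reward_deviation true; have := mean_reward_deviation false.
have := osc_x true; have := osc_x false; rewrite !ler_norml.
move=> /andP[? ?] /andP[? ?] /andP[? ?] /andP[? ?].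
by apply/andP; split; lra.
Qed.

(** Two errors of at most [U] / 2 cannot produce a difference larger than [U] in favour of the worse
    arm. *)
Lemma good_eliminated k : k \notin surviving T t z a i C -> f k x <= f (~~ k) x.
Proof.
have [osc8 _] := good_threshold.
have U0 : 0 <= U by rewrite mulr_ge0 ?sqrtr_ge0.
rewrite inE -ltNge ltrBrDr => maxk.
have other : U + mean k < mean (~~ k).
  by move: maxk; rewrite lt_max; case: k => /orP[]//= ?; lra.
have := mean_reward_deviation k; have := mean_reward_deviation (~~ k).
have := osc_x k; have := osc_x (~~ k); rewrite !ler_norml.
by move=> /andP[? ?] /andP[? ?] /andP[? ?] /andP[? ?]; lra.
Qed.

End GoodEvent.

(** * The active partition *)

Section Tracking.
Context {R : realType} {d : nat}.
Variables (M T : nat) (t g : nat -> nat) (z : nat -> obs R d) (a : nat -> bool).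
Variables (f : bool -> d.-tuple R -> R) (rho : nat -> R) (exc : nat -> @bin d -> R).

Local Notation gap x := `|f true x - f false x|.
Local Notation act := (active T t g z a).

Definition grid_size (i : nat) : nat := (\prod_(j < i) g j)%N.

Lemma surviving_neq0 i (C : @bin d) : surviving T t z a i C != finset.set0.
Proof.
have U0 n : 0 <= threshold T n C :> R by rewrite mulr_ge0 ?sqrtr_ge0.
apply/set0Pn; have [ft|tf] := leP (mean_reward t z a i C true) (mean_reward t z a i C false).
  by exists false; rewrite inE max_r// subrr.
exists true; rewrite inE max_l; last exact: ltW.
by rewrite subrr.
Qed.

Hypothesis g_gt0 : forall i, (i < M)%N -> (0 < g i)%N.
Hypothesis pulls : forall i, (1 <= i <= M)%N -> pulls_active_arms T t g z a i.
Hypothesis gap0 : forall x, half_cube x -> gap x <= rho 0.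
Hypothesis good_bin : forall i (v : {ffun 'I_d -> 'I_(grid_size i)}) x,
  (1 <= i < M)%N -> half_cube x -> in_bin (grid_bin v) x ->
  (grid_bin v, [set: bool]%SET) \in act i.-1 -> exc i (grid_bin v) < 1 ->
  ((1 < #|surviving T t z a i (grid_bin v)|)%N -> gap x <= rho i) /\
  (forall k, k \notin surviving T t z a i (grid_bin v) -> f k x <= f (~~ k) x).

(* Some earlier bin around [x] was bad, while [gap x] was still controlled by the
   goodness of its parent. *)
Definition exceptional (i : nat) (x : d.-tuple R) : Prop :=
  exists j (v : {ffun 'I_d -> 'I_(grid_size j)}),
    [/\ (1 <= j < i)%N, in_bin (grid_bin v) x, 1 <= exc j (grid_bin v) & gap x <= rho j.-1].

Definition undecided (i : nat) (x : d.-tuple R) : Prop :=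
  exists v : {ffun 'I_d -> 'I_(grid_size i)},
    [/\ in_bin (grid_bin v) x, (grid_bin v, [set: bool]%SET) \in act i.-1 & gap x <= rho i.-1].

(** [C] may belong to any earlier grid: a bin keeps the size it had when an arm was eliminated. *)
Definition decided (i : nat) (x : d.-tuple R) : Prop :=
  exists C k, [/\ in_bin C x, (C, [set k]%SET) \in act i.-1 & f (~~ k) x <= f k x].

Lemma grid_size_gt0 i : (i <= M)%N -> (0 < grid_size i)%N.
Proof.
move=> iM; apply: prodn_gt0 => j; apply: g_gt0; exact: leq_trans (ltn_ord j) iM.
Qed.

Lemma child_grid_size i (v : {ffun 'I_d -> 'I_(grid_size i)}) (x : d.-tuple R) :
  (i < M)%N -> in_bin (grid_bin v) x ->
  exists v' : {ffun 'I_d -> 'I_(grid_size i.+1)},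
    grid_bin v' \in child (grid_bin v) (g i) /\ in_bin (grid_bin v') x.
Proof.
move=> iM vx; rewrite /grid_size big_ord_recr/=.
exact: (child_grid_bin_exists (grid_size_gt0 (ltnW iM)) (g_gt0 iM)).
Qed.

(** Induction on the batch; the other two cases persist. From an undecided bin: if it is bad, the
    gap bound inherited from its parent makes the point exceptional; if it is good and both arms
    survive, the gap bound improves and passes to the child around [x]; if one arm survives, that
    arm is optimal at [x]. *)
Lemma tracking i x : (1 <= i <= M)%N -> half_cube x ->
  [\/ exceptional i x, undecided i x | decided i x].
Proof.
move=> + hx; case: i => // i /=; elim: i => [|i IH] iM.
  constructor 2.
  have [v0 v0x] : exists v : {ffun 'I_d -> 'I_(grid_size 0)}, in_bin (grid_bin v) x.
    by apply: grid_bin_exists => //; rewrite /grid_size big_ord0.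
  have [v [vc vx]] := child_grid_size iM v0x.
  exists v; split=> //=; last exact: gap0.
  apply/mapP; exists (grid_bin v) => //.
  suff -> : @Defs.root d = grid_bin v0 by [].
  have rx : in_bin (@Defs.root d) x.
    rewrite in_bin_scaled//; apply/forallP => j; rewrite tnth_mktuple mulr1.
    exact: hx.
  by apply: in_bin_inj rx v0x => //=; rewrite /grid_size big_ord0.
have {IH}[[j [v [/andP[j1 ji] vx ex gx]]]|[v [vx va gx]]|[C [k [Cx Ca kx]]]] := IH (ltnW iM).
- by constructor 1; exists j, v; split=> //; rewrite j1 (ltn_trans ji).
- have i1M : (1 <= i.+1 < M)%N by [].
  have [ex|ex] := leP 1 (exc i.+1 (grid_bin v)).
    by constructor 1; exists i.+1, v; split=> //; exact: ltnSn.
  have [small best] := good_bin i1M hx vx va ex.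
  set S := surviving T t z a i.+1 (grid_bin v) in small best.
  have upd : update T t g z a i.+1 (grid_bin v, [set: bool]%SET) =
      if (1 < #|S|)%N then [seq (C', S) | C' <- child (grid_bin v) (g i.+1)]
      else [:: (grid_bin v, S)].
    by rewrite /update/= cardsT card_bool.
  have acti CI : CI \in update T t g z a i.+1 (grid_bin v, [set: bool]%SET) ->
      CI \in act i.+1.
    by move=> CIu; apply/flatten_mapP; exists (grid_bin v, [set: bool]%SET).
  case: (ltnP 1 #|S|) => S2.
    constructor 2; have [v' [v'c v'x]] := child_grid_size iM vx.
    exists v'; split=> //; last exact: small.
    apply: acti; rewrite upd S2; apply/mapP; exists (grid_bin v') => //.
    congr (_, _); apply/esym/eqP.
    by rewrite eqEcard finset.subsetT cardsT card_bool.
  constructor 3.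
  have /cards1P[k Sk] : #|S| == 1%N.
    by rewrite eqn_leq S2 card_gt0; exact: surviving_neq0.
  exists (grid_bin v), k; split=> //.
    by apply: acti; rewrite upd ltnNge S2/= mem_seq1 Sk.
  by rewrite -{2}(negbK k); apply: best; rewrite Sk inE; case: (k).
- constructor 3; exists C, k; split=> //.
  apply/flatten_mapP; exists (C, [set k]%SET) => //.
  by rewrite /update/= cards1 mem_seq1.
Qed.

Lemma round_regret i s (x := ctx (z s)) :
  (1 <= i <= M)%N -> (t i.-1 <= s < t i)%N -> half_cube x ->
  [\/ exceptional i x, gap x <= rho i.-1 |
      Num.max (f true x) (f false x) - f (a s) x <= 0].
Proof.
move=> iM si hx; have [ex|[v [vx va gx]]|[C [k [Cx Ca kx]]]] := tracking iM hx.
- by constructor 1.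
- by constructor 2.
- constructor 3.
  have := pulls iM Ca; move=> /(_ s) as_k.
  have : a s \in [set k]%SET.
    apply: as_k; rewrite mem_filter Cx mem_iota.
    by move/andP: si => [-> /leq_trans->]//; rewrite -leq_subLR.
  rewrite inE => /eqP ->; rewrite subr_le0 ge_max.
  by case: k kx {Ca as_k} => /= ->; rewrite lexx.
Qed.

End Tracking.

(** * Expected regret *)

Section NonmeasurableMonotonicity.
Local Open Scope ereal_scope.
Context {R : realType} {dO : measure_display} {Omega : measurableType dO}.
Variable P : {measure set Omega -> \bar R}.

(* [f] need not be measurable: the integral of a nonnegative function is the
   supremum of the integrals of the simple functions below it. *)
Lemma ge0_le_integral_nonmeasurable (f g : Omega -> \bar R) :
  (forall w, 0 <= f w) -> (forall w, f w <= g w) ->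
  \int[P]_w f w <= \int[P]_w g w.
Proof.
move=> f0 fg; have g0 w : 0 <= g w by exact: le_trans (f0 w) (fg w).
rewrite !ge0_integralTE//; apply: le_ereal_sup => _ [h hf <-].
by exists h => // w; exact: le_trans (hf w) (fg w).
Qed.

End NonmeasurableMonotonicity.

Section TrivialRegret.
Context {R : realType} {d : nat}.

(** This serves a single batch, where the rate is [T] itself, and bounded horizons. *)
Lemma regret_trivial (L beta cl cu : R) (Q : probability (obs R d) R)
    (f : bool -> d.-tuple R -> R) (M T : nat) (t : nat -> nat)
    (pi : @policy R d M t) (dO : measure_display) (Omega : measurableType dO)
    (P : probability Omega R) (Z : nat -> {RV P >-> obs R d}) :
  0 < beta -> 0 < L -> 0 < cl -> bandit_instance cl cu Q f -> smooth L beta f ->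
  iid_sample T Q Z ->
  (regret T f Z pi <= (T%:R * (1 + 4 * (L * Num.sqrt d%:R `^ beta)))%:E)%E.
Proof.
move=> beta0 L0 cl0 inst sm [adm _ _]; rewrite /regret unlock.
set K := 1 + _.
apply: le_trans (ge0_le_integral_nonmeasurable P (g := fun=> (T%:R * K)%:E) _ _) _.
- by move=> w; rewrite lee_fin; apply: sumr_ge0 => s _; exact: arm_regret_ge0.
- move=> w; rewrite lee_fin mulr_natl -[X in _ *+ X]card_ord -sumr_const.
  apply: ler_sum => s _; apply: le_trans (arm_regret_le_gap _ _ _) _.
  by apply: (gap_cube_le beta0 L0 cl0 inst sm); have [] := adm s w (ltn_ord s).
by rewrite integral_cst//= probability_setT mule1.
Qed.

End TrivialRegret.

Section RegretBound.
Context {R : realType} {d : nat}.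
Variables (L beta cl cu : R) (Q : probability (obs R d) R).
Variable f : bool -> d.-tuple R -> R.
Hypotheses (beta0 : 0 < beta) (L0 : 0 < L) (cl0 : 0 < cl).
Hypothesis inst : bandit_instance cl cu Q f.
Hypothesis smooth_f : smooth L beta f.
Variables (M T : nat) (t g : nat -> nat) (rho : nat -> R).
Hypotheses (t0 : t 0%N = 0%N) (tM : t M = T).
Hypothesis t_incr : forall i, (i < M)%N -> (t i < t i.+1)%N.
Hypothesis g_gt0 : forall i, (i < M)%N -> (0 < g i)%N.
Variable pi : @policy R d M t.
Hypothesis pi_BaSEDB : is_BaSEDB T g pi.
Context {dO : measure_display} {Omega : measurableType dO}.
Variables (P : probability Omega R) (Z : nat -> {RV P >-> obs R d}).
Hypothesis Z_iid : iid_sample T Q Z.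

Local Notation gap x := `|f true x - f false x|.
Local Notation N i := (grid_size g i).
Local Notation Lam i := (ln (2 * T%:R * (N i)%:R^-1 ^+ d) : R).
Local Notation batch i := (batch_set T t i).

Hypothesis rho_ge0 : forall i, 0 <= rho i.
Hypothesis gap0 : forall x, half_cube x -> gap x <= rho 0.
Hypothesis Lam_ge1 : forall i, (1 <= i < M)%N -> 1 <= Lam i.
Hypothesis long_batch : forall i, (1 <= i < M)%N ->
  81 * Lam i <= #|batch i|%:R * (cl * (N i)%:R^-1 ^+ d) / 4.
Hypothesis short_batch : forall i m, (1 <= i < M)%N -> (0 < m)%N ->
  m%:R < 4 * #|batch i|%:R * (cu * (N i)%:R^-1 ^+ d) ->
  8 * (L * (Num.sqrt d%:R * (N i)%:R^-1) `^ beta) <= 4 * Num.sqrt (Lam i / m%:R).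
Hypothesis small_threshold : forall i m, (1 <= i < M)%N ->
  #|batch i|%:R * (cl * (N i)%:R^-1 ^+ d) / 4 < m%:R ->
  2 * (4 * Num.sqrt (Lam i / m%:R)) <= rho i.

Definition margin_set (r : R) : set (obs R d) :=
  [set z | cube (ctx z) /\ 0 < gap (ctx z) <= r].

Lemma measurable_margin_set r : measurable (margin_set r).
Proof.
have [_ _ reg] := inst.
have mgap : measurable_fun cube (fun x => gap x).
  apply: (measurableT_comp (@normr_measurable R setT)).
  by apply: measurable_funB; [case: (reg true)|case: (reg false)].
rewrite (_ : margin_set r = ctx @^-1` (cube `&` (fun x => gap x) @^-1` `]0, r])).
  by apply: measurable_ctx_preimage; apply: mgap => //; exact: measurable_cube.
by apply/seteqP; split=> z /=; rewrite in_itv.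
Qed.

Lemma t_le i j : (i <= j <= M)%N -> (t i <= t j)%N.
Proof.
move=> /andP[ij jM]; elim: j ij jM => [|j IH]; first by rewrite leqn0 => /eqP ->.
rewrite leq_eqVlt => /predU1P[->//|ij] jM.
by apply: leq_trans (IH ij (ltnW jM)) (ltnW (t_incr jM)).
Qed.

Lemma batch_of_round s : (s < T)%N -> exists2 i, (i < M)%N & (t i <= s < t i.+1)%N.
Proof.
rewrite -tM; elim: M t_incr => [|m IH] inc; first by rewrite t0.
move=> sm; have [sm'|ms] := ltnP s (t m).
  have [|i im si] := IH _ sm'; first by move=> i im; apply: inc; exact: ltnW.
  by exists i => //; exact: ltnW.
by exists m => //; rewrite ms.
Qed.

Lemma sample_admissible w s : (s < T)%N -> admissible (Z s w).
Proof. by have [adm _ _] := Z_iid => /adm. Qed.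

Definition bin_exc (z : nat -> obs R d) (i : nat) (C : @bin d) : R :=
  bin_excess Q T t z i C.

Lemma bin_exc_ge0 z i C : 0 <= bin_exc z i C.
Proof.
rewrite /bin_exc /bin_excess /excess !addr_ge0//.
- by rewrite mulr_ge0 ?powR_ge0//; apply: prodr_ge0 => s _; rewrite addr_ge0.
- by rewrite mulr_ge0 ?powR_ge0//; apply: prodr_ge0 => s _; exact: half_indic_ge0.
- by apply: sumr_ge0 => V _; apply: sumr_ge0 => kbe _; exact: deviation_excess_ge0.
Qed.

(** Instantiates the tracking argument with [bin_exc] as the test for bad bins. The rounds from
    [t i] to [t i.+1] form batch [i.+1], hence the shift of indices. *)
Lemma round_regret_le w s i (z := fun s' => Z s' w) (x := ctx (z s)) :
  (i < M)%N -> (t i <= s < t i.+1)%N -> half_cube x ->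
  [\/ exceptional g f rho (bin_exc z) i.+1 x, gap x <= rho i |
      Num.max (f true x) (f false x) - f (pulled pi z s) x <= 0].
Proof.
move=> iM si hx.
have adm s' : (s' < T)%N -> admissible (z s') by exact: sample_admissible.
have [pulls rr] := pi_BaSEDB adm.
apply: (round_regret (g := g) (T := T) (t := t) (M := M) (a := pulled pi z)) => //.
move=> j v y jM hy vy va ex.
have /andP[j1 jM'] := jM.
have N0 : (0 < N j)%N by apply: (grid_size_gt0 g_gt0); exact: ltnW.
have tj1 : (t j.-1 <= t j)%N by apply: t_le; rewrite leq_pred ltnW.
have tjT : (t j <= T)%N by rewrite -tM; apply: t_le; rewrite leqnn ltnW.
have /andP[qlo qhi] := mass_cell_bounds cl0 inst v N0.
have B0 : 0 <= #|batch j|%:R :> R by [].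
have L1 := Lam_ge1 jM.
have Lam0 : 0 < Lam j by lra.
have q0 : 0 < mass Q (cell (grid_bin v)).
  apply: lt_le_trans qlo; rewrite mulr_gt0// exprn_gt0// invr_gt0 ltr0n//.
have many : 81 * Lam j <= #|batch j|%:R * mass Q (cell (grid_bin v)) / 4.
  apply: le_trans (long_batch jM) _; rewrite ler_pM2r ?invr_gt0//.
  exact: ler_wpM2l.
have few m : (0 < m)%N -> m%:R < 4 * #|batch j|%:R * mass Q (cell (grid_bin v)) ->
    8 * oscillation L beta (grid_bin v) <= threshold T m (grid_bin v).
  move=> m0 mq; apply: short_batch => //; apply: lt_le_trans mq _.
  by rewrite ler_wpM2l// mulr_ge0.
have alt : sorted (fun s s' => pulled pi z s != pulled pi z s') (visits t z j (grid_bin v)).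
  by apply: (rr j jM _ _ va); rewrite cardsT card_bool.
have osc k : `|f k y - cell_mean Q (cell (grid_bin v)) (reward k)| <=
    oscillation L beta (grid_bin v).
  apply: (cell_mean_oscillation beta0 L0 inst smooth_f k q0) => //.
  by move=> y' /(grid_bin_half_cube N0); exact: half_cube_cube.
split=> [S2|k kS].
  have := good_both_survive (C := grid_bin v) adm tj1 tjT Lam0 many few alt ex osc S2.
  move=> /le_trans; apply.
  have [_ [m [mlo ->]]] := good_threshold (C := grid_bin v) adm tj1 tjT Lam0 few ex.
  apply: small_threshold => //; apply: le_lt_trans mlo.
  rewrite ler_pM2r ?invr_gt0//; exact: ler_wpM2l.
exact: (good_eliminated (C := grid_bin v) adm tj1 tjT Lam0 many few alt ex osc kS).
Qed.

(** The bins of a grid are disjoint, so charging all bad bins of a batch counts each point of the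
    margin set at most once. *)
Lemma sum_mass_cells i r : (i <= M)%N ->
  \sum_(v : {ffun 'I_d -> 'I_(N i)}) mass Q (cell (grid_bin v) `&` margin_set r)
  <= mass Q (margin_set r).
Proof.
move=> iM; have N0 := grid_size_gt0 g_gt0 iM.
have mD (v : {ffun 'I_d -> 'I_(N i)}) : measurable (cell (grid_bin v) `&` margin_set r).
  by apply: measurableI; [exact: measurable_cell|exact: measurable_margin_set].
have mr := measurable_margin_set r.
rewrite -lee_fin -integral_mass_indic// -sumEFin.
under eq_bigr => v _ do rewrite -integral_mass_indic//.
rewrite -ge0_integral_sum//; last first.
  by move=> v; apply/measurable_EFinP; exact: measurable_indic.
apply: ge0_le_integral => //.
- by move=> z _; apply: sume_ge0 => v _; rewrite lee_fin.
- by apply: emeasurable_sum => v; apply/measurable_EFinP; exact: measurable_indic.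
- by apply/measurable_EFinP; exact: measurable_indic.
move=> z _; rewrite sumEFin lee_fin.
have [[v vz]|none] := pselect (exists v : {ffun 'I_d -> 'I_(N i)},
    (cell (grid_bin v) `&` margin_set r) z).
  rewrite (bigD1 v)//= big1 ?addr0.
    by have [vz1 vz2] := vz; rewrite !indicE !mem_set.
  move=> v' /eqP v'v; rewrite indicE memNset// => -[[v'z _] _]; apply: v'v.
  have [[vz' _] _] := vz.
  have := @in_bin_inj R d (grid_bin v') (grid_bin v) _ N0 erefl v'z vz'.
  move=> vv; apply/ffunP => j; apply: val_inj.
  by have := congr1 (fun u : @bin d => tnth u.2 j) vv; rewrite !tnth_mktuple.
rewrite big1// => v _; rewrite indicE memNset// => vz; apply: none; by exists v.
Qed.

(** From |V| <= 2c + 1 one has 9c >= 9 (|V| - 1) / 2, which is at least 4 |V| once |V| >= 9. *)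
Lemma cls_large_parity (V : {set 'I_T}) e :
  (9 <= #|V| -> 4 * #|V| <= 9 * #|parity_class V e|)%N.
Proof. by move=> V9; have := leq_card_parity_class V e; lia. Qed.

(** The excess of batch [i] involves only rounds before [t i], hence not the round [s]. The 10 is 2
    + 8, as [long_batch] puts the visit-count terms below e^-Lam too. *)
Lemma expected_bin_exc i s (v : {ffun 'I_d -> 'I_(N i)}) r :
  (1 <= i < M)%N -> (t i <= s < T)%N ->
  measurable_fun setT (fun w => bin_exc (fun s' => Z s' w) i (grid_bin v)) /\
  (\int[P]_w (\1_(cell (grid_bin v) `&` margin_set r) (Z s w) *
     bin_exc (fun s' => Z s' w) i (grid_bin v))%:E <=
  (mass Q (cell (grid_bin v) `&` margin_set r) * (10 * expR (- Lam i)))%:E)%E.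
Proof.
move=> iM /andP[tis sT]; have [adm law ind] := Z_iid; have /andP[i1 iM'] := iM.
have N0 : (0 < N i)%N by apply: (grid_size_gt0 g_gt0); exact: ltnW.
have mZ (s' : 'I_T) : measurable_fun setT (Z s' : Omega -> obs R d) by [].
have mC := @measurable_cell R d (grid_bin v).
have Y01 k (z : obs R d) : cell (grid_bin v) z -> 0 <= reward k z <= 1 by case=> _ [_ zk].
have /andP[qlo qhi] := mass_cell_bounds cl0 inst v N0.
have q0 : 0 < mass Q (cell (grid_bin v)).
  by apply: lt_le_trans qlo; rewrite mulr_gt0// exprn_gt0// invr_gt0 ltr0n.
have lawZ (s' : 'I_T) A : measurable A -> P ((Z s' : Omega -> obs R d) @^-1` A) = Q A.
  by move=> mA; exact: law.
split.
  exact: (measurable_excess Q mZ mC (@measurable_reward R d)).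
have sB : Ordinal sT \notin batch i by rewrite inE/= (ltnNge s) tis andbF.
have mD : measurable (cell (grid_bin v) `&` margin_set r).
  by apply: measurableI => //; exact: measurable_margin_set.
have := integral_indic_excess_le mZ ind lawZ mC (@measurable_reward R d)
  Y01 q0 (@parity_class_sub 'I_T) cls_large_parity (Lam_ge1 iM) sB mD.
move=> /le_trans; apply.
rewrite lee_fin ler_wpM2l ?mass_ge0//.
have : expR (- (#|batch i|%:R * mass Q (cell (grid_bin v)) / 4)) <= expR (- Lam i).
  rewrite ler_expR lerN2.
  have := long_batch iM; have L1 := Lam_ge1 iM.
  have : #|batch i|%:R * (cl * (N i)%:R^-1 ^+ d) <=
      #|batch i|%:R * mass Q (cell (grid_bin v)) by rewrite ler_wpM2l.
  by lra.
by lra.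
Qed.

Lemma card_batch_set a b : (b <= T)%N ->
  #|[set s : 'I_T | (a <= s < b)%N]%SET| = (b - a)%N.
Proof.
move=> bT; rewrite -sum1_card.
rewrite (eq_bigl (fun s : 'I_T => (a <= s) && (s < b))%N); last by move=> s; rewrite inE.
rewrite -(big_mkord (fun s => (a <= s) && (s < b))%N (fun=> 1%N)).
rewrite -big_nat_widen// (eq_bigl (fun s => true && (a <= s))%N)//.
have [ab|ba] := leqP a b; first by rewrite -big_nat_widenl// sum_nat_const_nat muln1.
rewrite (_ : (b - a)%N = 0%N); last by apply/eqP; rewrite subn_eq0 ltnW.
rewrite big_nat_cond big1// => s /andP[/andP[_ sb] /= as_].
by have := leq_ltn_trans as_ (ltn_trans sb ba); rewrite ltnn.
Qed.

Lemma integral_indic_sample s A : (s < T)%N -> measurable A ->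
  (\int[P]_w (\1_A (Z s w))%:E = (mass Q A)%:E)%E.
Proof.
move=> sT mA; have [_ law _] := Z_iid.
have mZ : measurable_fun setT (Z s : Omega -> obs R d) by [].
transitivity (\int[P]_w (\1_((Z s : Omega -> obs R d) @^-1` A) w)%:E)%E.
  by apply: eq_integral => w _; rewrite !indicE.
rewrite integral_indic ?setIT ?massE//; first exact: law.
by rewrite -[X in measurable X]setTI; exact: mZ.
Qed.

Definition gap_mass i : R := rho i * mass Q (margin_set (rho i)).

(** The regret of a round is dominated by [H], whose parts are [H1] for undecided points, [H2] for
    the first bad bin around a point and [H3] for the upper faces. Any round may pay for a bad bin
    of each earlier batch, whence the factor [T] in the second sum. *)
Lemma regret_le :
  (regret T f Z pi <=
   (\sum_(i < M) (t i.+1 - t i)%:R * gap_mass i +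
    T%:R * \sum_(j < M | (0 < j)%N) gap_mass j.-1 * (10 * expR (- Lam j)))%:E)%E.
Proof.
have [adm law _] := Z_iid.
pose K := 1 + 4 * (L * Num.sqrt d%:R `^ beta).
have K0 : 0 <= K.
  by rewrite addr_ge0// mulr_ge0// mulr_ge0 ?powR_ge0// ltW.
pose face : set (obs R d) := ctx @^-1` (cube `\` half_cube).
have mface : measurable face.
  apply: measurable_ctx_preimage.
  by apply: measurableD; [exact: measurable_cube|exact: measurable_half_cube].
pose H1 (s : nat) (i : 'I_M) w : R := rho i * \1_(margin_set (rho i)) (Z s w).
pose H2 (s : nat) (j : 'I_M) (v : {ffun 'I_d -> 'I_(N j)}) w : R :=
  rho j.-1 * (\1_(cell (grid_bin v) `&` margin_set (rho j.-1)) (Z s w) *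
              bin_exc (fun s' => Z s' w) j (grid_bin v)).
pose H3 (s : nat) w : R := K * \1_face (Z s w).
pose H (s : 'I_T) w : R := \sum_(i < M | (t i <= s < t i.+1)%N) H1 s i w +
  \sum_(j < M | (0 < j)%N && (t j <= s)%N) \sum_v H2 s j v w + H3 s w.
have H1_ge0 s i w : 0 <= H1 s i w by rewrite mulr_ge0 ?rho_ge0.
have H2_ge0 s j v w : 0 <= H2 s j v w.
  by rewrite mulr_ge0 ?rho_ge0// mulr_ge0 ?bin_exc_ge0.
have H3_ge0 s w : 0 <= H3 s w by rewrite mulr_ge0.
have sH1_ge0 (s : 'I_T) w : 0 <= \sum_(i < M | (t i <= s < t i.+1)%N) H1 s i w.
  by apply: sumr_ge0.
have sH2_ge0 (s : 'I_T) w :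
    0 <= \sum_(j < M | (0 < j)%N && (t j <= s)%N) \sum_v H2 s j v w.
  by apply: sumr_ge0 => j _; apply: sumr_ge0.
pose reg (s : nat) w : R := Num.max (f true (ctx (Z s w))) (f false (ctx (Z s w)))
  - f (pulled pi (fun s' => Z s' w) s) (ctx (Z s w)).
have reg_ge0 s w : 0 <= reg s w by exact: arm_regret_ge0.
have reg_gap s w : reg s w <= gap (ctx (Z s w)) by exact: arm_regret_le_gap.
have regH (s : 'I_T) w : reg s w <= H s w.
  have zc : cube (ctx (Z s w)) by have [] := adm s w (ltn_ord s).
  have [hx|hx] := pselect (half_cube (ctx (Z s w))); last first.
    apply: le_trans (_ : H3 s w <= _); last by rewrite lerDr addr_ge0.
    rewrite /H3 indicE mem_set// mulr1.
    exact: le_trans (reg_gap s w) (gap_cube_le beta0 L0 cl0 inst smooth_f zc).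
  have [r0|r0] := leP (reg s w) 0.
    by apply: le_trans r0 _; rewrite !addr_ge0.
  have gap_pos : 0 < gap (ctx (Z s w)) by exact: lt_le_trans (reg_gap s w).
  have [i iM si] := batch_of_round (ltn_ord s).
  apply: (le_trans (reg_gap s w)).
  have [[j [v [/andP[j1 ji] vx ex gx]]]|gx|r0'] := round_regret_le iM si hx.
  - have jM : (j < M)%N by exact: leq_trans ji iM.
    have tjs : (t j <= s)%N.
      move/andP: si => [+ _]; apply: leq_trans; apply: t_le.
      by rewrite -ltnS ji ltnW.
    apply: (@le_trans _ _ (H2 s (Ordinal jM) v w)).
      rewrite /H2 indicE mem_set; last by split; split=> //; rewrite ?gap_pos //; exact: adm.
      rewrite mul1r; apply: le_trans gx _.
      (* The excess of a bad bin is at least 1, so it can multiply the gap bound. *)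
      by rewrite ler_peMr ?rho_ge0.
    apply: (@le_trans _ _ (\sum_(j < M | (0 < j)%N && (t j <= s)%N) \sum_v H2 s j v w)).
      rewrite (bigD1 (Ordinal jM))/=; last by rewrite j1 tjs.
      rewrite (bigD1 v)//= -addrA lerDl addr_ge0//.
        exact: sumr_ge0.
      by apply: sumr_ge0 => ? _; exact: sumr_ge0.
    by rewrite /H; have := sH1_ge0 s w; have := H3_ge0 s w; lra.
  - apply: (@le_trans _ _ (H1 s (Ordinal iM) w)).
      by rewrite /H1 indicE mem_set ?mulr1//; split=> //; rewrite gap_pos.
    apply: (@le_trans _ _ (\sum_(i < M | (t i <= s < t i.+1)%N) H1 s i w)).
      by rewrite (bigD1 (Ordinal iM))//= lerDl; exact: sumr_ge0.
    by rewrite /H; have := sH2_ge0 s w; have := H3_ge0 s w; lra.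
  - by move: r0; rewrite ltNge [X in ~~ X -> _](_ : _ = true).
rewrite /regret unlock.
apply: le_trans (ge0_le_integral_nonmeasurable P (g := fun w => (\sum_(s < T) H s w)%:E) _ _) _.
- by move=> w; rewrite lee_fin; apply: sumr_ge0 => s _; exact: reg_ge0.
- by move=> w; rewrite lee_fin; apply: ler_sum => s _; exact: regH.
have ind A : measurable A -> measurable_fun setT (\1_A : obs R d -> R).
  by move=> mA; exact: measurable_indic.
have EA (s : 'I_T) A : measurable A -> measurable_fun setT (fun w => \1_A (Z s w) : R) /\
    (\int[P]_w (\1_A (Z s w))%:E = (mass Q A)%:E)%E.
  move=> mA; split; first by apply: measurableT_comp => //; exact: ind.
  exact: integral_indic_sample.
have EZ (k : R) (h : Omega -> R) : 0 <= k -> measurable_fun setT h -> (forall w, 0 <= h w) ->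
    (\int[P]_w (k * h w)%:E = k%:E * \int[P]_w (h w)%:E)%E.
  move=> k0 mh h0; under eq_integral do rewrite EFinM.
  by rewrite ge0_integralZl_EFin//; [move=> w _; rewrite lee_fin|exact/measurable_EFinP].
have EH1 (s : 'I_T) i : measurable_fun setT (H1 s i) /\
    (\int[P]_w (H1 s i w)%:E <= (gap_mass i)%:E)%E.
  have [m1 e1] := EA s _ (measurable_margin_set (rho i)).
  split; first exact: measurable_funM.
  by rewrite EZ ?rho_ge0// e1.
have EH3 (s : 'I_T) : measurable_fun setT (H3 s) /\ (\int[P]_w (H3 s w)%:E = 0)%E.
  have [m3 e3] := EA s _ mface.
  split; first exact: measurable_funM.
  rewrite EZ// e3 (_ : mass Q face = 0) ?mule0// /mass.
  by rewrite (negligible_upper_faces cl0 inst).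
have EH2 (s : 'I_T) (j : 'I_M) v : (0 < j)%N -> (t j <= s)%N ->
    measurable_fun setT (H2 s j v) /\
    (\int[P]_w (H2 s j v w)%:E <= (rho j.-1 *
      (mass Q (cell (grid_bin v) `&` margin_set (rho j.-1)) * (10 * expR (- Lam j))))%:E)%E.
  move=> j0 tjs.
  have jM : (1 <= j < M)%N by rewrite j0 ltn_ord.
  have tsT : (t j <= s < T)%N by rewrite tjs ltn_ord.
  have [m2 e2] := expected_bin_exc v (rho j.-1) jM tsT.
  have mD : measurable (cell (grid_bin v) `&` margin_set (rho j.-1)).
    by apply: measurableI; [exact: measurable_cell|exact: measurable_margin_set].
  have [mi _] := EA s _ mD.
  split; first by apply: measurable_funM => //; exact: measurable_funM.
  rewrite EZ ?rho_ge0//; last 2 first.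
  - exact: measurable_funM.
  - by move=> w; rewrite mulr_ge0 ?bin_exc_ge0.
  by rewrite EFinM lee_wpmul2l// lee_fin rho_ge0.
have Esum (J : finType) (X : pred J) (h : J -> Omega -> R) (c : J -> R) :
    (forall j w, 0 <= h j w) ->
    (forall j, X j -> measurable_fun setT (h j) /\ (\int[P]_w (h j w)%:E <= (c j)%:E)%E) ->
    measurable_fun setT (fun w => \sum_(j | X j) h j w) /\
    (\int[P]_w (\sum_(j | X j) h j w)%:E <= (\sum_(j | X j) c j)%:E)%E.
  move=> h0 hc; pose h' j := if X j then h j else cst 0.
  have mh' j : measurable_fun setT (h' j).
    by rewrite /h'; case: ifPn => [/hc[]|].
  have hE w : \sum_(j | X j) h j w = \sum_j h' j w.
    by rewrite big_mkcond; apply: eq_bigr => j _; rewrite /h'; case: (X j).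
  split; first by under eq_fun do rewrite hE; exact: measurable_sum.
  under eq_integral do rewrite hE -sumEFin.
  rewrite ge0_integral_sum//; last 2 first.
  - by move=> j; apply/measurable_EFinP; exact: mh'.
  - by move=> j w _; rewrite lee_fin /h'; case: (X j).
  rewrite -sumEFin [leRHS]big_mkcond; apply: lee_sum => j _; rewrite /h'.
  by case: ifPn => [/hc[]//|_]; rewrite integral0.
have EB (s : 'I_T) (j : 'I_M) : (0 < j)%N && (t j <= s)%N ->
    measurable_fun setT (fun w => \sum_v H2 s j v w) /\
    (\int[P]_w (\sum_v H2 s j v w)%:E <= (gap_mass j.-1 * (10 * expR (- Lam j)))%:E)%E.
  move=> /andP[j0 tjs].
  have [mS eS] := Esum _ xpredT (H2 s j) _ (fun v w => H2_ge0 s j v w)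
    (fun v _ => EH2 s j v j0 tjs).
  split=> //; apply: le_trans eS _; rewrite lee_fin -mulr_sumr -mulr_suml mulrA.
  rewrite ler_wpM2r ?mulr_ge0 ?expR_ge0// ler_wpM2l ?rho_ge0//.
  exact/sum_mass_cells/ltnW.
have EH (s : 'I_T) : measurable_fun setT (H s) /\
    (\int[P]_w (H s w)%:E <= (\sum_(i < M | (t i <= s < t i.+1)%N) gap_mass i +
    \sum_(j < M | (0 < j)%N) gap_mass j.-1 * (10 * expR (- Lam j)))%:E)%E.
  have [mA eA] := Esum 'I_M (fun i => (t i <= s < t i.+1)%N) (H1 s) (fun i => gap_mass i)
    (fun i w => H1_ge0 s i w) (fun i _ => EH1 s i).
  have [mB eB] := Esum 'I_M (fun j => (0 < j)%N && (t j <= s)%N)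
    (fun j w => \sum_v H2 s j v w) (fun j => gap_mass j.-1 * (10 * expR (- Lam j)))
    (fun j w => sumr_ge0 _ (fun v _ => H2_ge0 s j v w)) (fun j jX => EB s j jX).
  have [mC eC] := EH3 s.
  split; first by apply: measurable_funD => //; exact: measurable_funD.
  under eq_integral do rewrite 2!EFinD.
  rewrite ge0_integralD//; last 4 first.
  - by move=> w _; rewrite -EFinD lee_fin addr_ge0.
  - by apply: emeasurable_funD; exact/measurable_EFinP.
  - by move=> w _; rewrite lee_fin.
  - exact/measurable_EFinP.
  rewrite eC adde0 ge0_integralD//; last 4 first.
  - by move=> w _; rewrite lee_fin.
  - exact/measurable_EFinP.
  - by move=> w _; rewrite lee_fin.
  - exact/measurable_EFinP.
  rewrite EFinD leeD//; apply: le_trans eB _; rewrite lee_fin big_mkcondr.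
  apply: ler_sum => j _; case: ifP => // _.
  by rewrite mulr_ge0 ?mulr_ge0 ?rho_ge0 ?mass_ge0 ?expR_ge0.
have [_ eT] := Esum 'I_T xpredT H _ (fun s w => le_trans (reg_ge0 s w) (regH s w))
  (fun s _ => EH s).
apply: le_trans eT _; rewrite lee_fin big_split/= sumr_const card_ord.
rewrite -[X in _ + X](mulr_natl _ T) lerD2r.
rewrite (exchange_big_dep xpredT)//=; apply: ler_sum => i _.
rewrite sumr_const mulr_natl -card_batch_set; last first.
  by rewrite -tM; apply: t_le; rewrite leqnn ltn_ord.
by rewrite (eq_card (B := mem [set s : 'I_T | (t i <= s < t i.+1)%N]%SET))// => s; rewrite inE.
Qed.

End RegretBound.

(** * Split factors *)

Section SplitFactors.
Context {R : realType}.

Lemma nat_floor (n : nat) (x : R) : n%:Z = Num.floor x -> n%:R <= x < n%:R + 1.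
Proof. by move=> nx; have := floor_itv x; rewrite -nx intrD -!pmulrn. Qed.

Lemma ln_mono (x y : R) : 0 < x -> x <= y -> ln x <= ln y.
Proof. by move=> x0 xy; rewrite ler_ln ?posrE// (lt_le_trans x0). Qed.

Lemma ln_succ_le (n : nat) : (0 < n)%N -> ln (n%:R + 1) <= ln n%:R + n%:R^-1 :> R.
Proof.
move=> n0; have nr : 0 < n%:R :> R by rewrite ltr0n.
have -> : n%:R + 1 = n%:R * (1 + n%:R^-1) :> R by field; rewrite gt_eqF.
have n1 : 0 < n%:R^-1 :> R by rewrite invr_gt0.
rewrite lnM ?posrE ?addr_gt0// lerD2l le_ln1Dx//.
by apply: lt_trans n1; rewrite ltrN10.
Qed.

(** Chosen so that c^-1 / (1 - gam) is at most this multiple of c^-1 - a^-1 as soon as c / a <=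
    2^(gam - 1). *)
Definition potential_scale (gam : R) : R := ((1 - gam) * (1 - 2 `^ (gam - 1)))^-1.

Lemma powR2_lt1 (gam : R) : gam < 1 -> 2 `^ (gam - 1) < 1 :> R.
Proof.
move=> g1; rewrite /powR gt_eqF// expR_lt1 nmulr_rlt0 ?subr_lt0//.
by rewrite ln_gt0// ltr1n.
Qed.

Lemma potential_scale_gt0 (gam : R) : gam < 1 -> 0 < potential_scale gam.
Proof. by move=> g1; rewrite invr_gt0 mulr_gt0 ?subr_gt0// powR2_lt1. Qed.

(* The cost of rounding [a `^ gam] down to [c] is paid for by the growth of the
   potential [n |-> - potential_scale gam / n]. *)
Lemma floor_powR_potential (gam : R) (a c : nat) : 0 < gam < 1 ->
  (0 < a)%N -> (0 < c)%N -> c%:Z = Num.floor (a%:R `^ gam) ->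
  (gam * ln a%:R - ln c%:R) / (1 - gam) <=
  potential_scale gam * (c%:R^-1 - a%:R^-1).
Proof.
move=> /andP[g0 g1] a0 c0 /nat_floor/andP[ca ac].
have s0 := potential_scale_gt0 g1.
have gp : 0 < 1 - gam by rewrite subr_gt0.
have cr : 0 < c%:R :> R by rewrite ltr0n.
have ar : 0 < a%:R :> R by rewrite ltr0n.
(* When [a] is 1 nothing is lost, and the ratio bound used below fails. *)
have [a1|a2] := leqP a 1.
  have a1' : a = 1%N by apply/eqP; rewrite eqn_leq a1.
  have c1' : c = 1%N.
    by apply/eqP; rewrite eqn_leq c0 andbT -(ler_nat R) (le_trans ca)// a1' powR1.
  by rewrite a1' c1' !subrr ln1 mulr0 subrr mul0r mulr0.
have lnac : gam * ln a%:R <= ln c%:R + c%:R^-1 :> R.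
  rewrite -ln_powR; apply: le_trans (ln_succ_le c0); apply: ln_mono; last exact: ltW.
  exact: powR_gt0.
have ratio : c%:R / a%:R <= 2 `^ (gam - 1) :> R.
  apply: (@le_trans _ _ (a%:R `^ (gam - 1))).
    by rewrite powRB ?(gt_eqF ar) ?implybT// powRr1 ?(ltW ar)// ler_pM2r ?invr_gt0.
  rewrite /powR !gt_eqF// ler_expR; apply: ler_wnM2l; first by rewrite subr_le0 ltW.
  by apply: ln_mono => //; rewrite ler_nat.
have p1 := powR2_lt1 g1.
have -> : potential_scale gam * (c%:R^-1 - a%:R^-1) =
    c%:R^-1 / (1 - gam) * ((1 - c%:R / a%:R) / (1 - 2 `^ (gam - 1))).
  rewrite /potential_scale; field.
  by rewrite !gt_eqF ?subr_gt0.
apply: (@le_trans _ _ (c%:R^-1 / (1 - gam))).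
  by rewrite ler_pM2r ?invr_gt0//; lra.
apply: ler_peMr; first by rewrite divr_ge0 ?invr_ge0 ?(ltW gp).
by rewrite ler_pdivlMr ?subr_gt0// mul1r lerD2l lerN2.
Qed.

(** The geometric sum 1 + gam + ... + gam^(n-1) in closed form. *)
Definition geom (gam : R) (n : nat) : R := (1 - gam ^+ n) / (1 - gam).

Lemma geomS (gam : R) n : gam < 1 -> geom gam n.+1 = 1 + gam * geom gam n.
Proof.
by move=> g1; rewrite /geom exprS; field; rewrite gt_eqF// subr_gt0.
Qed.

Lemma geom_ge0 (gam : R) n : 0 < gam < 1 -> 0 <= geom gam n <= (1 - gam)^-1.
Proof.
move=> /andP[g0 g1]; have gn : 0 <= gam ^+ n <= 1.
  by rewrite exprn_ge0 ?(ltW g0)//= exprn_ile1 ?(ltW g0) ?(ltW g1).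
rewrite /geom; apply/andP; split; first by rewrite divr_ge0 ?subr_ge0 ?(ltW g1)//; case/andP: gn.
by rewrite ler_piMl ?invr_ge0 ?subr_ge0 ?(ltW g1)//; case/andP: gn => ? ?; lra.
Qed.

Variables (p gam b : R) (M : nat) (g : nat -> nat).
Hypotheses (p_gt0 : 0 < p) (gam01 : 0 < gam < 1) (b_gt0 : 0 < b) (M2 : (2 <= M)%N).
Hypothesis g_gt0 : forall i, (i < M)%N -> (0 < g i)%N.
Hypothesis g0E : (g 0%N)%:Z = Num.floor (b `^ p^-1).
Hypothesis gE : forall i, (1 <= i <= M - 2)%N ->
  (g i)%:Z = Num.floor ((g i.-1)%:R `^ gam).

Local Notation G i := (ln (g i)%:R : R).
Local Notation S i := (ln (grid_size g i)%:R : R).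

Lemma ln_grid_size0 : S 0 = 0.
Proof. by rewrite /grid_size big_ord0 ln1. Qed.

Lemma ln_grid_sizeS i : (i < M)%N -> S i.+1 = S i + G i.
Proof.
move=> iM; rewrite /grid_size big_ord_recr/= natrM lnM// posrE ltr0n.
  exact: (grid_size_gt0 g_gt0 (ltnW iM)).
exact: g_gt0.
Qed.

Lemma ln_split_ge0 i : (i < M)%N -> 0 <= G i.
Proof. by move=> iM; rewrite ln_ge0// ler1n g_gt0. Qed.

Lemma ln_split0 : ln b / p - ln 2 <= G 0 <= ln b / p.
Proof.
have /andP[gb bg] := nat_floor g0E.
have g1 : 1 <= (g 0)%:R :> R by rewrite ler1n g_gt0// (leq_trans _ M2).
have lb : ln (b `^ p^-1) = ln b / p by rewrite ln_powR mulrC.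
rewrite -lb; apply/andP; split; last by apply: ln_mono => //; lra.
rewrite -ln_div ?posrE ?powR_gt0//; apply: ln_mono; first by rewrite divr_gt0 ?powR_gt0.
by rewrite ler_pdivrMr//; lra.
Qed.

Lemma ln_split_le i : (1 <= i <= M - 2)%N -> G i <= gam * G i.-1.
Proof.
move=> iM; have /andP[gl _] := nat_floor (gE iM).
rewrite -ln_powR; apply: ln_mono => //; rewrite ltr0n g_gt0//.
by case/andP: iM => _; lia.
Qed.

(* Without rounding, [w_i^-p * w_{i-1}^(p gam)] would be exactly [b]. *)
Lemma ln_grid_size_step i : (1 <= i <= M - 1)%N ->
  p * S i - p * gam * S i.-1 <= ln b.
Proof.
case: i => // i /=; rewrite ltn_subRL => iM.
have {}iM : (i.+1 < M)%N by lia.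
(* The left-hand side does not increase with [i]: a step adds (1 - gam) [G i] and replaces [G i] by
   at most [gam * G i]. *)
suff H : G i + (1 - gam) * S i <= ln b / p.
  have : p * (G i + (1 - gam) * S i) <= p * (ln b / p) by rewrite ler_pM2l.
  rewrite ln_grid_sizeS; last exact: ltnW.
  have -> : p * (ln b / p) = ln b by field; rewrite gt_eqF.
  by lra.
elim: i iM => [|i IH] iM.
  by rewrite ln_grid_size0; have /andP[_] := ln_split0; lra.
have := IH (ltnW iM); rewrite ln_grid_sizeS; last by do 2 apply: ltnW.
have : G i.+1 <= gam * G i by apply: (@ln_split_le i.+1); lia.
lra.
Qed.

Lemma ln_grid_size_le i : (i <= M - 1)%N -> p * S i <= ln b * geom gam i.
Proof.
have /andP[g0 g1] := gam01.
elim: i => [|i IH] iM.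
  by rewrite ln_grid_size0 /geom expr0 subrr mul0r !mulr0.
have := IH (ltnW iM); have := @ln_grid_size_step i.+1; rewrite iM/= geomS// => /(_ isT) H1 H2.
have : gam * (p * S i) <= gam * (ln b * geom gam i) by rewrite ler_pM2l.
lra.
Qed.

(** A rounding loss propagates to all later factors with total weight at most 1 / (1 - gam).
    Measured by the potential these losses telescope, so their sum is bounded uniformly in [M]. *)
Lemma ln_grid_size_ge : geom gam (M - 1) * G 0 - potential_scale gam <= S (M - 1).
Proof.
have /andP[g0 g1] := gam01.
have B0 := potential_scale_gt0 g1; set B := potential_scale gam in B0 *.
have key n i : (i + n <= M - 1)%N ->
    geom gam n * G i - B * (1 - (g i)%:R^-1) <= S (i + n) - S i.
  elim: n i => [|n IH] i inM.
    have g1i : 1 <= (g i)%:R :> R by rewrite ler1n g_gt0//; lia.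
    rewrite addn0 subrr /geom expr0 subrr !mul0r sub0r oppr_le0.
    by rewrite mulr_ge0 ?(ltW B0)// subr_ge0 invf_le1// (lt_le_trans ltr01).
  have iM : (i < M)%N by lia.
  have g1i : 1 <= (g i)%:R :> R by rewrite ler1n g_gt0.
  (* The recursion [gE] stops at [M - 2], so a single remaining factor has to be a second base
     case. *)
  case: n IH inM => [|n] IH inM.
    rewrite addn1 ln_grid_sizeS// [geom _ _](_ : _ = 1); last first.
      by rewrite /geom expr1 divff// gt_eqF// subr_gt0.
    have : 0 <= B * (1 - (g i)%:R^-1).
      by rewrite mulr_ge0 ?(ltW B0)// subr_ge0 invf_le1// (lt_le_trans ltr01).
    lra.
  have iM' : (1 <= i.+1 <= M - 2)%N by lia.
  have := IH i.+1; rewrite addSnnS ln_grid_sizeS// => /(_ inM) H.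
  have gi1 : (0 < g i.+1)%N by apply: g_gt0; lia.
  have := floor_powR_potential gam01 (g_gt0 iM) gi1 (gE iM').
  rewrite -/B => H2.
  have /andP[s0 s1] := geom_ge0 n.+1 gam01.
  have Gle := ln_split_le iM'.
  have : geom gam n.+1 * (gam * G i - G i.+1) <= (gam * G i - G i.+1) / (1 - gam).
    by rewrite mulrC ler_wpM2l// subr_ge0.
  rewrite (geomS n.+1 g1); lra.
have := key (M - 1)%N 0; rewrite add0n ln_grid_size0 => /(_ (leqnn _)).
have : 0 <= B * (g 0)%:R^-1 by apply: divr_ge0; [exact: ltW|exact: ler0n].
lra.
Qed.

End SplitFactors.

(** * Choice of the grid *)

Section RegretRate.
Context {R : realType} {d : nat}.
Variables (alpha beta L D0 delta0 cl cu : R).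
Hypotheses (d1 : (1 <= d)%N) (beta01 : 0 < beta <= 1) (alpha0 : 0 < alpha).
Hypotheses (alphabeta : alpha * beta <= 1) (L0 : 0 < L) (D00 : 0 < D0).
Hypotheses (delta01 : 0 < delta0 < 1) (clu : 0 < cl <= cu).

Definition eff_dim : R := 2 * beta + d%:R.
Definition gam : R := beta * (1 + alpha) / eff_dim.

Local Notation sd := (Num.sqrt d%:R `^ beta : R).

Definition grid_scale : R := (16 * cu * (L * sd) ^+ 2)^-1.
(** The first two terms bound the gap on the half-open cube, where no batch has been played yet; the
    last one bounds twice the threshold after a batch, up to the factor w^beta. *)
Definition gap_scale : R := 1 + 2 * (L * sd) + 32 / Num.sqrt (grid_scale * cl).
Definition margin_scale : R := D0 + delta0 `^ (- alpha).

Lemma beta_gt0 : 0 < beta. Proof. by case/andP: beta01. Qed.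

Lemma eff_dim_gt0 : 0 < eff_dim.
Proof. by rewrite /eff_dim ltr_wpDr// mulr_gt0// beta_gt0. Qed.

Lemma gam_eff_dim : eff_dim * gam = beta * (1 + alpha).
Proof. by rewrite /gam mulrC divfK// gt_eqF// eff_dim_gt0. Qed.

(** The upper bound holds because beta + alpha beta <= beta + 1 < 2 beta + d. *)
Lemma gam_bounds : 0 < gam < 1.
Proof.
have b0 := beta_gt0; have p0 := eff_dim_gt0; have al := alpha0; have ab := alphabeta.
apply/andP; split; first by rewrite divr_gt0// mulr_gt0// addr_gt0.
rewrite /gam ltr_pdivrMr// mul1r /eff_dim.
have : 1 <= d%:R :> R by rewrite ler1n.
have : beta <= 1 by case/andP: beta01.
nra.
Qed.

Lemma sd_gt0 : 0 < sd.
Proof. by rewrite powR_gt0// sqrtr_gt0 ltr0n. Qed.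

Lemma grid_scale_gt0 : 0 < grid_scale.
Proof.
have /andP[c0 cu0] := clu.
rewrite invr_gt0 mulr_gt0 ?exprn_gt0 ?mulr_gt0 ?sd_gt0//.
exact: lt_le_trans cu0.
Qed.

Lemma gap_scale_gt0 : 0 < gap_scale.
Proof.
have lsd := mulr_gt0 L0 sd_gt0.
have : 0 <= 32 / Num.sqrt (grid_scale * cl) by rewrite divr_ge0 ?sqrtr_ge0.
by rewrite /gap_scale; lra.
Qed.

Lemma margin_scale_gt0 : 0 < margin_scale.
Proof. by rewrite ltr_wpDr ?powR_ge0. Qed.

(* Here [s = w^-beta] and [wd = w^d] for the bin width [w]. *)
Lemma batch_length_conditions (s n wd ell Lam : R) :
  0 < s -> 1296 <= grid_scale * cl * s ^+ 2 -> 2^-1 <= ell -> 1 <= Lam <= 2 * ell ->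
  ell <= Lam -> 0 < wd ->
  grid_scale * (s ^+ 2 / wd) * ell / 2 <= n <= grid_scale * (s ^+ 2 / wd) * ell ->
  [/\ 81 * Lam <= n * (cl * wd) / 4,
      forall m : R, 0 < m -> m < 4 * n * (cu * wd) ->
        8 * (L * (sd / s)) <= 4 * Num.sqrt (Lam / m) &
      forall m : R, n * (cl * wd) / 4 < m ->
        2 * (4 * Num.sqrt (Lam / m)) <= gap_scale / s].
Proof.
move=> s0 s1296 ell2 /andP[Lam1 Lam2] ellLam wd0 /andP[nlo nhi].
have /andP[c0 cucl] := clu; have cu0 : 0 < cu by exact: lt_le_trans cucl.
have l0 := grid_scale_gt0; have sd0 := sd_gt0.
have lc0 : 0 < grid_scale * cl by rewrite mulr_gt0.
set S2 := s ^+ 2 in s1296 nlo nhi.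
have S20 : 0 < S2 by rewrite exprn_gt0.
have nlo' : grid_scale * cl * S2 * ell / 8 <= n * (cl * wd) / 4.
  have : grid_scale * (S2 / wd) * ell / 2 * (cl * wd) <= n * (cl * wd).
    by rewrite ler_pM2r// mulr_gt0.
  have -> : grid_scale * (S2 / wd) * ell / 2 * (cl * wd) = grid_scale * cl * S2 * ell / 2.
    by field; rewrite gt_eqF.
  lra.
have nhi' : 4 * n * (cu * wd) <= 4 * cu * grid_scale * S2 * ell.
  have : n * (cu * wd) <= grid_scale * (S2 / wd) * ell * (cu * wd).
    by rewrite ler_pM2r// mulr_gt0.
  have -> : grid_scale * (S2 / wd) * ell * (cu * wd) = cu * grid_scale * S2 * ell.
    by field; rewrite gt_eqF.
  lra.
split.
- apply: le_trans nlo'.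
  (* 1296 = 81 * 2 * 8, with 2 from [Lam <= 2 * ell] and 8 from [nlo']. *)
  have : 1296 * ell <= grid_scale * cl * S2 * ell by rewrite ler_pM2r//; lra.
  lra.
- move=> m m0 mn.
  have key : (2 * (L * (sd / s))) ^+ 2 <= Lam / m.
    rewrite ler_pdivlMr//.
    have -> : (2 * (L * (sd / s))) ^+ 2 * m = 4 * (L * sd) ^+ 2 / S2 * m.
      by rewrite /S2; field; rewrite gt_eqF.
    apply: (@le_trans _ _ (4 * (L * sd) ^+ 2 / S2 * (4 * cu * grid_scale * S2 * ell))).
      rewrite ler_wpM2l ?(le_trans (ltW mn))//.
      by rewrite divr_ge0 ?(ltW S20)// mulr_ge0// sqr_ge0.
    (* [grid_scale] is the value that makes this an equality. *)
    have -> : 4 * (L * sd) ^+ 2 / S2 * (4 * cu * grid_scale * S2 * ell) = ell.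
      by rewrite /grid_scale; field; rewrite !gt_eqF// ?exprn_gt0// mulr_gt0.
    exact: ellLam.
  have : 2 * (L * (sd / s)) <= Num.sqrt (Lam / m).
    rewrite -[leLHS]ger0_norm -?sqrtr_sqr; last first.
      by rewrite !mulr_ge0// ?(ltW L0) ?(ltW sd0) ?invr_ge0 ?(ltW s0).
    by rewrite ler_wsqrtr.
  lra.
- move=> m nm.
  have m0 : 0 < m.
    apply: le_lt_trans nm; apply: le_trans nlo'.
    by rewrite divr_ge0// !mulr_ge0 ?(ltW l0) ?(ltW c0) ?(ltW S20)//; lra.
  have sl0 : 0 < Num.sqrt (grid_scale * cl) by rewrite sqrtr_gt0.
  have key : Num.sqrt (Lam / m) <= 4 / Num.sqrt (grid_scale * cl) / s.
    rewrite -[leRHS]ger0_norm -?sqrtr_sqr; last first.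
      by rewrite !divr_ge0// ltW.
    rewrite ler_wsqrtr// ler_pdivrMr//.
    have -> : (4 / Num.sqrt (grid_scale * cl) / s) ^+ 2 = 16 / (grid_scale * cl * S2).
      rewrite -[in RHS](@sqr_sqrtr _ (grid_scale * cl)) ?(ltW lc0)// /S2.
      by field; rewrite !gt_eqF.
    apply: (@le_trans _ _ (16 / (grid_scale * cl * S2) * (grid_scale * cl * S2 * ell / 8))).
      have -> : 16 / (grid_scale * cl * S2) * (grid_scale * cl * S2 * ell / 8) = 2 * ell.
        by field; rewrite !gt_eqF.
      exact: Lam2.
    rewrite ler_wpM2l// ?(le_trans nlo') ?(ltW nm)//.
    by rewrite divr_ge0// (ltW (mulr_gt0 lc0 S20)).
  have : 32 / Num.sqrt (grid_scale * cl) / s <= gap_scale / s.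
    rewrite ler_pM2r ?invr_gt0// /gap_scale.
    have := mulr_gt0 L0 sd0; lra.
  lra.
Qed.

(** Beyond [delta0], where the margin condition is silent, the mass is at most 1 <= (r /
    delta0)^alpha; hence the second term of [margin_scale]. *)
Lemma margin_mass_le (Q : probability (obs R d) R) f r :
  bandit_class L D0 delta0 cl cu alpha beta Q f -> 0 < r ->
  mass Q (margin_set f r) <= margin_scale * r `^ alpha.
Proof.
move=> [inst _ marg] r0; have /andP[de0 de1] := delta01.
have mA : measurable (margin_set f r) by exact: (measurable_margin_set inst).
have [rd|dr] := leP r delta0.
  apply: (@le_trans _ _ (D0 * r `^ alpha)).
    by rewrite -lee_fin massE//; apply: marg; rewrite ltW.
  by rewrite ler_wpM2r ?powR_ge0// lerDl powR_ge0.
apply: (le_trans (mass_le1 Q mA)).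
apply: (@le_trans _ _ (delta0 `^ (- alpha) * r `^ alpha)).
  rewrite -[leLHS](powRr0 delta0) -(addNr alpha) powRD; last first.
    by rewrite addNr eqxx gt_eqF.
  rewrite ler_wpM2l ?powR_ge0//; apply: ge0_ler_powR; rewrite ?nnegrE ?ltW//.
by rewrite ler_wpM2r ?powR_ge0// lerDr ltW.
Qed.

Definition gap_mass_scale : R := margin_scale * gap_scale `^ (1 + alpha).

Section LargeHorizon.
Variables (T M : nat) (b : R) (g t : nat -> nat).
Hypotheses (T2 : (2 <= T)%N) (M2 : (2 <= M)%N) (b_gt0 : 0 < b).
Hypothesis g_gt0 : forall i, (i < M)%N -> (0 < g i)%N.
Hypothesis g0E : (g 0%N)%:Z = Num.floor (b `^ eff_dim^-1).
Hypothesis gE : forall i, (1 <= i <= M - 2)%N ->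
  (g i)%:Z = Num.floor ((g i.-1)%:R `^ gam).
Hypotheses (t0 : t 0%N = 0%N) (tM : t M = T).
Hypothesis t_incr : forall i, (i < M)%N -> (t i < t i.+1)%N.

Local Notation N i := ((grid_size g i)%:R : R).
Local Notation w i := (N i)^-1.

Hypothesis tE : forall i, (1 <= i <= M.-1)%N ->
  (t i)%:Z - (t i.-1)%:Z =
  Num.floor (grid_scale * w i `^ (- eff_dim) * ln (T%:R * w i ^+ d)).
Hypothesis fine_grid : forall i, (1 <= i < M)%N ->
  1296 <= grid_scale * cl * (N i `^ beta) ^+ 2.
Hypothesis long_horizon : forall i, (1 <= i < M)%N -> 2 <= T%:R * w i ^+ d.

Lemma grid_size_real_gt0 i : (i <= M)%N -> 0 < N i.
Proof. by move=> iM; rewrite ltr0n; exact: (grid_size_gt0 g_gt0). Qed.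

Lemma powR_grid_size i x : (i <= M)%N -> N i `^ x = expR (x * ln (N i)).
Proof. by move=> iM; rewrite /powR gt_eqF// grid_size_real_gt0. Qed.

(** A batch has n >= 1 rounds, so the unrounded length is below n + 1 <= 2n: the floor loses at most
    a factor 2. *)
Lemma batch_length i : (1 <= i < M)%N ->
  grid_scale * N i `^ eff_dim * ln (T%:R * w i ^+ d) / 2 <= (t i - t i.-1)%:R
  <= grid_scale * N i `^ eff_dim * ln (T%:R * w i ^+ d).
Proof.
move=> /andP[i1 iM].
have N0 := grid_size_real_gt0 (ltnW iM).
have ti : (t i.-1 < t i)%N by rewrite -{2}(prednK i1); apply: t_incr; rewrite prednK// ltnW.
have iM' : (1 <= i <= M.-1)%N by rewrite i1 -ltnS prednK// (leq_trans _ M2).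
have := tE iM'; rewrite subzn; last exact: ltnW.
rewrite -powR_inv1 ?(ltW N0)// -powRrM mulN1r opprK => /nat_floor/andP[lo hi].
have n1 : 1 <= (t i - t i.-1)%:R :> R by rewrite ler1n subn_gt0.
by apply/andP; split; lra.
Qed.

Lemma grid_conditions i (Lam := ln (2 * T%:R * w i ^+ d) : R) (n := (t i - t i.-1)%:R : R) :
  (1 <= i < M)%N ->
  [/\ 1 <= Lam, 81 * Lam <= n * (cl * w i ^+ d) / 4,
      forall m : R, 0 < m -> m < 4 * n * (cu * w i ^+ d) ->
        8 * (L * (Num.sqrt d%:R * w i) `^ beta) <= 4 * Num.sqrt (Lam / m) &
      forall m : R, n * (cl * w i ^+ d) / 4 < m ->
        2 * (4 * Num.sqrt (Lam / m)) <= gap_scale / N i `^ beta].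
Proof.
move=> iM; have /andP[i1 iM'] := iM.
have N0 := grid_size_real_gt0 (ltnW iM').
have w0 : 0 < w i by rewrite invr_gt0.
have wd0 : 0 < w i ^+ d by rewrite exprn_gt0.
have lh := long_horizon iM; have l2l := @ln2_ge_half R.
have ell2 : ln 2 <= ln (T%:R * w i ^+ d) by exact: ln_mono.
have LamE : Lam = ln 2 + ln (T%:R * w i ^+ d).
  by rewrite /Lam -mulrA lnM// posrE; lra.
have s0 : 0 < N i `^ beta by rewrite powR_gt0.
have Neff : N i `^ eff_dim = (N i `^ beta) ^+ 2 / w i ^+ d.
  rewrite exprVn invrK -!powR_mulrn ?powR_ge0 ?(ltW N0)// -powRrM -powRD ?(gt_eqF N0) ?implybT//.
  by rewrite /eff_dim mulrC.
have [] := @batch_length_conditions (N i `^ beta) n (w i ^+ d)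
  (ln (T%:R * w i ^+ d)) Lam s0 (fine_grid iM) _ _ _ wd0 _.
- lra.
- by rewrite LamE; apply/andP; split; lra.
- lra.
- by rewrite -Neff; exact: batch_length.
move=> c1 c2 c3; split=> //; first by rewrite LamE; lra.
have -> : (Num.sqrt d%:R * w i) `^ beta = sd / N i `^ beta.
  by rewrite powRM ?sqrtr_ge0 ?(ltW w0)// -powR_inv1 ?(ltW N0)// -powRrM mulN1r powRN.
exact: c2.
Qed.

Variable pi : @policy R d M t.
Hypothesis pi_BaSEDB : is_BaSEDB T g pi.
Variables (Q : probability (obs R d) R) (f : bool -> d.-tuple R -> R).
Hypothesis Qf : bandit_class L D0 delta0 cl cu alpha beta Q f.
Context {dO : measure_display} {Omega : measurableType dO}.
Variables (P : probability Omega R) (Z : nat -> {RV P >-> obs R d}).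
Hypothesis Z_iid : iid_sample T Q Z.

Let rho i : R := gap_scale / N i `^ beta.

(** The gap mass is of order [rho i] to the power 1 + alpha, that is w^(beta (1 + alpha)), and
    [eff_dim * gam] is this very exponent, the one balanced by the split factors. *)
Lemma gap_mass_le i : (i < M)%N ->
  gap_mass Q f rho i <= gap_mass_scale * expR (- (eff_dim * gam * ln (N i))).
Proof.
move=> iM; have N0 := grid_size_real_gt0 (ltnW iM).
have gs := gap_scale_gt0.
have r0 : 0 < rho i by rewrite divr_gt0 ?powR_gt0.
rewrite /gap_mass; apply: (@le_trans _ _ (rho i * (margin_scale * rho i `^ alpha))).
  by rewrite ler_pM2l//; exact: margin_mass_le.
rewrite mulrCA /gap_mass_scale -mulrA ler_pM2l ?margin_scale_gt0//.
rewrite -{1}(powRr1 (ltW r0)) -powRD ?(gt_eqF r0) ?implybT//.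
rewrite /rho powRM ?invr_ge0 ?powR_ge0 ?(ltW gs)// ler_pM2l ?powR_gt0//.
rewrite -powRN -powRrM powR_grid_size ?(ltW iM)//; last exact: ltnW.
by rewrite ler_expR gam_eff_dim; lra.
Qed.

Lemma regret_large :
  (regret T f Z pi <=
   (gap_mass_scale * (M%:R * b * (grid_scale * ln T%:R + 5) +
     T%:R * expR (- (eff_dim * gam * ln (N M.-1)))))%:E)%E.
Proof.
have /andP[c0 cucl] := clu; have [inst sm _] := Qf.
have beta0 := beta_gt0; have gs := gap_scale_gt0.
have card i : (1 <= i < M)%N -> #|batch_set T t i| = (t i - t i.-1)%N.
  move=> /andP[i1 iM]; apply: card_batch_set.
  by rewrite -tM; apply: (t_le t_incr); rewrite leqnn ltnW.
have rho_ge0 i : 0 <= rho i by rewrite divr_ge0 ?powR_ge0 ?(ltW gs).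
have gap0 x : half_cube x -> `|f true x - f false x| <= rho 0.
  move=> /(gap_half_cube_le beta0 L0 c0 inst sm) /le_trans; apply.
  rewrite /rho /grid_size big_ord0 powR1 divr1 /gap_scale lerDl.
  by rewrite divr_ge0 ?sqrtr_ge0.
have := @regret_le R d L beta cl cu Q f beta0 L0 c0 inst sm M T t g rho t0 tM t_incr g_gt0
  pi pi_BaSEDB dO Omega P Z Z_iid rho_ge0 gap0.
move=> /(_ _ _ _ _)/le_trans; apply.
- by move=> i iM; have [] := grid_conditions iM.
- by move=> i iM; rewrite card//; have [] := grid_conditions iM.
- by move=> i m iM m0; rewrite card//; have [_ _ + _] := grid_conditions iM; apply; rewrite ltr0n.
- by move=> i m iM; rewrite card//; have [_ _ _] := grid_conditions iM; apply.
pose E i := expR (- (eff_dim * gam * ln (N i))).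
have GG0 : 0 < gap_mass_scale by rewrite mulr_gt0 ?margin_scale_gt0// powR_gt0.
have gapE := gap_mass_le; move: gap_mass_scale GG0 gapE => K K0 gapE.
have T0 : 0 < T%:R :> R by rewrite ltr0n; exact: leq_trans T2.
have lnT0 : 0 <= ln T%:R :> R by rewrite ln_ge0// ler1n; exact: leq_trans T2.
have l0 := grid_scale_gt0.
have N1 i : (i <= M)%N -> 1 <= N i by move=> iM; rewrite ler1n; exact: (grid_size_gt0 g_gt0).
have wd1 i : (i <= M)%N -> w i ^+ d <= 1.
  by move=> iM; rewrite exprn_ile1 ?invr_ge0 ?invf_le1 ?grid_size_real_gt0 ?N1.
have step i : (1 <= i < M)%N -> N i `^ eff_dim * E i.-1 <= b.
  move=> /andP[i1 iM]; rewrite powR_grid_size ?(ltnW iM)// -expRD.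
  rewrite -[leRHS]lnK ?posrE// ler_expR.
  have iM1 : (1 <= i <= M - 1)%N by rewrite i1 subn1 -ltnS prednK// (leq_trans _ M2).
  by have := ln_grid_size_step eff_dim_gt0 gam_bounds b_gt0 M2 g_gt0 g0E gE iM1.
have E0 i : 0 <= E i by exact: expR_ge0.
have bound1 i : (i.+1 < M)%N -> (t i.+1 - t i)%:R * gap_mass Q f rho i <=
    K * (b * (grid_scale * ln T%:R)).
  move=> iM; have iM1 : (1 <= i.+1 < M)%N by [].
  have /andP[_ nhi] := batch_length iM1.
  have lnle : ln (T%:R * w i.+1 ^+ d) <= ln T%:R.
    apply: ln_mono; last by rewrite ler_piMr ?(ltW T0) ?wd1// ltnW.
    by rewrite mulr_gt0// exprn_gt0// invr_gt0 grid_size_real_gt0// ltnW.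
  apply: (@le_trans _ _ ((t i.+1 - t i)%:R * (K * E i))).
    by rewrite ler_wpM2l//; apply: gapE; exact: ltnW.
  apply: (@le_trans _ _ (grid_scale * N i.+1 `^ eff_dim * ln T%:R * (K * E i))).
    rewrite ler_wpM2r ?mulr_ge0 ?(ltW K0)//; apply: (le_trans nhi).
    by rewrite ler_wpM2l// mulr_ge0 ?powR_ge0 ?(ltW l0).
  have -> : grid_scale * N i.+1 `^ eff_dim * ln T%:R * (K * E i) =
    K * (N i.+1 `^ eff_dim * E i * (grid_scale * ln T%:R)) by ring.
  rewrite ler_pM2l// ler_wpM2r ?mulr_ge0 ?(ltW l0)//.
  exact: step iM1.
(* Since e^-Lam = 1 / (2 T w^d), the horizon cancels and leaves 5 N^d, bounded by 5 N^(2 beta + d)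
   so that [step] applies again. *)
have bound2 j : (1 <= j < M)%N ->
    T%:R * (gap_mass Q f rho j.-1 * (10 * expR (- ln (2 * T%:R * w j ^+ d)))) <=
    K * (b * 5).
  move=> jM; have /andP[j1 jM'] := jM.
  have N0 := grid_size_real_gt0 (ltnW jM').
  have wd0 : 0 < w j ^+ d by rewrite exprn_gt0// invr_gt0.
  rewrite expRN lnK ?posrE ?mulr_gt0//.
  have -> : T%:R * (gap_mass Q f rho j.-1 * (10 * (2 * T%:R * w j ^+ d)^-1)) =
      gap_mass Q f rho j.-1 * (N j ^+ d * 5).
    by rewrite -[N j ^+ d]invrK -exprVn; field; rewrite !gt_eqF.
  apply: (@le_trans _ _ (K * E j.-1 * (N j `^ eff_dim * 5))).
    apply: ler_pM.
    - by rewrite mulr_ge0 ?rho_ge0 ?mass_ge0.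
    - by rewrite mulr_ge0 ?exprn_ge0 ?(ltW N0).
    - by apply: gapE; exact: leq_ltn_trans (leq_pred j) jM'.
    rewrite ler_pM2r// -powR_mulrn ?(ltW N0)//; apply: ler_powR; first exact/N1/ltnW.
    by rewrite /eff_dim lerDr mulr_ge0// ltW.
  have -> : K * E j.-1 * (N j `^ eff_dim * 5) =
    K * (N j `^ eff_dim * E j.-1 * 5) by ring.
  by rewrite ler_pM2l// ler_pM2r//; exact: step.
rewrite lee_fin.
have sum_cst m (x : R) : \sum_(j < m) x = m%:R * x by rewrite sumr_const card_ord mulr_natl.
have sum2 : T%:R * (\sum_(j < M | (0 < j)%N) gap_mass Q f rho j.-1 *
    (10 * expR (- ln (2 * T%:R * w j ^+ d)))) <= M%:R * (K * (b * 5)).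
  rewrite mulr_sumr big_mkcond -sum_cst.
  apply: ler_sum => j _; case: ifP => j0; first by apply: bound2; rewrite j0 ltn_ord.
  by rewrite !mulr_ge0 ?(ltW K0) ?(ltW b_gt0).
(* The last batch has no prescribed length; it is bounded by all [T] rounds. *)
have sum1 : \sum_(i < M) (t i.+1 - t i)%:R * gap_mass Q f rho i <=
    M%:R * (K * (b * (grid_scale * ln T%:R))) +
    T%:R * (K * E M.-1).
  have MM : M = M.-1.+1 by rewrite prednK// (leq_trans _ M2).
  rewrite [in leLHS]MM big_ord_recr/= lerD//.
    apply: (@le_trans _ _ (M.-1%:R * (K * (b * (grid_scale * ln T%:R))))).
      rewrite -sum_cst.
      by apply: ler_sum => i _; apply: bound1; rewrite [ltnRHS]MM ltnS ltn_ord.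
    rewrite ler_wpM2r ?ler_nat ?leq_pred//.
    by rewrite !mulr_ge0 ?(ltW K0) ?(ltW b_gt0) ?(ltW l0).
  apply: ler_pM => //.
  - by rewrite mulr_ge0 ?rho_ge0 ?mass_ge0.
  - by rewrite ler_nat -MM tM leq_subr.
  - by apply: gapE; rewrite -MM.
apply: le_trans (lerD sum1 sum2) _; rewrite -/(E M.-1); lra.
Qed.

End LargeHorizon.

End RegretRate.

(** * Exponent of the rate and sizes of the grids in terms of the horizon *)

Section RateBounds.
Context {R : realType}.
Variables (p gam a1 a2 b : R) (T M : nat) (g : nat -> nat).
Hypotheses (p_gt0 : 0 < p) (gam01 : 0 < gam < 1) (a12 : 0 < a1 <= a2).
Hypotheses (T1 : (1 <= T)%N) (M2 : (2 <= M)%N).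

Definition rate_exponent : R := (1 - gam) / (1 - gam ^+ M).

Local Notation e := rate_exponent.
Local Notation lT := (ln T%:R : R).

Hypothesis bE : a1 * T%:R `^ e <= b <= a2 * T%:R `^ e.
Hypothesis g_gt0 : forall i, (i < M)%N -> (0 < g i)%N.
Hypothesis g0E : (g 0%N)%:Z = Num.floor (b `^ p^-1).
Hypothesis gE : forall i, (1 <= i <= M - 2)%N ->
  (g i)%:Z = Num.floor ((g i.-1)%:R `^ gam).

Local Notation S i := (ln (grid_size g i)%:R : R).

Lemma expr_gam_lt1 : 0 <= gam ^+ M < 1.
Proof.
have /andP[g0 g1] := gam01; rewrite exprn_ge0 ?(ltW g0)//=.
by rewrite exprn_ilt1 ?(ltW g0)// -lt0n (leq_trans _ M2).
Qed.

(** The lower bound is free of [M], which makes the horizons treated separately independent of the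
    number of batches. *)
Lemma rate_exponent_bounds : 1 - gam <= e <= 1.
Proof.
have /andP[g0 g1] := gam01; have /andP[h0 h1] := expr_gam_lt1.
have hM : gam ^+ M <= gam.
  by rewrite -[leRHS]expr1; apply: ler_wiXn2l; rewrite ?(ltW g0) ?(ltW g1)// (leq_trans _ M2).
have d0 : 0 < 1 - gam ^+ M by rewrite subr_gt0.
rewrite /rate_exponent ler_pdivlMr// ler_pdivrMr//; apply/andP; split; nra.
Qed.

Lemma rate_exponent_geom i : (i < M)%N -> e * geom gam i <= 1.
Proof.
have /andP[g0 g1] := gam01; have /andP[h0 h1] := expr_gam_lt1 => iM.
have -> : e * geom gam i = (1 - gam ^+ i) / (1 - gam ^+ M).
  by rewrite /rate_exponent /geom; field; rewrite !gt_eqF ?subr_gt0.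
rewrite ler_pdivrMr ?subr_gt0// mul1r lerD2l lerN2.
by apply: ler_wiXn2l; rewrite ?(ltW g0) ?(ltW g1)// ltnW.
Qed.

(** The equation that determines [e]: with b = T^e and no rounding, the last batch costs T b^(-gam
    geom(M - 1)) = T^e, as much as the others. *)
Lemma rate_exponent_last : gam * geom gam (M - 1) * e = 1 - e.
Proof.
have /andP[g0 g1] := gam01; have /andP[h0 h1] := expr_gam_lt1.
rewrite /rate_exponent /geom.
have -> : gam ^+ M = gam * gam ^+ (M - 1).
  by rewrite -exprS subn1 prednK// (leq_trans _ M2).
have : 1 - gam * gam ^+ (M - 1) != 0.
  by rewrite -exprS subn1 prednK ?(leq_trans _ M2)// gt_eqF// subr_gt0.
by move=> h; field; rewrite h gt_eqF// subr_gt0.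
Qed.

Lemma lnT_ge0 : 0 <= lT.
Proof. by rewrite ln_ge0// ler1n. Qed.

Lemma rate_gt0 : 0 < T%:R `^ e :> R.
Proof. by rewrite powR_gt0// ltr0n. Qed.

Lemma b_gt0 : 0 < b.
Proof.
have /andP[a0 _] := a12; have /andP[+ _] := bE; apply: lt_le_trans.
by rewrite mulr_gt0// rate_gt0.
Qed.

(** Taking the minimum and maximum with 1 gives the two logarithms a sign, so that they can be
    multiplied by bounds on [geom]. *)
Lemma ln_b_bounds :
  ln (Num.min 1 a1) + e * lT <= ln b <= ln (Num.max 1 a2) + e * lT.
Proof.
have /andP[a0 a2'] := a12; have /andP[lo hi] := bE; have r0 := rate_gt0.
have m0 : 0 < Num.min 1 a1 by rewrite lt_min ltr01.
have M0 : 0 < Num.max 1 a2 by rewrite lt_max ltr01.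
rewrite -!ln_powR -!lnM ?posrE//; apply/andP; split; apply: ln_mono.
- by rewrite mulr_gt0.
- by apply: le_trans lo; rewrite ler_pM2r// ge_min lexx orbT.
- exact: b_gt0.
- by apply: (le_trans hi); rewrite ler_pM2r// le_max lexx orbT.
Qed.

Lemma ln_min1_le0 : ln (Num.min 1 a1) <= 0.
Proof. by rewrite ln_le0// ge_min lexx. Qed.

Lemma ln_max1_ge0 : 0 <= ln (Num.max 1 a2).
Proof. by rewrite ln_ge0// le_max lexx. Qed.

(** Collects the rounding of [g 0] (the term in ln 2), that of the later factors ([potential_scale])
    and the lower constant [a1] for [b]. *)
Definition last_batch_scale : R :=
  expR (p * gam * (ln 2 / (1 - gam) + potential_scale gam)
        - gam / (1 - gam) * ln (Num.min 1 a1)).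

Lemma last_batch_le :
  T%:R * expR (- (p * gam * S M.-1)) <= last_batch_scale * T%:R `^ e.
Proof.
have /andP[g0 g1] := gam01; have /andP[blo _] := ln_b_bounds.
have T0 : 0 < T%:R :> R by rewrite ltr0n.
have l2 : 0 <= ln 2 :> R by rewrite ln_ge0// ler1n.
rewrite -[X in X * _ <= _](lnK T0) -expRD /last_batch_scale /powR gt_eqF// -expRD ler_expR.
have last := rate_exponent_last; have m0 := ln_min1_le0.
have := ln_grid_size_ge p_gt0 gam01 b_gt0 M2 g_gt0 g0E gE.
have /andP[G0 _] := ln_split0 b_gt0 M2 g_gt0 g0E.
have /andP[q0 q1] := geom_ge0 (M - 1) gam01.
rewrite -subn1; set q := geom gam (M - 1) in last q0 q1 *; set B := potential_scale gam.
set s := S (M - 1); set m := ln (Num.min 1 a1) in blo m0 *; set l := ln 2 in l2 G0 *.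
move=> Sge.
have h1 : p * gam * (q * (ln b / p - l) - B) <= p * gam * s.
  rewrite ler_pM2l ?mulr_gt0//; apply: le_trans Sge.
  by rewrite lerD2r; apply: ler_wpM2l.
have E1 : p * gam * (q * (ln b / p - l) - B) =
    gam * q * ln b - p * gam * q * l - p * gam * B.
  by field; rewrite gt_eqF.
have h2 : gam * q * (m + e * lT) <= gam * q * ln b.
  by rewrite ler_wpM2l// mulr_ge0// ltW.
have h3 : gam * q * (e * lT) = (1 - e) * lT by rewrite mulrA last.
have h4 : gam * (1 - gam)^-1 * m <= gam * q * m.
  by rewrite ler_wnM2r// ler_pM2l.
have h5 : p * gam * (q * l) <= p * gam * (l / (1 - gam)).
  by rewrite ler_pM2l ?mulr_gt0// mulrC ler_wpM2l.
lra.
Qed.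

(** The factor [g 0] alone is of order at least T^((1 - gam) / p), whatever [M] is. *)
Lemma ln_grid_size_lower i : (1 <= i < M)%N ->
  (ln (Num.min 1 a1) + (1 - gam) * lT) / p - ln 2 <= S i.
Proof.
move=> /andP[i1 iM].
have G0S : ln (g 0)%:R <= S i.
  case: i i1 iM => // i _; elim: i => [|i IH] iM.
    by rewrite (ln_grid_sizeS g_gt0)// ?ln_grid_size0 ?add0r// ltnW.
  rewrite (ln_grid_sizeS g_gt0); last exact: ltnW.
  by apply: (le_trans (IH (ltnW iM))); rewrite lerDl (ln_split_ge0 g_gt0)// ltnW.
apply: le_trans G0S; have /andP[G0 _] := ln_split0 b_gt0 M2 g_gt0 g0E.
apply: le_trans G0; rewrite lerD2r ler_pM2r ?invr_gt0//.
have /andP[blo _] := ln_b_bounds; apply: le_trans blo; rewrite lerD2l.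
by rewrite ler_wpM2r ?lnT_ge0//; have /andP[] := rate_exponent_bounds.
Qed.

Lemma ln_grid_size_upper i : (i < M)%N ->
  p * S i <= ln (Num.max 1 a2) / (1 - gam) + lT.
Proof.
move=> iM; have iM1 : (i <= M - 1)%N by rewrite subn1 -ltnS prednK// (leq_trans _ M2).
apply: (le_trans (ln_grid_size_le p_gt0 gam01 b_gt0 M2 g_gt0 g0E gE iM1)).
have /andP[q0 q1] := geom_ge0 i gam01; have /andP[_ bhi] := ln_b_bounds.
apply: (le_trans (ler_wpM2r q0 bhi)); rewrite mulrDl lerD//.
  by rewrite ler_wpM2l// ln_max1_ge0.
rewrite mulrAC -[leRHS]mul1r ler_wpM2r ?lnT_ge0//; exact: rate_exponent_geom.
Qed.

Lemma long_horizon_fine_grid (beta kap : R) i : 0 < beta ->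
  (p * (kap / (2 * beta) + ln 2) - ln (Num.min 1 a1)) / (1 - gam) <= lT ->
  (1 <= i < M)%N -> kap <= 2 * beta * S i.
Proof.
move=> beta0; have /andP[_ g1] := gam01.
rewrite ler_pdivrMr ?subr_gt0// => h1 iM; have low := ln_grid_size_lower iM.
have h3 : kap / (2 * beta) + ln 2 <=
    (ln (Num.min 1 a1) + (1 - gam) * lT) / p by rewrite ler_pdivlMr//; lra.
have : kap / (2 * beta) <= S i by lra.
by rewrite ler_pdivrMr ?mulr_gt0//; lra.
Qed.

(** Up to constants N^p is at most T, so (T w^d)^p is at least of order T^(p - d) = T^(2 beta). *)
Lemma long_horizon_dense_grid (beta : R) (d i : nat) : 0 < beta ->
  p = 2 * beta + d%:R ->
  (p * ln 2 + d%:R * (ln (Num.max 1 a2) / (1 - gam))) / (2 * beta) <= lT ->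
  (i < M)%N -> ln 2 <= lT - d%:R * S i.
Proof.
move=> beta0 pE; rewrite ler_pdivrMr ?mulr_gt0// => h1 iM.
have up := ln_grid_size_upper iM.
have h2 : d%:R * (p * S i) <= d%:R * (ln (Num.max 1 a2) / (1 - gam) + lT).
  by rewrite ler_wpM2l.
by rewrite -(ler_pM2l p_gt0); rewrite pE in h1 h2 *; lra.
Qed.

End RateBounds.

(** * Assembly of the constants *)

Section LogForms.
Context {R : realType}.

Lemma le_sqr_powR (c x beta : R) : 0 < c -> 0 < x ->
  ln c <= 2 * beta * ln x -> c <= (x `^ beta) ^+ 2.
Proof.
move=> c0 x0 h; rewrite -[leLHS]lnK ?posrE// -powR_mulrn ?powR_ge0// -powRrM.
by rewrite /powR gt_eqF// ler_expR; lra.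
Qed.

Lemma le_mul_exprV (c T x : R) (d : nat) : 0 < c -> 0 < T -> 0 < x ->
  ln c <= ln T - d%:R * ln x -> c <= T * x^-1 ^+ d.
Proof.
move=> c0 T0 x0 h; have x0' : 0 < x^-1 by rewrite invr_gt0.
rewrite -[leLHS]lnK ?posrE// -[leRHS]lnK ?posrE ?mulr_gt0 ?exprn_gt0// ler_expR.
by rewrite lnM ?posrE ?exprn_gt0// lnXn// lnV ?posrE// -mulr_natl; lra.
Qed.

Lemma le_log_sqr_rate (l rate x : R) : 2^-1 <= l -> 1 <= rate -> 0 <= x ->
  x <= 4 * x * (l ^+ 2 * rate).
Proof.
move=> l2 r1 x0; have l1 : 1 <= 4 * l ^+ 2 by rewrite expr2; nra.
have -> : 4 * x * (l ^+ 2 * rate) = 4 * l ^+ 2 * rate * x by ring.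
by rewrite ler_peMl// mulr_ege1.
Qed.

(** One logarithm comes from the number of batches, the other from their length. As l >= 1/2, the 5
    is absorbed in 10 l and the last batch in 4 l^2. *)
Lemma regret_constant (gm D1 a2 gs lb l rate m b x : R) :
  0 <= gm -> 0 <= gs -> 0 <= lb -> 0 <= m -> 0 <= b -> 2^-1 <= l -> 1 <= rate ->
  m <= D1 * l -> b <= a2 * rate -> x <= lb * rate ->
  gm * (m * b * (gs * l + 5) + x) <=
  gm * (D1 * a2 * (gs + 10) + 4 * lb) * (l ^+ 2 * rate).
Proof.
move=> gm0 gs0 lb0 m0 b0 l2 r1 mD ba xl.
rewrite -[leRHS]mulrA; apply: ler_wpM2l => //; rewrite mulrDl lerD//.
  have -> : D1 * a2 * (gs + 10) * (l ^+ 2 * rate) =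
    (D1 * l) * (a2 * rate) * ((gs + 10) * l) by ring.
  apply: ler_pM; [exact: mulr_ge0| |exact: ler_pM|by lra].
  by apply: addr_ge0 => //; apply: mulr_ge0 => //; lra.
apply: (le_trans xl); have l1 : 1 <= 4 * l ^+ 2 by rewrite expr2; nra.
have -> : 4 * lb * (l ^+ 2 * rate) = 4 * l ^+ 2 * (lb * rate) by ring.
by rewrite ler_peMl// mulr_ge0//; lra.
Qed.

End LogForms.

Theorem theorem3 (R : realType) (d : nat) (alpha beta L D0 delta0 cl cu D1 a1 a2 : R) :
  (1 <= d)%N ->
  0 < beta <= 1 -> 0 < alpha -> alpha * beta <= 1 ->
  0 < L -> 0 < D0 -> 0 < delta0 < 1 -> 0 < cl <= cu ->
  0 < D1 -> 0 < a1 <= a2 ->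
  let gamma : R := beta * (1 + alpha) / (2 * beta + d%:R) in
  exists (lmin lmax : R) (l : nat -> nat -> nat -> R) (Ctilde : R),
    [/\ 0 < lmin,
        forall T M i, lmin <= l T M i <= lmax,
        0 < Ctilde &
    forall T M : nat,
      (2 <= T)%N -> (1 <= M)%N -> M%:R <= D1 * ln T%:R ->
      let rate : R := T%:R `^ ((1 - gamma) / (1 - gamma ^+ M)) in
    forall b : R, a1 * rate <= b <= a2 * rate ->
    forall g : nat -> nat,
      (g 0%N)%:Z = Num.floor (b `^ (2 * beta + d%:R)^-1) ->
      (forall i, (1 <= i <= M - 2)%N ->
         (g i)%:Z = Num.floor ((g i.-1)%:R `^ gamma)) ->
      ((2 <= M)%N -> g M.-1 = 1%N) ->
      let w i : R := (\prod_(j < i) g j)%N%:R^-1 in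
    forall t : nat -> nat,
      t 0%N = 0%N -> t M = T -> (forall i, (i < M)%N -> (t i < t i.+1)%N) ->
      (forall i, (1 <= i <= M.-1)%N ->
         (t i)%:Z - (t i.-1)%:Z =
         Num.floor (l T M i * w i `^ (- (2 * beta + d%:R))
                    * ln (T%:R * w i ^+ d))) ->
    forall pi : @policy R d M t,
      measurable_policy pi -> is_BaSEDB T g pi ->
    forall (Q : probability (obs R d) R) (f : bool -> d.-tuple R -> R),
      bandit_class L D0 delta0 cl cu alpha beta Q f ->
    forall (dO : measure_display) (Omega : measurableType dO)
           (P : probability Omega R) (Z : nat -> {RV P >-> obs R d}),
      iid_sample T Q Z ->
      (regret T f Z pi <= (Ctilde * ln T%:R ^+ 2 * rate)%:E)%E].
Proof.
move=> d1 beta01 alpha0 alphabeta L0 D00 delta01 clu D10 a12 gamma.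
have /andP[a10 a1a2] := a12; have /andP[cl0 cucl] := clu.
have beta0 : 0 < beta by case/andP: beta01.
have p0 : 0 < @eff_dim R d beta by exact: eff_dim_gt0.
have gam01 : 0 < gamma < 1 := gam_bounds d1 beta01 alpha0 alphabeta.
have /andP[g0 g1] := gam01.
have gs0 := grid_scale_gt0 beta d1 L0 clu.
have gm0 : 0 < @gap_mass_scale R d alpha beta L D0 delta0 cl cu.
  by rewrite mulr_gt0 ?margin_scale_gt0// powR_gt0// gap_scale_gt0.
have lb0 : 0 < last_batch_scale (@eff_dim R d beta) gamma a1 by exact: expR_gt0.
have K0 : 0 < 1 + 4 * (L * Num.sqrt d%:R `^ beta).
  by rewrite ltr_wpDr// !mulr_ge0 ?powR_ge0// ltW.
have a20 : 0 < a2 by exact: lt_le_trans a1a2.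
have n1296 : 0 < 1296 :> R by rewrite ltr0n.
set gs := grid_scale beta L cu in gs0 *.
set gm := gap_mass_scale alpha beta L D0 delta0 cl cu in gm0 *.
set lb := last_batch_scale _ _ _ in lb0 *.
set K := 1 + _ in K0 *.
(* [kap] is the value that 2 beta ln N must reach for [fine_grid]. The horizons with ln T >= [T1]
   satisfy [fine_grid], those with ln T >= [T2] satisfy [long_horizon], and neither bound depends on
   [M]. *)
pose kap : R := ln (1296 / (gs * cl)).
pose T1 : R := (@eff_dim R d beta * (kap / (2 * beta) + ln 2) - ln (Num.min 1 a1)) / (1 - gamma).
pose T2 : R := (@eff_dim R d beta * ln 2 + d%:R * (ln (Num.max 1 a2) / (1 - gamma))) / (2 * beta).
pose T0 : R := Num.max T1 T2.
pose Ca := 4 * K; pose Cb := 4 * (K * expR T0).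
pose Cc := gm * (D1 * a2 * (gs + 10) + 4 * lb).
have Ca0 : 0 < Ca by rewrite mulr_gt0.
have Cb0 : 0 < Cb by rewrite !mulr_gt0// expR_gt0.
have Cc0 : 0 < Cc by rewrite mulr_gt0// addr_gt0 ?mulr_gt0// addr_gt0.
exists gs, gs, (fun _ _ _ => gs), (Ca + Cb + Cc); split=> //.
- by move=> *; rewrite lexx.
- by rewrite !addr_gt0.
move=> T M T_ge2 M_ge1 MD rate b bE g g0E gE gM w t t0 tM tinc tE pi _ piB Q f Qf
  dO Omega P Z Ziid.
have [inst sm _] := Qf.
have Tr : 0 < T%:R :> R by rewrite ltr0n; exact: leq_trans T_ge2.
have T_ge1 : (1 <= T)%N by exact: leq_trans T_ge2.
have lT : 2^-1 <= ln T%:R :> R.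
  by apply: (le_trans ln2_ge_half); apply: ln_mono => //; rewrite ler_nat.
have rate_ge1 : 1 <= rate.
  rewrite -[leLHS](powRr0 T%:R); apply: ler_powR; first by rewrite ler1n.
  by rewrite divr_ge0 ?subr_ge0 ?(ltW g1)// exprn_ile1// ltW.
have triv := regret_trivial pi beta0 L0 cl0 inst sm Ziid; rewrite -/K in triv.
have log_rate_ge0 : 0 <= ln T%:R ^+ 2 * rate.
  by rewrite mulr_ge0 ?sqr_ge0// (le_trans ler01).
have conclude x y : (regret T f Z pi <= x%:E)%E -> x <= y * (ln T%:R ^+ 2 * rate) ->
    y <= Ca + Cb + Cc -> (regret T f Z pi <= ((Ca + Cb + Cc) * ln T%:R ^+ 2 * rate)%:E)%E.
  move=> xr xy yC; apply: (le_trans xr); rewrite lee_fin -mulrA.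
  by apply: (le_trans xy); exact: ler_wpM2r.
have [M1|M2] := leqP M 1.
  have M1' : M = 1%N by apply/eqP; rewrite eqn_leq M1.
  have rT : rate = T%:R.
    by rewrite /rate M1' expr1 divff ?powRr1 ?(ltW Tr)// gt_eqF// subr_gt0.
  apply: (conclude _ Ca triv); last by rewrite -addrA lerDl addr_ge0// ltW.
  have := le_log_sqr_rate lT (lexx 1) (ltW K0); rewrite mulr1 -/Ca => KC.
  by rewrite -{1}rT mulrC mulrA ler_wpM2r// (le_trans ler01 rate_ge1).
have [Tsmall|Tlarge] := ltP (ln T%:R) T0.
  have TT0 : T%:R <= expR T0 by rewrite -[leLHS]lnK ?posrE// ler_expR ltW.
  apply: (conclude _ Cb triv); last first.
    by rewrite [Ca + Cb]addrC -addrA lerDl addr_ge0// ltW.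
  apply: (@le_trans _ _ (K * expR T0)); first by rewrite mulrC ler_pM2l.
  by apply: le_log_sqr_rate => //; rewrite mulr_ge0 ?expR_ge0// ltW.
have pred_lt : (M.-1 < M)%N by rewrite prednK// (leq_trans _ M2).
(* If a split factor vanished, the default values 0^-1 = 0 and 0 to a nonzero power = 0 would give
   batch [M.-1] length 0, against the strict increase of the grid. *)
have Npos : (0 < grid_size g M.-1)%N.
  rewrite lt0n; apply/eqP => Ng0.
  have M1i : (1 <= M.-1 <= M.-1)%N by rewrite leqnn andbT -ltnS prednK// (leq_trans _ M2).
  have := tE _ M1i; rewrite /w -/(grid_size g M.-1) Ng0 invr0 powR0; last first.
    by rewrite oppr_eq0 gt_eqF.
  rewrite mulr0 mul0r floor0 => /eqP; rewrite subr_eq0 => /eqP [tt].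
  have := tinc M.-2; rewrite prednK; last by case/andP: M1i.
  by rewrite tt ltnn => /(_ (leq_pred M)).
have g_gt0 i : (i < M)%N -> (0 < g i)%N.
  move=> iM; have [iM'|] := ltnP i M.-1; last first.
    move=> Mi; have -> : i = M.-1.
      by apply/eqP; rewrite eqn_leq Mi andbT -ltnS prednK// (leq_trans _ M2).
    by rewrite gM.
  rewrite lt0n; apply/eqP => gi0; move: Npos.
  by rewrite /grid_size (bigD1 (Ordinal iM'))//= gi0 mul0n.
have b0 : 0 < b := b_gt0 a12 T_ge1 bE.
have Nr i : (i <= M)%N -> 0 < (grid_size g i)%:R :> R.
  by move=> iM; rewrite ltr0n; exact: (grid_size_gt0 g_gt0).
have fine_grid i : (1 <= i < M)%N ->
    1296 <= gs * cl * ((grid_size g i)%:R `^ beta) ^+ 2.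
  move=> iM; have /andP[i1 iM'] := iM.
  have gc0 : 0 < gs * cl by exact: mulr_gt0.
  rewrite mulrC -ler_pdivrMr//; apply: le_sqr_powR; [exact: divr_gt0|exact/Nr/ltnW|].
  apply: (long_horizon_fine_grid p0 gam01 a12 T_ge1 M2 bE g_gt0 g0E beta0 _ iM).
  by apply: le_trans Tlarge; rewrite le_max lexx.
have long_horizon i : (1 <= i < M)%N -> 2 <= T%:R * (grid_size g i)%:R^-1 ^+ d :> R.
  move=> /andP[i1 iM']; apply: le_mul_exprV => //; first exact/Nr/ltnW.
  apply: (long_horizon_dense_grid p0 gam01 a12 T_ge1 M2 bE g_gt0 g0E gE beta0 erefl _ iM').
  by apply: le_trans Tlarge; rewrite le_max lexx orbT.
have large := regret_large d1 beta01 alpha0 alphabeta L0 D00 delta01 clu T_ge2 M2 b0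
  g_gt0 g0E gE t0 tM tinc tE fine_grid long_horizon piB Qf Ziid.
have last := last_batch_le p0 gam01 a12 T_ge1 M2 bE g_gt0 g0E gE.
apply: (conclude _ Cc large); last by rewrite lerDr addr_ge0// ltW.
have /andP[_ bhi] := bE.
by apply: regret_constant => //; exact: ltW.
Qed.
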